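(* A $4$-set $\{a,b,c,d\}$ (a multiset of four positive integers) is representable if and only if one of the following holds (equalities being of multisets): (1) $\{a,b,c,d\}=\{4,2,2,1\}$; or (2) $\{a,b,c,d\}=\{4,2,2,2\}$; or (3) $a,b,c,d\le 3$ and $\{a,b,c,d\}\neq\{3,3,3,1\}$.
   Context: All point sets are finite subsets of the Euclidean plane. A point $x$ blocks two points $v$ and $w$ if $x$ is in the interior of the line segment $\overline{vw}$. Two points $v,w$ are visible with respect to a point set $P$ if no point in $P$ blocks $v$ and $w$. A point set $P$ is $k$-blocked if each point in $P$ is assigned one of $k$ colours such that each pair of distinct points $v,w\in P$ are visible with respect to $P$ if and only if $v$ and $w$ are coloured differently. A $k$-set is a multiset of $k$ positive integers. For a $k$-set $\{n_1,\dots,n_k\}$, $P$ is $\{n_1,\dots,n_k\}$-blocked if it is $k$-blocked and for some labelling of the colours by $1,\dots,k$, the $i$-th colour class has exactly $n_i$ points for each $i$. A $k$-set $\{n_1,\dots,n_k\}$ is representable if there is an $\{n_1,\dots,n_k\}$-blocked point set. *)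

(* Defs.v *)
From mathcomp Require Import all_boot all_order all_algebra all_fingroup.
From mathcomp Require Import finmap.
From mathcomp Require Import reals.

Set Implicit Arguments.
Unset Strict Implicit.
Unset Printing Implicit Defensive.

Import Order.TTheory GRing.Theory Num.Theory.
Local Open Scope ring_scope.

Section Blocking.
Variable R : realType.
Local Notation plane := 'rV[R]_2.

Definition blocks (x v w : plane) : Prop :=
  exists t : R, 0 < t < 1 /\ x = (1 - t) *: v + t *: w.

Definition visible (P : {fset plane}) (v w : plane) : Prop :=
  forall x : plane, x \in P -> ~ blocks x v w.

Definition blocked_colouring (k : nat) (P : {fset plane}) (col : P -> 'I_k) :
    Prop :=
  forall v w : P, v != w -> (visible P (val v) (val w) <-> col v != col w).

(* A k-set is given by any enumeration of its elements; the permutation s is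
   the labelling of the colours, so that the order of enumeration is
   irrelevant. *)
Definition set_blocked (k : nat) (n : k.-tuple nat) (P : {fset plane}) : Prop :=
  exists col : P -> 'I_k,
    blocked_colouring col /\
    exists s : 'S_k, forall i : 'I_k,
      #|[set v : P | col v == s i]| = tnth n i.

End Blocking.

Definition representable (R : realType) (k : nat) (n : k.-tuple nat) : Prop :=
  exists P : {fset 'rV[R]_2}, set_blocked n P.

(* Main.v *)
(* Deleting a point that blocks no pair of a blocked set leaves a blocked set.
   By induction on the number of points it therefore suffices to exclude the
   finitely many multisets of class sizes that are forbidden but become allowed
   when one such point is deleted.  If a class S of four points contains every
   point that blocks no pair, then the whole set lies in the convex hull of S:
   either S is in convex position, and the set is a projective 3 x 3 grid, or one
   point of S lies in the triangle spanned by the others, and the class sizes are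
   4, 2, 2, 2.  In both cases a point outside the hull cannot be added.  For the
   sizes 3, 3, 3, 1 the single point D either blocks a side of each of the three
   monochromatic triangles or avoids one of them, whose sides are then blocked
   by two points of one colour and one point of another.
   The remaining statements concern at most twelve points of known role.  They
   are refuted in terms of orientations of triples alone: a blocker gives
   equalities between orientations, and the four-point identity and the
   Grassmann-Pluecker relations propagate signs. *)
Require Import Defs.
From mathcomp Require Import all_boot all_order all_algebra all_fingroup.
From mathcomp Require Import finmap.
From mathcomp Require Import reals.
From mathcomp Require Import ring lra zify.

Set Implicit Arguments.
Unset Strict Implicit.
Unset Printing Implicit Defensive.

Import Order.TTheory GRing.Theory Num.Theory.
Local Open Scope ring_scope.

(** * Planar geometry *)

(** For most of the critical sizes with a class of four, a deletion from any other class leaves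
    sizes that are still forbidden. By minimality every point that can be deleted then has the
    colour of that class, and this is what confines the whole set to its hull. The exceptions are 4,
    3, 2, 1 and 4, 3, 2, 2, which may also lose a point of the class of three and become 4, 2, 2, 1
    or 4, 2, 2, 2, just as 5, 2, 2, 1 and 5, 2, 2, 2 do by losing a point of the class of five.
    Hence the need to know that sets of these two kinds have no extension. The geometric fact used
    throughout is that a line through two points of equal colour carries exactly three points of the
    set. So a blocker is unique, its colour differs from that of the pair it blocks, and every
    further point lies strictly on one side of the line. These are the only facts, besides
    identities between orientations, that the sign calculus consults; a refutation is then a finite
    tree, and its verification is a computation. *)

Lemma count_lt (T : eqType) (a1 a2 : pred T) (t : seq T) (e : T) :
  {in t, forall y, a1 y -> a2 y} -> e \in t -> a2 e -> ~~ a1 e -> (count a1 t < count a2 t)%N.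
Proof.
move=> h he h2 h1.
have -> : count a1 t = count a1 [seq x <- t | a2 x].
  rewrite count_filter; apply: eq_in_count => y hy /=.
  by case: (boolP (a1 y)) => //= /(h y hy) ->.
rewrite -[ltnRHS]size_filter -(count_predC a1 [seq x <- t | a2 x]) -[ltnLHS]addn0 ltn_add2l.
by rewrite -has_count; apply/hasP; exists e => //; rewrite mem_filter h2.
Qed.

Section Plane.
Variable R : realType.
Local Notation plane := 'rV[R]_2.
Implicit Types (p q r u v w x : plane) (s : seq plane).

Definition px p : R := p 0 0.
Definition py p : R := p 0 1.

Lemma plane_eqP p q : px p = px q -> py p = py q -> p = q.
Proof.
move=> hx hy; apply/rowP => i.
have [-> | ->] : i = 0 \/ i = 1.
  by case: i => [[|[|//]]] hi; [left|right]; apply: val_inj.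
  exact: hx.
exact: hy.
Qed.

(** Twice the signed area of the triangle [p q r], positive for counterclockwise order. *)
Definition orient p q r : R :=
  (px q - px p) * (py r - py p) - (py q - py p) * (px r - px p).
(** The scalar product of [x - v] and [w - x]. For [x] on the line through [v] and [w] it is
    positive exactly when [x] lies strictly between them. *)
Definition inner_dot x v w : R :=
  (px x - px v) * (px w - px x) + (py x - py v) * (py w - py x).

Lemma blocksE x v w : blocks x v w <->
  exists t : R, [/\ 0 < t < 1, px x = px v + t * (px w - px v)
    & py x = py v + t * (py w - py v)].
Proof.
split=> [[t [ht ->]]|[t [ht hx hy]]]; exists t; first by split=> //; rewrite /px /py !mxE; ring.
split=> //; apply: plane_eqP; rewrite ?hx ?hy /px /py !mxE; ring.
Qed.

Lemma orient_cycle p q r : orient q r p = orient p q r.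
Proof. rewrite /orient; ring. Qed.

Lemma orient_swap p q r : orient q p r = - orient p q r.
Proof. rewrite /orient; ring. Qed.

Lemma orient_rev p q r : orient r q p = - orient p q r.
Proof. rewrite /orient; ring. Qed.

Lemma orient_flip p q r : orient p r q = - orient p q r.
Proof. rewrite /orient; ring. Qed.

Lemma inner_dot_sym x v w : inner_dot x w v = inner_dot x v w.
Proof. rewrite /inner_dot; ring. Qed.

Lemma orient_gp4 p q r u :
  orient p q r = orient q r u - orient p r u + orient p q u.
Proof. rewrite /orient; ring. Qed.

Lemma orient_gp5 p q r u v :
  orient p q r * orient p u v =
  orient p q u * orient p r v - orient p q v * orient p r u.
Proof. rewrite /orient; ring. Qed.

Lemma blocks_orient x v w u : blocks x v w -> exists t : R,
  [/\ 0 < t < 1, orient v x u = t * orient v w u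
    & orient x w u = (1 - t) * orient v w u].
Proof.
move=> /blocksE [t [ht hx hy]]; exists t; split=> //;
rewrite /orient hx hy; ring.
Qed.

Lemma blocks_collinear x v w : blocks x v w -> orient v x w = 0.
Proof. move=> /blocksE [t [ht hx hy]]; rewrite /orient hx hy; ring. Qed.

Lemma dist2_gt0 v w : v != w ->
  0 < (px w - px v) ^+ 2 + (py w - py v) ^+ 2.
Proof.
move=> vw; rewrite lt_def paddr_eq0 ?sqr_ge0 ?addr_ge0 ?sqr_ge0 // andbT.
apply: contra vw; rewrite !sqrf_eq0 !subr_eq0 => /andP [/eqP h /eqP h'].
by apply/eqP/plane_eqP.
Qed.

Lemma blocks_dot x v w : v != w -> blocks x v w ->
  0 < inner_dot x v w.
Proof.
move=> vw /blocksE [t [/andP [h0 h1] hx hy]].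
rewrite /inner_dot hx hy.
rewrite [X in 0 < X](_ : _ =
  t * (1 - t) * ((px w - px v) ^+ 2 + (py w - py v) ^+ 2)); last by ring.
rewrite mulr_gt0 ?mulr_gt0 ?subr_gt0 //.
exact: dist2_gt0.
Qed.

Lemma dot_blocks x v w : orient v x w = 0 -> 0 < inner_dot x v w ->
  blocks x v w.
Proof.
move=> ho hd.
pose d : R := (px w - px v) ^+ 2 + (py w - py v) ^+ 2.
have hd2 : 0 < d.
  have -> : d = (px x - px v) ^+ 2 + (py x - py v) ^+ 2 + (px w - px x) ^+ 2 + (py w - py
    x) ^+ 2 + 2 * inner_dot x v w.
    by rewrite /d /inner_dot; ring.
  by rewrite ltr_wpDl ?mulr_gt0 // !addr_ge0 ?sqr_ge0.
(* [e / d] is the parameter of the projection of [x] to the line. Lagrange's identity gives [e * (d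
   - e) = d * inner_dot x v w + orient v x w ^+ 2], which places this parameter strictly between 0
   and 1. *)
pose e : R := (px x - px v) * (px w - px v) + (py x - py v) * (py w - py v).
have he : e * (d - e) = d * inner_dot x v w.
  have : e * (d - e) - d * inner_dot x v w = orient v x w * orient v x w
    by rewrite /e /d /inner_dot /orient; ring.
  by rewrite ho mulr0 => /eqP; rewrite subr_eq0 => /eqP.
have he0 : 0 < e * (d - e) by rewrite he mulr_gt0.
have e0 : 0 < e by nra.
have e1 : e < d by rewrite -subr_gt0 -(pmulr_rgt0 _ e0).
apply/blocksE; exists (e / d); split.
- by rewrite divr_gt0 //= ltr_pdivrMr // mul1r.
- apply: (mulfI (lt0r_neq0 hd2)); rewrite mulrDr mulrA mulrCA mulfV ?lt0r_neq0 // mulr1.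
  have : d * px x - (d * px v + e * (px w - px v)) = (py w - py v) * orient v x w
    by rewrite /e /d /orient; ring.
  by rewrite ho mulr0 => /eqP; rewrite subr_eq0 => /eqP.
- apply: (mulfI (lt0r_neq0 hd2)); rewrite mulrDr mulrA mulrCA mulfV ?lt0r_neq0 // mulr1.
  have : d * py x - (d * py v + e * (py w - py v)) = - (px w - px v) * orient v x w
    by rewrite /e /d /orient; ring.
  by rewrite ho mulr0 => /eqP; rewrite subr_eq0 => /eqP.
Qed.

Lemma inner_dot_neq0 p q r : p != q -> p != r -> orient p q r = 0 ->
  inner_dot p q r != 0.
Proof.
move=> /dist2_gt0 hq /dist2_gt0 hr h0; rewrite -sqrf_eq0.
have -> : inner_dot p q r ^+ 2 =
  ((px q - px p) ^+ 2 + (py q - py p) ^+ 2) * ((px r - px p) ^+ 2 + (py r - py p) ^+ 2) -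
    orient p q r ^+ 2.
  by rewrite /inner_dot /orient; ring.
by rewrite h0 expr0n subr0 mulf_neq0 ?lt0r_neq0.
Qed.

(** If neither [p] nor [q] lies between the other two, the inner products at [p] and [q] are both
    negative. For collinear points their product is the squared distance of [p] and [q] times the
    inner product at [r], which is therefore positive. *)
Lemma collinear_blocks p q r : p != q -> p != r -> q != r ->
  orient p q r = 0 -> [\/ blocks p q r, blocks q p r | blocks r p q].
Proof.
move=> pq pr qr h0.
have h1 : orient q p r = 0 by rewrite orient_swap h0 oppr0.
have [h|h] := ltP 0 (inner_dot q p r).
  by constructor 2; apply: dot_blocks.
have [h'|h'] := ltP 0 (inner_dot p q r).
  by constructor 1; apply: dot_blocks.
constructor 3; apply: dot_blocks; first by rewrite orient_cycle -h1 orient_cycle.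
have hp : inner_dot p q r < 0 by rewrite lt_neqAle h' inner_dot_neq0.
have hq : inner_dot q p r < 0 by rewrite lt_neqAle h inner_dot_neq0 // eq_sym.
have hd := dist2_gt0 pq.
rewrite -(pmulr_rgt0 _ hd).
have -> : ((px q - px p) ^+ 2 + (py q - py p) ^+ 2) * inner_dot r p q =
  inner_dot p q r * inner_dot q p r - orient p q r ^+ 2.
  by rewrite /inner_dot /orient; ring.
by rewrite h0 expr0n subr0 nmulr_rgt0.
Qed.

(** Decidable form of [blocks]. The two agree for [v != w], but [blocks v v v] holds whereas
    [btw v v v] is false. *)
Definition btw x v w : bool := (orient v x w == 0) && (0 < inner_dot x v w).

Lemma btwP x v w : v != w -> reflect (blocks x v w) (btw x v w).
Proof.
move=> vw; apply: (iffP andP) => [[/eqP h0 hd]|h]; first exact: dot_blocks.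
by split; [apply/eqP/blocks_collinear|apply: blocks_dot].
Qed.

Lemma btw_sym x v w : btw x v w = btw x w v.
Proof.
by rewrite /btw (orient_rev v x w) oppr_eq0 inner_dot_sym.
Qed.

Lemma btw_neq x v w : btw x v w -> [/\ x != v, x != w & v != w].
Proof.
case/andP => _ hd; split; apply: contraTneq hd => ->;
  rewrite /inner_dot ?subrr ?mul0r ?mulr0 ?addr0 ?ltxx //.
rewrite -leNgt -subr_ge0.
have -> : 0 - ((px x - px w) * (px w - px x) + (py x - py w) * (py w - py x)) =
  (px x - px w) ^+ 2 + (py x - py w) ^+ 2 by ring.
by rewrite addr_ge0 ?sqr_ge0.
Qed.

(** Reduces betweenness on one line to an inequality between parameters, which [nra] can handle. *)
Lemma btw_line o d (x y z : R) : d != 0 ->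
  btw (o + y *: d) (o + x *: d) (o + z *: d) = (0 < (y - x) * (z - y)).
Proof.
move=> d0; rewrite /btw.
have -> : orient (o + x *: d) (o + y *: d) (o + z *: d) = 0.
  by rewrite /orient /px /py !mxE; ring.
have hd : 0 < px d ^+ 2 + py d ^+ 2.
  have := @dist2_gt0 0 d; rewrite eq_sym d0 => /(_ isT).
  by rewrite /px /py !mxE !subr0.
rewrite eqxx /= -(pmulr_rgt0 ((y - x) * (z - y)) hd).
by congr (0 < _); rewrite /inner_dot /px /py !mxE; ring.
Qed.

Lemma orient_line v w u (k : R) :
  orient v (v + k *: (w - v)) u = k * orient v w u.
Proof. rewrite /orient /px /py !mxE; ring. Qed.

Lemma collinear_line v w u : v != w -> orient v w u = 0 ->
  exists k : R, u = v + k *: (w - v).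
Proof.
move=> vw h0; have := dist2_gt0 vw; set d := _ + _ => hd.
exists (((px u - px v) * (px w - px v) + (py u - py v) * (py w - py v)) / d).
apply: plane_eqP; apply: (mulfI (lt0r_neq0 hd)).
  rewrite {2}/px !mxE -/(px _) mulrDr mulrA mulrCA mulfV ?lt0r_neq0 // mulr1 -/(px w) -/(px v).
  have : d * px u - (d * px v + ((px u - px v) * (px w - px v) + (py u - py v) * (py w - py
    v)) * (px w - px v)) =
    - (py w - py v) * orient v w u by rewrite /d /orient; ring.
  by rewrite h0 mulr0 => /eqP; rewrite subr_eq0 => /eqP.
rewrite {2}/py !mxE -/(py _) mulrDr mulrA mulrCA mulfV ?lt0r_neq0 // mulr1 -/(py w) -/(py v).
have : d * py u - (d * py v + ((px u - px v) * (px w - px v) + (py u - py v) * (py w - py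
  v)) * (py w - py v)) =
  (px w - px v) * orient v w u by rewrite /d /orient; ring.
by rewrite h0 mulr0 => /eqP; rewrite subr_eq0 => /eqP.
Qed.

End Plane.

(** * Lines in a blocked set *)

Section Blocked.
Variable R : realType.
Local Notation plane := 'rV[R]_2.
Implicit Types (p q r u v w x : plane) (s : seq plane) (col : plane -> nat).

(** The colouring is defined on the whole plane with values in [nat], so that it can be kept
    unchanged when points are deleted or added. *)
Definition blocked s col := uniq s /\ {in s &, forall v w, v != w ->
  has (fun x => btw x v w) s = (col v == col w)}.

(** Descent on the number of points between [b] and [c]. Since [b] blocks [a, c] and [a, d], and [c]
    blocks [b, d], all four points have one colour. So some [e] blocks [b, c], and [a, b, e, d] is
    again such a quadruple, with fewer points between its middle ones. *)
Lemma blocked_no4 s col a b c d : blocked s col ->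
  a \in s -> b \in s -> c \in s -> d \in s -> btw b a c -> btw c b d -> False.
Proof.
case=> us hs ha + + hd.
have [m] := ubnP (count (fun x => btw x b c) s).
elim: m c => // m IH c hm hb hc hbac hcbd.
have [nba nbc nac] := btw_neq hbac; have [ncb ncd nbd] := btw_neq hcbd.
have w0 : c - b != 0 by rewrite subr_eq0.
have L P Q S (x y z : R) : P = b + x *: (c - b) -> Q = b + y *: (c - b) ->
    S = b + z *: (c - b) -> btw P Q S = (0 < (x - y) * (z - x)).
  by move=> -> -> ->; exact: btw_line.
have [ka ea] : exists k : R, a = b + k *: (c - b).
  apply: collinear_line => //; case/andP: hbac => /eqP h _.
  by rewrite orient_cycle.
have [kd ed] : exists k : R, d = b + k *: (c - b).
  by apply: collinear_line => //; case/andP: hcbd => /eqP h _.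
have eb : b = b + 0 *: (c - b) by rewrite scale0r addr0.
have ec : c = b + 1 *: (c - b) by rewrite scale1r addrCA subrr addr0.
have la := hbac; rewrite (L _ _ _ _ _ _ eb ea ec) in la.
have ld := hcbd; rewrite (L _ _ _ _ _ _ ec eb ed) in ld.
have hbad : btw b a d by rewrite (L _ _ _ _ _ _ eb ea ed); nra.
have [_ _ nad] := btw_neq hbad.
have e1 : col a = col c.
  by apply/eqP; rewrite -hs //; apply/hasP; exists b.
have e2 : col b = col d by apply/eqP; rewrite -hs //; apply/hasP; exists c.
have e3 : col a = col d by apply/eqP; rewrite -hs //; apply/hasP; exists b.
have : has (fun x => btw x b c) s by rewrite hs // -e1 e3 e2.
case/hasP => e he hbec.
have [ke ee] : exists k : R, e = b + k *: (c - b).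
  apply: collinear_line => //; case/andP: hbec => /eqP h _.
  by rewrite orient_flip h oppr0.
have le := hbec; rewrite (L _ _ _ _ _ _ ee eb ec) in le.
apply: (IH e) => //; last by rewrite (L _ _ _ _ _ _ ee eb ed); nra.
- rewrite -ltnS (leq_trans _ hm) // ltnS.
  apply: (@count_lt _ _ _ _ e) => // [x hx hxe|]; last by apply/negP => /btw_neq []; rewrite eqxx.
  have [kx ex] : exists k : R, x = b + k *: (c - b).
    apply: collinear_line => //; case/andP: hxe => /eqP h _.
    move: h; rewrite ee orient_flip orient_line => /eqP.
    by rewrite oppr_eq0 mulf_eq0 => /orP [/eqP k0|/eqP //]; rewrite k0 subrr mul0r ltxx in le.
  rewrite (L _ _ _ _ _ _ ex eb ee) in hxe; rewrite (L _ _ _ _ _ _ ex eb ec); nra.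
- by rewrite (L _ _ _ _ _ _ eb ea ee); nra.
Qed.

(** In each of its four possible positions relative to [v], [b], [w], a further point on the line
    would produce a quadruple excluded by [blocked_no4]. *)
Lemma blocked_collinear s col v b w u : blocked s col ->
  v \in s -> b \in s -> w \in s -> u \in s -> btw b v w ->
  orient v w u = 0 -> u \in [:: v; b; w].
Proof.
move=> bs hv hb hw hu hbvw h0.
have [nbv nbw nvw] := btw_neq hbvw.
have w0 : w - v != 0 by rewrite subr_eq0 eq_sym.
have L P Q S (x y z : R) : P = v + x *: (w - v) -> Q = v + y *: (w - v) ->
    S = v + z *: (w - v) -> btw P Q S = (0 < (x - y) * (z - x)).
  by move=> -> -> ->; exact: btw_line.
have [k eu] := collinear_line nvw h0.
have [t et] : exists k : R, b = v + k *: (w - v).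
  apply: collinear_line => //; case/andP: hbvw => /eqP h _.
  by rewrite orient_flip h oppr0.
have ev : v = v + 0 *: (w - v) by rewrite scale0r addr0.
have ew : w = v + 1 *: (w - v) by rewrite scale1r addrCA subrr addr0.
have lb := hbvw; rewrite (L _ _ _ _ _ _ et ev ew) in lb.
rewrite !inE; apply/or3P.
have [k0|k0|k0] := ltgtP k 0; last by constructor 1; rewrite eu k0 -ev.
  exfalso; apply: (blocked_no4 bs hu hv hb hw); last exact: hbvw.
  by rewrite (L _ _ _ _ _ _ ev eu et); nra.
have [kt|kt|kt] := ltgtP k t; last by constructor 2; rewrite eu kt -et.
  exfalso; apply: (blocked_no4 bs hv hu hb hw).
    by rewrite (L _ _ _ _ _ _ eu ev et); nra.
  by rewrite (L _ _ _ _ _ _ et eu ew); nra.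
have [k1|k1|k1] := ltgtP k 1; last by constructor 3; rewrite eu k1 -ew.
  exfalso; apply: (blocked_no4 bs hv hb hu hw).
    by rewrite (L _ _ _ _ _ _ et ev eu); nra.
  by rewrite (L _ _ _ _ _ _ eu et ew); nra.
exfalso; apply: (blocked_no4 bs hv hb hw hu); first exact: hbvw.
by rewrite (L _ _ _ _ _ _ ew et eu); nra.
Qed.

(** If [b] had the colour of [v], this pair would need a blocker. The only other point on the line
    is [w], and [w] cannot lie between [b] and [v]. *)
Lemma blocked_btw_col s col v b w : blocked s col ->
  v \in s -> b \in s -> w \in s -> btw b v w -> col v = col w /\ col b != col v.
Proof.
move=> bs hv hb hw hbvw; have [us hs] := bs; have [nbv nbw nvw] := btw_neq hbvw.
split; first by apply/eqP; rewrite -hs //; apply/hasP; exists b.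
rewrite -hs //; apply/hasPn => k hk; apply/negP => hkb.
have [nkb nkv _] := btw_neq hkb.
have : k \in [:: v; b; w].
  apply: (blocked_collinear bs) => //.
  have [t et] : exists t : R, b = v + t *: (w - v).
    apply: collinear_line => //; case/andP: hbvw => /eqP h _.
    by rewrite orient_flip h oppr0.
  case/andP: hkb => /eqP h _; move: h.
  rewrite orient_rev orient_flip et orient_line opprK => /eqP; rewrite mulf_eq0.
  case/orP => /eqP // t0; by rewrite et t0 scale0r addr0 eqxx in nbv.
rewrite !inE (negbTE nkb) (negbTE nkv) /= => /eqP ekw; subst k.
case/andP: hkb => _ h1; case/andP: hbvw => _ h2.
have := dist2_gt0 nbw; rewrite ltNge => /negP; apply.
rewrite -oppr_ge0.
have -> : - ((px w - px b) ^+ 2 + (py w - py b) ^+ 2) = inner_dot w b v + inner_dot b v w.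
  by rewrite /inner_dot; ring.
by rewrite addr_ge0 // ltW.
Qed.

Lemma blocked_btw_uniq s col v b b' w : blocked s col ->
  v \in s -> b \in s -> b' \in s -> w \in s ->
  btw b v w -> btw b' v w -> b' = b.
Proof.
move=> bs hv hb hb' hw h h'.
have : b' \in [:: v; b; w].
  apply: (blocked_collinear bs) => //.
  by case/andP: h' => /eqP h0 _; rewrite orient_flip h0 oppr0.
by have [n1 n2 _] := btw_neq h'; rewrite !inE (negbTE n1) (negbTE n2) orbF => /eqP.
Qed.

(** It suffices that the retained part contains the blockers of its own pairs. This covers both the
    deletion of points that block nothing and the restriction to a convex region. *)
Lemma blocked_filter s col (a : pred plane) : blocked s col ->
  {in s & &, forall v w x, a v -> a w -> btw x v w -> a x} ->
  blocked (filter a s) col.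
Proof.
case=> us hs ha; split; first exact: filter_uniq.
move=> v w; rewrite !mem_filter => /andP [av hv] /andP [aw hw] vw.
rewrite -hs //; apply/hasP/hasP => -[x]; rewrite ?mem_filter.
  by case/andP => _ hx hb; exists x.
by move=> hx hb; exists x => //; rewrite mem_filter hx (ha v w).
Qed.

Lemma blocked_perm s s' col : perm_eq s s' -> blocked s col -> blocked s' col.
Proof.
move=> e [us hs]; split; first by rewrite -(perm_uniq e).
move=> v w; rewrite -!(perm_mem e) => hv hw vw.
by rewrite -hs // (eq_has_r (perm_mem e)).
Qed.

Lemma blocked_col s (f : nat -> nat) col : injective f ->
  blocked s col -> blocked s (f \o col).
Proof.
by move=> fi [us hs]; split=> // v w hv hw vw; rewrite hs //= (inj_eq fi).
Qed.

End Blocked.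

(** * Refutation of configurations by sign arithmetic *)

(** A set of possible signs of a real number. The operations below over-approximate the
    corresponding operations on reals. *)
Record signs := Signs { neg_ok : bool; zero_ok : bool; pos_ok : bool }.

Definition any_sign := Signs true true true.
Definition sopp m := Signs (pos_ok m) (zero_ok m) (neg_ok m).
Definition smeet m k :=
  Signs (neg_ok m && neg_ok k) (zero_ok m && zero_ok k) (pos_ok m && pos_ok k).
Definition sadd m k :=
  Signs (neg_ok m || neg_ok k)
    [|| zero_ok m && zero_ok k, neg_ok m && pos_ok k | pos_ok m && neg_ok k]
    (pos_ok m || pos_ok k).
Definition smul m k :=
  Signs (neg_ok m && pos_ok k || pos_ok m && neg_ok k)
    (zero_ok m || zero_ok k)
    (neg_ok m && neg_ok k || pos_ok m && pos_ok k).
(* Signs of an x such that x * y has its sign in m and y has its sign in k. *)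
Definition sdiv m k :=
  let z := zero_ok m && zero_ok k in
  Signs [|| neg_ok m && pos_ok k, pos_ok m && neg_ok k | z]
    (zero_ok m)
    [|| neg_ok m && neg_ok k, pos_ok m && pos_ok k | z].
Definition sempty m := ~~ [|| neg_ok m, zero_ok m | pos_ok m].

Section Allows.
Variable R : realType.
Implicit Types (x y : R) (m k : signs).

Definition allows m x :=
  if x < 0 then neg_ok m else if x == 0 then zero_ok m else pos_ok m.

Lemma allows_opp m x : allows (sopp m) (- x) = allows m x.
Proof. by rewrite /allows oppr_lt0 oppr_eq0; case: ltgtP. Qed.

Lemma allows_meet m k x : allows (smeet m k) x = allows m x && allows k x.
Proof. by rewrite /allows; case: ltgtP. Qed.

Lemma allows_add m k x y : allows m x -> allows k y -> allows (sadd m k) (x + y).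
Proof.
rewrite /allows /=; case: (ltgtP x 0) => hx; case: (ltgtP y 0) => hy hm hk;
 case: (ltgtP (x + y) 0) => h; rewrite ?hm ?hk ?orbT //; exfalso; lra.
Qed.

Lemma allows_mul m k x y : allows m x -> allows k y -> allows (smul m k) (x * y).
Proof.
rewrite /allows /=; case: (ltgtP x 0) => hx; case: (ltgtP y 0) => hy hm hk;
 case: (ltgtP (x * y) 0) => h; rewrite ?hm ?hk ?orbT //; exfalso; nra.
Qed.

Lemma allows_div m k x y : allows m (x * y) -> allows k y -> allows (sdiv m k) x.
Proof.
rewrite /allows /=; case: (ltgtP y 0) => hy; case: (ltgtP x 0) => hx;
 case: (ltgtP (x * y) 0) => h hm hk; rewrite ?hm ?hk ?orbT //; exfalso; nra.
Qed.

Lemma allows_sempty m x : allows m x -> ~~ sempty m.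
Proof. by rewrite /allows /sempty negbK; case: ltgtP => _ ->; rewrite ?orbT. Qed.

End Allows.

(** What is known about numbered points: signs of triples, blockers as triples [(v, b, w)] with [b]
    in the middle, and colours. Signs are stored for sorted triples only, and a missing entry reads
    as [any_sign]. *)
Record state := State {
  sgn_tab : seq (seq (seq signs));
  mid_tab : seq (nat * nat * nat);
  col_tab : seq (option nat) }.

(** The boolean is the parity of the sorting permutation; an odd one reverses the orientation. *)
Definition sort3 (a b c : nat) : bool * nat * nat * nat :=
  if (a < b)%N then
    if (b < c)%N then (false, a, b, c)
    else if (a < c)%N then (true, a, c, b) else (false, c, a, b)
  else if (a < c)%N then (true, b, a, c)
  else if (b < c)%N then (false, b, c, a) else (true, c, b, a).

Definition lookup (t : seq (seq (seq signs))) a b c : signs :=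
  nth any_sign (nth [::] (nth [::] t a) b) c.
Definition update (t : seq (seq (seq signs))) a b c m :=
  let ta := nth [::] t a in let tb := nth [::] ta b in
  set_nth [::] t a (set_nth [::] ta b (set_nth any_sign tb c m)).

Definition get_sgn st a b c : signs :=
  let: (o, x, y, z) := sort3 a b c in
  let m := lookup (sgn_tab st) x y z in if o then sopp m else m.

(** [None] signals a contradiction, here and in every operation on states below; accordingly
    [closes] accepts it. *)
Definition restrict st a b c (k : signs) : option state :=
  let: (o, x, y, z) := sort3 a b c in
  let m := smeet (lookup (sgn_tab st) x y z) (if o then sopp k else k) in
  if sempty m then None
  else Some (State (update (sgn_tab st) x y z m) (mid_tab st) (col_tab st)).

Section Facts.
Variables (R : realType) (s : seq 'rV[R]_2).
Implicit Types (col : 'rV[R]_2 -> nat).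

Definition col_holds col (x : nat * nat) : bool :=
  let: (i, c) := x in (i < size s)%N && (col (nth 0 s i) == c).
Definition sign_holds (x : nat * nat * nat * signs) : bool :=
  let: (a, b, c, m) := x in allows m (orient (nth 0 s a) (nth 0 s b) (nth 0 s c)).
Definition mid_holds (x : nat * nat * nat) : bool :=
  let: (v, b, w) := x in
  [&& (v < size s)%N, (b < size s)%N, (w < size s)%N
    & btw (nth 0 s b) (nth 0 s v) (nth 0 s w)].

End Facts.

Section Checker.
(* The points are numbered from 0 to n - 1, those in nb block no pair, and
   at most [nth 0 caps c] points have colour c. *)
Variables (n : nat) (nb : seq nat) (caps : seq nat).

Definition colour st i : option nat := nth None (col_tab st) i.

Definition differ (c d : option nat) : bool :=
  if (c, d) is (Some i, Some j) then i != j else false.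
Definition agree (c d : option nat) : bool :=
  if (c, d) is (Some i, Some j) then i == j else false.

(** Necessary conditions for [b] to lie between [v] and [w]: a blocked pair is monochromatic, its
    blocker has another colour, and the blocker is unique. *)
Definition mid_ok st v b w : bool :=
  [&& b \notin nb, ~~ differ (colour st v) (colour st w),
    ~~ agree (colour st b) (colour st v), ~~ agree (colour st b) (colour st w)
  & all (fun x : nat * nat * nat => let: (v', b', w') := x in
      ((v' == v) && (w' == w) || (v' == w) && (w' == v)) ==> (b' == b))
      (mid_tab st)].

(** Three distinct collinear points have one of them between the other two. If each of the three
    possibilities violates [mid_ok], the orientation cannot vanish. *)
Definition get st a b c : signs :=
  let m := get_sgn st a b c in
  if zero_ok m && uniq [:: a; b; c] && all (fun i => i < n)%N [:: a; b; c] &&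
    ~~ [|| mid_ok st b a c, mid_ok st a b c | mid_ok st a c b]
  then Signs (neg_ok m) false (pos_ok m) else m.

Definition obind_seq (T : Type) (f : state -> T -> option state) :=
  fix loop (l : seq T) (st : state) : option state :=
    if l is x :: l' then obind (loop l') (f st x) else Some st.

(* If b lies between v and w then the three triples (v, b, u), (b, w, u) and
   (v, w, u) have the same, nonzero, orientation. *)
Definition sync v b w (st : state) u : option state :=
  if u \in [:: v; b; w] then Some st else
  let m := smeet (Signs true false true)
    (smeet (get st v w u) (smeet (get st v b u) (get st b w u))) in
  obind (fun st1 => obind (fun st2 => restrict st2 b w u m)
    (restrict st1 v b u m)) (restrict st v w u m).

Definition add_mid v b w st : option state :=
  if [&& b != v, b != w & mid_ok st v b w] then
    obind (fun st1 => obind_seq (sync v b w) (iota 0 n)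
        (State (sgn_tab st1) ((v, b, w) :: mid_tab st1) (col_tab st1)))
      (restrict st v b w (Signs false true false))
  else None.

Definition add_col i c st : option state :=
  if differ (colour st i) (Some c) then None else
  let t := set_nth None (col_tab st) i (Some c) in
  if (nth 0 caps c < count (fun j => nth None t j == Some c) (iota 0 n))%N
  then None else Some (State (sgn_tab st) (mid_tab st) t).

Definition unused st c := Some c \notin col_tab st.

Definition first_unused st := find (unused st) (iota 0 (size caps)).

(* c is interchangeable with a smaller colour that does not occur either. *)
Definition redundant st c : bool :=
  [&& unused st c, (first_unused st < c)%N
    & nth 0%N caps c == nth 0%N caps (first_unused st)].

(* Gp4 a b c d and Gp5 a b c d e narrow the sign of the triple (a, b, c) by the
   four-point identity and by a Grassmann-Pluecker relation.  The branching
   rules are Mid v w, over the blocker of two points of equal colour; Sgn a b c,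
   over negative, positive, and the point lying between the other two; and
   Col i, over the colour of i. *)
Inductive cert :=
| Stop
| Gp4 of nat & nat & nat & nat & cert
| Gp5 of nat & nat & nat & nat & nat & cert
| Sync of nat & nat & nat & nat & cert
| Mid of nat & nat & (nat -> cert)
| Sgn of nat & nat & nat & cert & cert & (nat -> cert)
| Col of nat & (nat -> cert).

(** A branch that is not listed receives [Stop], so it must be contradictory as soon as it is
    opened. [Clash] is the extreme case in which every candidate for the blocker fails at once. *)
Definition case (l : seq (nat * cert)) (i : nat) : cert :=
  nth Stop (map snd l) (index i (map fst l)).

Definition Clash v w := Mid v w (fun => Stop).

Definition closes (f : state -> bool) (o : option state) :=
  if o is Some st then f st else true.

Fixpoint refutes (c : cert) (st : state) : bool :=
  match c with
  | Stop => false
  | Gp4 a b e d c' =>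
      closes (refutes c') (restrict st a b e
        (sadd (sadd (get st b e d) (sopp (get st a e d))) (get st a b d)))
  | Gp5 a b e d f c' =>
      closes (refutes c') (restrict st a b e (sdiv
        (sadd (smul (get st a b d) (get st a e f))
          (sopp (smul (get st a b f) (get st a e d)))) (get st a d f)))
  | Sync v b w u c' =>
      (((v, b, w) \in mid_tab st) && (u < n)%N) &&
      closes (refutes c') (sync v b w st u)
  | Mid v w k =>
      [&& v != w, (v < n)%N, (w < n)%N, agree (colour st v) (colour st w)
      & all (fun b => closes (refutes (k b)) (add_mid v b w st)) (iota 0 n)]
  | Sgn a b e cn cp k =>
      [&& uniq [:: a; b; e], all (fun i => i < n)%N [:: a; b; e],
        closes (refutes cn) (restrict st a b e (Signs true false false)),
        closes (refutes cp) (restrict st a b e (Signs false false true)),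
        closes (refutes (k a)) (add_mid b a e st),
        closes (refutes (k b)) (add_mid a b e st)
      & closes (refutes (k e)) (add_mid a e b st)]
  | Col i k =>
      (i < n)%N && all (fun c => redundant st c || closes (refutes (k c)) (add_col i c st))
        (iota 0 (size caps))
  end.

(** * Soundness of the refutation checker *)

Section Soundness.
Variable R : realType.
Variable s : seq 'rV[R]_2.
Hypothesis sn : size s = n.

Let p i : 'rV[R]_2 := nth 0 s i.
Hypothesis hnb : forall z v w, z \in nb -> v \in s -> w \in s -> ~~ btw (p z) v w.

Let pn i : (i < n)%N -> p i \in s.
Proof. by move=> hi; rewrite mem_nth ?sn. Qed.

Section Coloured.
Variable col : 'rV[R]_2 -> nat.
Hypothesis bs : blocked s col.
Hypothesis hcap : forall c, (count (fun x => col x == c) s <= nth 0 caps c)%N.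

Record sound st : Prop := Sound {
  sound_sgn : forall a b c, allows (get_sgn st a b c) (orient (p a) (p b) (p c));
  sound_mid : forall v b w, (v, b, w) \in mid_tab st ->
    [/\ v < n, b < n & w < n]%N /\ btw (p b) (p v) (p w);
  sound_col : forall i c, colour st i = Some c -> (i < n)%N /\ col (p i) = c }.

Definition osound (o : option state) := exists2 st, o = Some st & sound st.

Lemma osound_closes f o : osound o -> (forall st, sound st -> ~~ f st) ->
  ~~ closes f o.
Proof. by case=> st -> hs; apply. Qed.

Lemma osound_bind f o : osound o -> (forall st, sound st -> osound (f st)) ->
  osound (obind f o).
Proof. by case=> st -> hs; apply. Qed.

Lemma sort3P a b c : let: (o, x, y, z) := sort3 a b c in
  orient (p a) (p b) (p c) =
    if o then - orient (p x) (p y) (p z) else orient (p x) (p y) (p z).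
Proof.
rewrite /sort3; case: (ltnP a b) => _; [case: (ltnP b c) => _; last case: (ltnP a c) => _
  | case: (ltnP a c) => _; last case: (ltnP b c) => _]; rewrite // /orient; ring.
Qed.

Lemma lookup_update t x y z m a b c : lookup (update t x y z m) a b c =
  if [&& a == x, b == y & c == z] then m else lookup t a b c.
Proof.
rewrite /lookup /update nth_set_nth /=; case: eqP => //= ->.
by rewrite nth_set_nth /=; case: eqP => //= ->; rewrite nth_set_nth /=; case: eqP => //= ->.
Qed.

Lemma restrict_sound st a b c k : sound st ->
  allows k (orient (p a) (p b) (p c)) -> osound (restrict st a b c k).
Proof.
move=> hst hk; rewrite /restrict.
have := sort3P a b c; have := sound_sgn hst a b c; rewrite /get_sgn.
case E: (sort3 a b c) => [[[o x] y] z] h eo.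
set m := smeet _ _.
have hm : allows m (orient (p x) (p y) (p z)).
  rewrite allows_meet; case: o {E m} h eo => h eo.
    by rewrite -allows_opp -eo h /= -allows_opp -eo.
  by rewrite -eo h.
rewrite (negbTE (allows_sempty hm)); eexists; first by [].
split=> [a' b' c'|v d w|i d]; first last.
- exact: (sound_col hst).
- exact: (sound_mid hst).
rewrite /get_sgn /=.
have := sort3P a' b' c'; have := sound_sgn hst a' b' c'; rewrite /get_sgn.
case: (sort3 a' b' c') => [[[o' x'] y'] z'] h' eo'.
rewrite lookup_update; case E' : [&& x' == x, _ & _] => //.
case/and3P: E' => /eqP ex /eqP ey /eqP ez; subst.
by rewrite eo'; case: (o'); rewrite ?allows_opp.
Qed.

Lemma p_neq i j : (i < n)%N -> (j < n)%N -> i != j -> p i != p j.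
Proof. by case: bs => us _ hi hj; rewrite nth_uniq ?sn. Qed.

Lemma mid_ok_sound st v b w : sound st -> (v < n)%N -> (b < n)%N -> (w < n)%N ->
  btw (p b) (p v) (p w) -> mid_ok st v b w.
Proof.
move=> hst hv hb hw h; rewrite /mid_ok.
have [cvw cbv] := blocked_btw_col bs (pn hv) (pn hb) (pn hw) h.
apply/and5P; split.
- by apply/negP => hz; have := hnb hz (pn hv) (pn hw); rewrite h.
- rewrite /differ; case Ev: (colour st v) => [i|] //; case Ew: (colour st w) => [j|] //.
  have [_ <-] := sound_col hst Ev; have [_ <-] := sound_col hst Ew.
  by rewrite cvw eqxx.
- rewrite /agree; case Ev: (colour st b) => [i|] //; case Ew: (colour st v) => [j|] //.
  by have [_ <-] := sound_col hst Ev; have [_ <-] := sound_col hst Ew.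
- rewrite /agree; case Ev: (colour st b) => [i|] //; case Ew: (colour st w) => [j|] //.
  by have [_ <-] := sound_col hst Ev; have [_ <-] := sound_col hst Ew; rewrite -cvw.
apply/allP => -[[v' b'] w'] hm; apply/implyP => e.
have [[hv' hb' hw'] h'] := sound_mid hst hm.
apply/negPn/negP => /(p_neq hb' hb) /eqP; apply.
apply: (blocked_btw_uniq bs (pn hv) (pn hb) (pn hb') (pn hw)) => //.
by case/orP: e => /andP [/eqP <- /eqP <-] //; rewrite btw_sym.
Qed.

Lemma get_sound st a b c : sound st -> allows (get st a b c) (orient (p a) (p b) (p c)).
Proof.
move=> hst; rewrite /get; have := sound_sgn hst a b c.
case: ifP => // /andP [/andP [/andP [_ /and3P [hab hac _]] /and4P [ha hb hc _]] hno] h.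
move: hab; rewrite !inE negb_or => /andP [ab ac]; move: hac; rewrite inE => bc.
have h0 : orient (p a) (p b) (p c) != 0.
  apply/negP => /eqP h0; case/negP: hno.
  have [||] := collinear_blocks (p_neq ha hb ab) (p_neq ha hc ac) (p_neq hb hc bc) h0.
  - move=> /(btwP _ (p_neq hb hc bc)) /(mid_ok_sound hst hb ha hc) ->; by rewrite ?orbT.
  - move=> /(btwP _ (p_neq ha hc ac)) /(mid_ok_sound hst ha hb hc) ->; by rewrite ?orbT.
  - move=> /(btwP _ (p_neq ha hb ab)) /(mid_ok_sound hst ha hc hb) ->; by rewrite ?orbT.
by move: h; rewrite /allows (negbTE h0).
Qed.

Lemma sync_sound st v b w u : sound st -> (v < n)%N -> (b < n)%N -> (w < n)%N -> (u < n)%N ->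
  btw (p b) (p v) (p w) -> osound (sync v b w st u).
Proof.
move=> hst hv hb hw hu h; rewrite /sync; case: ifP => hin; first by exists st.
(* The line through [v], [b] and [w] contains no fourth point of the set. *)
have h0 : orient (p v) (p w) (p u) != 0.
  apply: contraFneq hin => h0.
  have := blocked_collinear bs (pn hv) (pn hb) (pn hw) (pn hu) h h0.
  by rewrite !inE !nth_uniq ?sn //; case: bs.
have [_ _ nvw] := btw_neq h.
have [t [/andP [t0 t1] e1 e2]] := blocks_orient (p u) (elimT (btwP _ nvw) h).
set m := smeet _ _.
have H x : x = orient (p v) (p w) (p u) \/ x = orient (p v) (p b) (p u) \/
    x = orient (p b) (p w) (p u) -> allows m x.
  have sg y : 0 < y -> forall k,
    allows k (y * orient (p v) (p w) (p u)) = allows k (orient (p v) (p w) (p u)).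
    move=> y0 k; rewrite /allows pmulr_rlt0 // mulf_eq0 gt_eqF //.
  have hm : allows m (orient (p v) (p w) (p u)).
    rewrite /m !allows_meet; apply/and4P; split.
    - by rewrite /allows (negbTE h0); case: ifP.
    - exact: get_sound.
    - by rewrite -(sg t) // -e1; apply: get_sound.
    - by rewrite -(sg (1 - t)) ?subr_gt0 // -e2; apply: get_sound.
  by case=> [->|[->|->]] //; rewrite ?e1 ?e2 sg // subr_gt0.
apply: osound_bind => [|st1 hs1]; first by apply: restrict_sound => //; apply: H; left.
apply: osound_bind => [|st2 hs2]; first by apply: restrict_sound => //; apply: H; right; left.
by apply: restrict_sound => //; apply: H; right; right.
Qed.

Lemma add_mid_sound st v b w : sound st -> (v < n)%N -> (b < n)%N -> (w < n)%N ->
  btw (p b) (p v) (p w) -> osound (add_mid v b w st).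
Proof.
move=> hst hv hb hw h; rewrite /add_mid mid_ok_sound // andbT.
have [nbv nbw nvw] := btw_neq h.
have -> : b != v by apply: contraNneq nbv => ->.
have -> /= : b != w by apply: contraNneq nbw => ->.
apply: osound_bind => [|st1 hs1].
  apply: restrict_sound => //; case/andP: h => /eqP -> _.
  by rewrite /allows ltxx eqxx.
have {hs1} : sound (State (sgn_tab st1) ((v, b, w) :: mid_tab st1) (col_tab st1)).
  split=> [a' b' c'|v' b' w'|i d]; first exact: (sound_sgn hs1).
    by rewrite inE => /orP [/eqP [-> -> ->]|/(sound_mid hs1)].
  exact: (sound_col hs1).
move: (State _ _ _) => st2; have : all (fun u => u < n)%N (iota 0 n).
  by apply/allP => u; rewrite mem_iota.
elim: (iota 0 n) st2 => [|u l IH] st2 /=; first by exists st2.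
case/andP => hu hl hs2; apply: osound_bind; first exact: sync_sound.
by move=> st3; apply: IH.
Qed.

Lemma add_col_sound st i : sound st -> (i < n)%N -> osound (add_col i (col (p i)) st).
Proof.
move=> hst hi; rewrite /add_col.
have -> : differ (colour st i) (Some (col (p i))) = false.
  by rewrite /differ; case E: (colour st i) => [c|] //; have [_ ->] := sound_col hst E;
    rewrite eqxx.
set t := set_nth _ _ _ _.
have ht j c : nth None t j = Some c -> (j < n)%N /\ col (p j) = c.
  rewrite nth_set_nth /=; case: eqP => [-> [<-] //|_]; exact: (sound_col hst).
case: ifP => [|_]; last first.
  eexists; first by []; split=> [a' b' c'|v' b' w'|j d].
  - exact: (sound_sgn hst).
  - exact: (sound_mid hst).
  - exact: ht.
rewrite ltnNge => /negP []; apply: leq_trans (hcap (col (p i))).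
have -> : count (fun x => col x == col (p i)) s = count (fun j =>
  col (p j) == col (p i)) (iota 0 n).
  by rewrite -[in LHS](mkseq_nth 0 s) /mkseq count_map sn.
by apply: sub_count => j /eqP /ht [_ ->].
Qed.

End Coloured.

Definition swapn (a b x : nat) := if x == a then b else if x == b then a else x.

Lemma swapnK a b : involutive (swapn a b).
Proof.
move=> x; rewrite /swapn; have [->|xa] := eqVneq x a.
  by have [->|ba] := eqVneq b a; rewrite ?eqxx.
by have [->|xb] := eqVneq x b; rewrite ?eqxx // (negbTE xa) (negbTE xb).
Qed.

Let irrefutable c := forall col st, blocked s col ->
  (forall d, (count (fun x => col x == d) s <= nth 0 caps d)%N) ->
  {in s, forall x, col x < size caps}%N -> sound col st -> ~~ refutes c st.

Lemma refutes_sound c : irrefutable c.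
Proof.
elim: c => [|a b d e c IH|a b d e f c IH|v b w u c IH|v w k IH
  |a b d c1 IH1 c2 IH2 k IH|i k IH] col st bs hcap hcol hst //=;
have cl c' o : irrefutable c' -> osound col o -> ~~ closes (refutes c') o
  by move=> g ho; apply: (osound_closes ho) => st' hs; exact: (g col).
- apply: (cl _ _ IH); apply: restrict_sound => //.
  by rewrite (orient_gp4 _ _ _ (p e)); apply: allows_add;
    [apply: allows_add|]; rewrite ?allows_opp; apply: (get_sound bs).
- apply: (cl _ _ IH); apply: restrict_sound => //.
  apply: (@allows_div _ _ _ _ (orient (p a) (p e) (p f))); last exact: (get_sound bs).
  rewrite orient_gp5; apply: allows_add; rewrite ?allows_opp;
    apply: allows_mul; exact: (get_sound bs).
- apply/negP => /andP [/andP [hm hu]]; apply/negP.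
  have [[hv hb hw] h] := sound_mid hst hm.
  by apply: (cl _ _ IH); apply: (sync_sound bs).
- apply/negP => /and5P [vw hv hw hc /allP ha].
  have e : col (p v) = col (p w).
    move: hc; rewrite /agree; case Ev: (colour st v) => [x|] //;
      case Ew: (colour st w) => [y|] //.
    by have [_ ->] := sound_col hst Ev; have [_ ->] := sound_col hst Ew => /eqP.
  have : has (fun x => btw x (p v) (p w)) s.
    by case: (bs) => _ hs; rewrite (hs _ _ (pn hv) (pn hw) (p_neq bs hv hw vw)) e.
  case/hasP => x hx hb; move/(nthP 0): hx => [b]; rewrite sn => hbn ex; subst x.
  move: (ha b); rewrite mem_iota /= => /(_ hbn); apply/negP.
  by apply: (cl _ _ (IH b)); apply: (add_mid_sound bs).
- apply/negP => /and5P [/and3P [hab hac _] /and4P [ha hb hd _] hn hp /and3P [k1 k2 k3]].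
  move: hab; rewrite !inE negb_or => /andP [ab ad]; move: hac; rewrite inE => bd.
  have [[ab' ad'] bd'] := (p_neq bs ha hb ab, p_neq bs ha hd ad, p_neq bs hb hd bd).
  have [h0|h0|h0] := ltgtP (orient (p a) (p b) (p d)) 0.
  + move: hn; apply/negP; apply: (cl _ _ IH1); apply: restrict_sound => //.
    by rewrite /allows h0.
  + move: hp; apply/negP; apply: (cl _ _ IH2); apply: restrict_sound => //.
    by rewrite /allows ltNge (ltW h0) /= gt_eqF.
  have [||] := collinear_blocks ab' ad' bd' h0.
  + move=> /(btwP _ bd') /(add_mid_sound bs hst hb ha hd) h.
    by move: k1; apply/negP; exact: (cl _ _ (IH a)).
  + move=> /(btwP _ ad') /(add_mid_sound bs hst ha hb hd) h.
    by move: k2; apply/negP; exact: (cl _ _ (IH b)).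
  + move=> /(btwP _ ab') /(add_mid_sound bs hst ha hd hb) h.
    by move: k3; apply/negP; exact: (cl _ _ (IH d)).
- apply/negP => /andP [hi /allP ha]; clear cl.
wlog nr : col bs hcap hcol hst / ~~ redundant st (col (p i)).
  move=> W; case: (boolP (redundant st (col (p i)))) => [|h]; last exact: (W col).
  case/and3P; set c1 := col _; set c0 := first_unused st => u1 c01 /eqP ecap.
  have hc1 : (c1 < size caps)%N by rewrite hcol ?pn.
  have u0 : unused st c0.
    have hf : has (unused st) (iota 0 (size caps)).
      by apply/hasP; exists c1 => //; rewrite mem_iota.
    have := nth_find 0%N hf; rewrite nth_iota ?add0n //.
    by rewrite has_find size_iota in hf.
  apply: (W (swapn c1 c0 \o col)).
  - exact: blocked_col (inv_inj (swapnK _ _)) bs.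
  - move=> d; rewrite (eq_count (a2 := fun x => col x == swapn c1 c0 d)); last first.
      by move=> x /=; rewrite -(inj_eq (inv_inj (swapnK c1 c0))) swapnK.
    apply: leq_trans (hcap _) _; rewrite /swapn.
    by case: eqP => [->|_]; [rewrite ecap|case: eqP => [->|//]; rewrite ecap].
  - move=> x hx /=; rewrite /swapn; case: ifP => _; first exact: ltn_trans c01 hc1.
    by case: ifP => _ //; exact: hcol.
  (* Neither of the exchanged colours occurs in the state, so the state stays true for the new
     colouring. *)
  - split=> [a' b' c'|v' b' w'|j d /[dup] hj]; first exact: (sound_sgn hst).
      exact: (sound_mid hst).
    case/(sound_col hst) => hjn <-; split=> //=; rewrite /swapn.
    have inu : forall d', colour st j = Some d' -> ~~ unused st d'.
      move=> d' e; rewrite /unused negbK -e mem_nth //.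
      by case: ltnP => // /(nth_default None); rewrite -/(colour st j) e.
    have hcj := (sound_col hst hj).2; rewrite hcj.
    have := inu _ hj; case: eqP => [->|_]; first by rewrite u1.
    by case: eqP => [->|//]; rewrite u0.
  have -> : (swapn c1 c0 \o col) (p i) = c0 by rewrite /swapn /= eqxx.
  by rewrite /redundant -/c0 ltnn andbF.
move: (ha (col (p i))); rewrite mem_iota /= hcol ?pn // => /(_ isT).
rewrite (negbTE nr) /=; apply/negP.
have ho : osound col (add_col i (col (p i)) st) by apply: (add_col_sound).
by apply: (osound_closes ho) => st' hs; exact: (IH _ col).
Qed.

(** Colours and signs are entered before the blockers because [add_mid] consults both. *)
Definition init (sg : seq (nat * nat * nat * signs)) (md : seq (nat * nat * nat))
    (cl : seq (nat * nat)) : option state :=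
  obind (obind_seq (fun st x => let: (v, b, w) := x in add_mid v b w st) md)
  (obind (obind_seq (fun st x => let: (a, b, c, m) := x in restrict st a b c m) sg)
  (obind_seq (fun st x => let: (i, c) := x in add_col i c st) cl (State [::] [::] [::]))).

Lemma osound_seq T col (P : pred T) (f : state -> T -> option state) (l : seq T) st :
  (forall st' x, P x -> sound col st' -> osound col (f st' x)) ->
  all P l -> sound col st -> osound col (obind_seq f l st).
Proof.
move=> hf; elim: l st => [|x l IH] st /=; first by exists st.
by case/andP => hx hl hst; apply: osound_bind (hf _ _ hx hst) _ => st'; exact: IH.
Qed.

Lemma refutation c sg md cl col :
  closes (refutes c) (init sg md cl) -> blocked s col ->
  (forall d, (count (fun x => col x == d) s <= nth 0 caps d)%N) ->
  {in s, forall x, col x < size caps}%N ->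
  all (col_holds s col) cl -> all (sign_holds s) sg -> all (mid_holds s) md ->
  False.
Proof.
move=> hr bs hcap hcol hcl hsg hmd.
suff ho : osound col (init sg md cl).
  case: ho hr => st -> hst /=; apply/negP; exact: refutes_sound hst.
rewrite /init; apply: osound_bind; first apply: osound_bind.
- apply: osound_seq hcl _ => [st [i d]|].
    by rewrite /col_holds sn => /andP [hi /eqP <-] hst; exact: (add_col_sound).
  split=> // [a b d|i d]; last by rewrite /colour nth_nil.
  rewrite /get_sgn; case: (sort3 a b d) => [[[o x] y] z].
  by rewrite /lookup !nth_nil; case: o; rewrite /= /allows; case: ltgtP.
- move=> st; apply: osound_seq hsg => st' [[[a b] d] m] h hst'.
  exact: restrict_sound.
- move=> st; apply: osound_seq hmd => st' [[v b] w].
  by rewrite /mid_holds sn => /and4P [hv hb hw h] hst'; exact: (add_mid_sound bs).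
Qed.

End Soundness.
End Checker.

(** * Certificates *)

Section Certificates.
Local Open Scope nat_scope.

(* The certificates were found by computer search.  In the triangle
   certificates the class of colour 0 consists of the corners 0, 1, 2 and the
   inner point 3; the points 4, 5, 6 block the inner point from 0, 1, 2 and the
   points 7, 8, 9 block the sides opposite 0, 1, 2.  In the quadrilateral
   certificates this class is 0, 1, 2, 3 in convex position and 4, 5, 6, 7 block
   the sides 01, 12, 23, 30. *)

Definition neg := Signs true false false.
Definition pos := Signs false false true.
Definition nonneg := Signs false true true.

(** Only the points 4 to [k + 3] are placed in the closed triangle. A point added to the
    configuration gets a larger number and is left free. *)
Definition triangle_signs k : seq (nat * nat * nat * signs) :=
  [:: (0, 1, 3, pos); (1, 2, 3, pos); (2, 0, 3, pos)] ++
  flatten [seq [:: (0, 1, u, nonneg); (1, 2, u, nonneg); (2, 0, u, nonneg)] | u <- iota 4 k].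
Definition triangle_mids : seq (nat * nat * nat) :=
  [:: (0, 4, 3); (1, 5, 3); (2, 6, 3); (1, 7, 2); (2, 8, 0); (0, 9, 1)].
Definition quad_signs k : seq (nat * nat * nat * signs) :=
  [:: (0, 1, 2, pos); (0, 1, 3, pos); (0, 2, 3, pos); (1, 2, 3, pos)] ++
  flatten [seq [:: (0, 1, u, nonneg); (1, 2, u, nonneg); (2, 3, u, nonneg);
    (3, 0, u, nonneg)] | u <- iota 4 k].
Definition quad_mids : seq (nat * nat * nat) := [:: (0, 4, 1); (1, 5, 2); (2, 6, 3); (3, 7, 0)].
Definition four_zero : seq (nat * nat) := [:: (0, 0); (1, 0); (2, 0); (3, 0)].

(** Excludes convex position for the sizes 4, 2, 2, 2, all ten points being in the hull. *)
Definition quad10_cert : cert :=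
  Gp5 0 5 6 1 2 (Gp5 1 6 7 0 3 (Gp5 5 4 6 0 1 (Gp5 6 4 7 0 1 (Col 4 (case [:: (1, Mid 1 3 (case [::
  (8, Gp5 7 4 8 0 1 (Gp5 6 5 8 1 2 (Mid 0 2 (case [:: (8,
    Gp5 7 6 8 0 2 (Gp5 5 4 8 0 1 (Col 5 (case
  [:: (1, Mid 4 5 (case [:: (9, Col 6 (case [:: (2, Col 7 (case [:: (2, Clash 6 7);
    (3, Col 8 (case
  [:: (2, Clash 6 8); (3, Clash 7 8)]))]))]))]));
    (2, Col 6 (case [:: (1, Mid 4 6 (case [:: (8, Col
  7 (case [:: (2, Col 8 (case [:: (3, Col 9 (case [:: (3, Clash 8 9)]))]));
    (3, Col 8 (case [:: (2,
  Mid 5 8 (case [:: (9, Col 9 (case [:: (3, Clash 7 9)]))]));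
    (3, Mid 7 8 (case [:: (9, Col 9 (case
  [:: (2, Clash 5 9)]))]))]))])); (9, Col 7 (case [:: (2, Col 8 (case [:: (3, Col 9 (case [:: (3,
  Clash 8 9)]))])); (3, Col 8 (case [:: (2, Mid 5 8 (case [:: (9, Col 9 (case [:: (3, Clash 7
  9)]))])); (3, Mid 7 8 (case [:: (9, Col 9 (case [:: (2, Clash 5 9)]))]))]))]))])); (2, Mid 5 6
  (case [:: (9, Col 7 (case [:: (1, Clash 4 7); (3, Col 8 (case [:: (1, Clash 4 8); (3, Clash 7
  8)]))]))])); (3, Col 7 (case [:: (1, Mid 4 7 (case [:: (9, Col 8 (case [:: (2, Clash 5 8); (3,
  Clash 6 8)]))])); (2, Mid 5 7 (case [:: (8, Col 8 (case [:: (1, Mid 4 8 (case [:: (9,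
    Col 9 (case
  [:: (3, Clash 6 9)]))])); (3, Mid 6 8 (case [:: (9, Col 9 (case [:: (1, Clash 4 9)]))]))])); (9,
  Col 8 (case [:: (1, Mid 4 8 (case [:: (9, Col 9 (case [:: (3, Clash 6 9)]))]));
    (3, Mid 6 8 (case
  [:: (9, Col 9 (case [:: (1, Clash 4 9)]))]))]))]));
    (3, Mid 6 7 (case [:: (9, Col 8 (case [:: (1,
  Clash 4 8); (2, Clash 5 8)]))]))]))]))]))));
    (9, Gp5 7 6 9 0 2 (Gp5 5 4 9 0 1 (Col 5 (case [:: (1,
  Mid 4 5 (case [:: (8, Col 6 (case [:: (2, Col 7 (case [:: (2, Clash 6 7);
    (3, Col 9 (case [:: (2,
  Clash 6 9); (3, Clash 7 9)]))]))]))]));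
    (2, Col 6 (case [:: (1, Mid 4 6 (case [:: (8, Col 7 (case
  [:: (2, Col 8 (case [:: (3, Col 9 (case [:: (3, Clash 8 9)]))]));
    (3, Col 8 (case [:: (2, Mid 5 8
  (case [:: (9, Col 9 (case [:: (3, Clash 7 9)]))]));
    (3, Mid 7 8 (case [:: (9, Col 9 (case [:: (2,
  Clash 5 9)]))]))]))])); (9, Col 7 (case [:: (2, Col 8 (case [:: (3, Col 9 (case [:: (3, Clash 8
  9)]))])); (3, Col 8 (case [:: (2, Mid 5 8 (case [:: (9, Col 9 (case [:: (3,
    Clash 7 9)]))])); (3,
  Mid 7 8 (case [:: (9, Col 9 (case [:: (2, Clash 5 9)]))]))]))]))]));
    (2, Mid 5 6 (case [:: (9, Col
  7 (case [:: (1, Clash 4 7); (3, Col 8 (case [:: (1, Clash 4 8); (3, Clash 7 8)]))]))]));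
    (3, Col 7
  (case [:: (1, Mid 4 7 (case [:: (9, Col 8 (case [:: (2, Clash 5 8); (3, Clash 6 8)]))]));
    (2, Mid
  5 7 (case [:: (8, Col 8 (case [:: (1, Mid 4 8 (case [:: (9, Col 9 (case [:: (3,
    Clash 6 9)]))]));
  (3, Mid 6 8 (case [:: (9, Col 9 (case [:: (1, Clash 4 9)]))]))]));
    (9, Col 8 (case [:: (1, Mid 4 8
  (case [:: (9, Col 9 (case [:: (3, Clash 6 9)]))]));
    (3, Mid 6 8 (case [:: (9, Col 9 (case [:: (1,
  Clash 4 9)]))]))]))])); (3, Mid 6 7 (case [:: (8, Col 9 (case [:: (1, Clash 4 9); (2, Clash 5
  9)]))]))]))]))]))))])))); (9, Gp5 7 4 9 0 1 (Gp5 6 5 9 1 2 (Mid 0 2 (case [:: (8, Gp5 7 6 8 0 2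
  (Gp5 5 4 8 0 1 (Col 5 (case [:: (1, Mid 4 5 (case [:: (9, Col 6 (case [:: (2,
    Col 7 (case [:: (2,
  Clash 6 7); (3, Col 8 (case [:: (2, Clash 6 8); (3, Clash 7 8)]))]))]))])); (2, Col 6 (case [::
  (1, Mid 4 6 (case [:: (8, Col 7 (case [:: (2, Col 8 (case [:: (3, Col 9 (case [:: (3, Clash 8
  9)]))])); (3, Col 8 (case [:: (2, Mid 5 8 (case [:: (9, Col 9 (case [:: (3,
    Clash 7 9)]))])); (3,
  Mid 7 8 (case [:: (9, Col 9 (case [:: (2, Clash 5 9)]))]))]))])); (9, Col 7 (case [:: (2, Col 8
  (case [:: (3, Col 9 (case [:: (3, Clash 8 9)]))]));
    (3, Col 8 (case [:: (2, Mid 5 8 (case [:: (9,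
  Col 9 (case [:: (3, Clash 7 9)]))])); (3, Mid 7 8 (case [:: (9, Col 9 (case [:: (2, Clash 5
  9)]))]))]))]))])); (2, Mid 5 6 (case [:: (8, Col 7 (case [:: (1, Clash 4 7); (3, Col 9 (case [::
  (1, Clash 4 9); (3, Clash 7 9)]))]))]));
    (3, Col 7 (case [:: (1, Mid 4 7 (case [:: (8, Col 9 (case
  [:: (2, Clash 5 9); (3, Clash 6 9)]))])); (2, Mid 5 7 (case [:: (8, Col 8 (case [:: (1, Mid 4 8
  (case [:: (9, Col 9 (case [:: (3, Clash 6 9)]))]));
    (3, Mid 6 8 (case [:: (9, Col 9 (case [:: (1,
  Clash 4 9)]))]))])); (9, Col 8 (case [:: (1, Mid 4 8 (case [:: (9, Col 9 (case [:: (3, Clash 6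
  9)]))])); (3, Mid 6 8 (case [:: (9, Col 9 (case [:: (1, Clash 4 9)]))]))]))]));
    (3, Mid 6 7 (case
  [:: (9, Col 8 (case [:: (1, Clash 4 8); (2, Clash 5 8)]))]))]))]))]))));
    (9, Gp5 7 6 9 0 2 (Gp5 5
  4 9 0 1 (Col 5 (case [:: (1, Mid 4 5 (case [:: (8, Col 6 (case [:: (2,
    Col 7 (case [:: (2, Clash 6
  7); (3, Col 9 (case [:: (2, Clash 6 9); (3, Clash 7 9)]))]))]))]));
    (2, Col 6 (case [:: (1, Mid 4
  6 (case [:: (8, Col 7 (case [:: (2, Col 8 (case [:: (3, Col 9 (case [:: (3,
    Clash 8 9)]))])); (3,
  Col 8 (case [:: (2, Mid 5 8 (case [:: (9, Col 9 (case [:: (3, Clash 7 9)]))]));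
    (3, Mid 7 8 (case
  [:: (9, Col 9 (case [:: (2, Clash 5 9)]))]))]))])); (9, Col 7 (case [:: (2, Col 8 (case [:: (3,
  Col 9 (case [:: (3, Clash 8 9)]))])); (3, Col 8 (case [:: (2, Mid 5 8 (case [:: (9, Col 9 (case
  [:: (3, Clash 7 9)]))])); (3, Mid 7 8 (case [:: (9, Col 9 (case [:: (2,
    Clash 5 9)]))]))]))]))]));
  (2, Mid 5 6 (case [:: (8, Col 7 (case [:: (1, Clash 4 7);
    (3, Col 9 (case [:: (1, Clash 4 9); (3,
  Clash 7 9)]))]))])); (3, Col 7 (case [:: (1, Mid 4 7 (case [:: (8, Col 9 (case [:: (2,
    Clash 5 9);
  (3, Clash 6 9)]))])); (2, Mid 5 7 (case [:: (8, Col 8 (case [:: (1, Mid 4 8 (case [:: (9, Col 9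
  (case [:: (3, Clash 6 9)]))]));
    (3, Mid 6 8 (case [:: (9, Col 9 (case [:: (1, Clash 4 9)]))]))]));
  (9, Col 8 (case [:: (1, Mid 4 8 (case [:: (9, Col 9 (case [:: (3, Clash 6 9)]))])); (3, Mid 6 8
  (case [:: (9, Col 9 (case [:: (1, Clash 4 9)]))]))]))])); (3, Mid 6 7 (case [:: (8, Col 9 (case
  [:: (1, Clash 4 9); (2, Clash 5 9)]))]))]))]))]))))]))))]))]))))).

Lemma quad10_certE : closes (refutes 10 [::] [:: 4; 2; 2; 2] quad10_cert)
  (init 10 [::] [:: 4; 2; 2; 2] (quad_signs 6) quad_mids four_zero).
Proof. exact: isT. Qed.

(** Point 9 is the added one: it blocks nothing and is not placed in the hull. With ten points the
    caps 10 impose no restriction. *)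
Definition quad9z_cert : cert :=
  Gp5 0 5 6 1 2 (Gp5 5 4 6 0 1 (Mid 1 3 (case [:: (8, Mid 0 2 (case [:: (8, Col 4 (case [:: (0, Gp5
  4 3 9 0 1 (Gp5 9 0 1 3 4 Stop));
    (1, Col 5 (case [:: (0, Gp5 5 3 9 1 2 (Gp5 9 1 2 3 5 Stop)); (1,
  Clash 4 5); (2, Col 8 (case [:: (0, Gp5 1 0 2 3 8 Stop); (1, Clash 4 8); (2, Clash 5 8);
    (3, Col 6
  (case [:: (0, Gp5 6 4 8 2 3 (Gp5 8 2 3 4 6 Stop)); (1, Mid 4 6 (case [:: (8, Col 7 (case [:: (0,
  Gp5 7 5 8 0 3 (Gp5 8 0 3 5 7 Stop)); (1, Clash 4 7); (2, Mid 5 7 (case [:: (8, Col 9 (case [:: (0,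
  Mid 3 9 (case [:: (4, Clash 0 9); (5, Clash 0 9)])); (1, Mid 6 9 (case [:: (0, Clash 4 9); (1,
  Clash 4 9); (5, Clash 4 9); (7, Clash 4 9)])); (2, Mid 7 9 (case [:: (1, Clash 5 9); (2, Clash 5
  9); (4, Clash 5 9); (6, Clash 5 9)])); (3, Clash 8 9)]))])); (3, Clash 7 8)]))]));
    (2, Clash 5 6);
  (3, Clash 6 8)]))]))]))]))]))]))).

Lemma quad9z_certE : closes (refutes 10 [:: 9] [:: 10; 10; 10; 10] quad9z_cert)
  (init 10 [:: 9] [:: 10; 10; 10; 10] (quad_signs 5) quad_mids four_zero).
Proof. exact: isT. Qed.

Definition triangle10_cert : cert :=
  Gp5 0 4 5 1 3 (Gp5 0 4 6 1 3 (Gp5 1 5 6 0 3 (Col 4 (case [:: (1, Col 5 (case [:: (1, Clash 4 5);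
  (2, Col 6 (case [:: (1, Clash 4 6); (2, Clash 5 6); (3, Col 9 (case [:: (1, Clash 4 9);
    (2, Clash
  5 9)]))])); (3, Col 6 (case [:: (1, Clash 4 6); (2, Col 8 (case [:: (1, Clash 4 8); (2, Clash 6
  8)]))]))])); (2, Col 5 (case [:: (1, Col 6 (case [:: (1, Clash 5 6); (2, Clash 4 6); (3, Col 9
  (case [:: (1, Clash 5 9); (2, Clash 4 9)]))])); (2, Clash 4 5); (3, Col 6 (case [:: (1, Col 8
  (case [:: (1, Clash 6 8); (2, Clash 4 8)])); (2, Clash 4 6)]))])); (3, Col 5 (case [:: (1, Col 6
  (case [:: (1, Clash 5 6); (2, Col 7 (case [:: (1, Clash 5 7); (2, Clash 6 7)]))])); (2, Col 6
  (case [:: (1, Col 7 (case [:: (1, Clash 6 7); (2, Clash 5 7)])); (2, Clash 5 6)]))]))])))).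

Lemma triangle10_certE : closes (refutes 10 [::] [:: 4; 3; 2; 1] triangle10_cert)
  (init 10 [::] [:: 4; 3; 2; 1] (triangle_signs 6) triangle_mids four_zero).
Proof. exact: isT. Qed.

(** The two additional signs place point 10 in the angle under which the inner point 3 sees the side
    from 0 to 1. With eleven points the caps are void. *)
Definition triangle11_cert : cert :=
  Gp5 0 4 5 1 3 (Gp5 0 4 6 1 3 (Gp5 1 4 6 0 3 (Gp5 3 4 8 0 1 (Gp5 1 5 6 0 3 (Gp5 3 5 7 0 1 (Gp5 0 6
  10 1 3 (Gp5 1 6 10 0 3 (Gp5 4 5 6 0 1 (Gp5 3 6 7 0 2 (Gp5 3 6 8 0 2 (Gp5 4 6 8 0 2 (Gp5 5
    6 7 1 2
  (Col 4 (case [:: (0, Gp5 0 1 2 3 4 Stop); (1, Col 6 (case [:: (0, Gp5 2 0 1 3 6 Stop);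
    (1, Clash 4
  6); (2, Col 8 (case [:: (0, Gp5 0 1 3 2 8 Stop); (1, Clash 4 8); (2, Clash 6 8); (3, Col 5 (case
  [:: (0, Gp5 5 6 8 1 3 (Gp5 6 1 3 5 8 Stop));
    (1, Mid 4 5 (case [:: (10, Col 7 (case [:: (0, Gp5 7
  6 8 1 2 (Gp5 8 1 2 6 7 Stop)); (1, Clash 5 7); (2, Clash 6 7); (3, Col 10 (case [:: (0, Clash 0
  10); (1, Gp5 10 6 8 4 5 (Gp5 10 4 7 6 8 Stop)); (2, Clash 6 10);
    (3, Mid 8 10 (case [:: (3, Clash
  7 10); (6, Gp5 6 7 10 1 2 (Gp5 6 7 8 1 10 (Clash 7 8)))]))]))]))])); (2, Clash 5 6); (3, Col 7
  (case [:: (0, Gp5 7 6 8 1 2 (Gp5 8 1 2 6 7 Stop)); (1, Col 10 (case [:: (0, Clash 0 10);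
    (1, Clash
  4 10); (2, Mid 6 10 (case [:: (4, Gp5 8 3 10 0 4 (Mid 4 7 (case [:: (5,
    Col 9 (case [:: (0, Gp5 9
  8 10 0 1 (Gp5 10 0 1 8 9 Stop)); (1, Clash 4 9); (2, Clash 9 10);
    (3, Mid 8 9 (case [:: (3, Clash
  5 9); (4, Clash 5 9); (6, Gp5 10 5 9 1 6 (Clash 5 8)); (10, Clash 5 9)]))]))])));
    (5, Gp5 7 3 10 1
  5 (Mid 5 8 (case [:: (4, Col 9 (case [:: (0, Gp5 9 8 10 0 1 (Gp5 10 0 1 8 9 Stop)); (1, Mid 7 9
  (case [:: (3, Clash 4 9); (5, Clash 4 9); (6, Gp5 10 4 9 0 6 (Clash 4 7));
    (10, Clash 4 9)])); (2,
  Clash 9 10); (3, Clash 5 9)]))])))])); (3, Clash 5 10)])); (2, Clash 6 7); (3, Clash 5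
  7)]))]))]))]))])))))))))))))).

Lemma triangle11_certE : closes (refutes 11 [::] [:: 11; 11; 11; 11] triangle11_cert)
  (init 11 [::] [:: 11; 11; 11; 11] (triangle_signs 7 ++ [:: (3, 0, 10, pos);
    (3, 1, 10, neg)]) triangle_mids four_zero).
Proof. exact: isT. Qed.

Definition triangle10z_cert : cert :=
  Gp5 0 4 5 1 3 (Gp5 0 4 6 1 3 (Gp5 1 4 6 0 3 (Gp5 3 4 8 0 1 (Gp5 1 5 6 0 3 (Gp5 3 5 9 0 1 (Gp5 4 5
  6 0 1 (Gp5 3 6 8 0 2 (Gp5 4 6 8 0 2 (Gp5 5 6 7 1 2 (Col 4 (case [:: (0,
    Gp5 4 2 10 0 3 (Gp5 10 0 3
  2 4 Stop)); (1, Col 5 (case [:: (0, Gp5 5 2 10 1 3 (Gp5 10 1 3 2 5 Stop));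
    (1, Clash 4 5); (2, Col
  6 (case [:: (0, Gp5 2 0 1 3 6 Stop); (1, Clash 4 6); (2, Clash 5 6);
    (3, Col 7 (case [:: (0, Gp5 7
  4 6 1 2 (Gp5 4 1 3 6 7 Stop)); (1, Col 8 (case [:: (0, Gp5 8 6 7 0 2 (Gp5 6 0 3 7 8 Stop)); (1,
  Clash 4 8); (2, Col 9 (case [:: (0, Gp5 9 6 8 0 1 (Gp5 6 0 2 8 9 Stop)); (1, Clash 4 9);
    (2, Clash
  5 9); (3, Mid 6 9 (case [:: (4, Gp5 8 3 9 0 4 (Mid 5 8 (case [:: (4, Clash 4 7);
    (6, Gp5 8 3 7 0 6
  (Mid 4 7 (case [:: (5, Gp5 9 3 7 0 5 (Gp5 9 6 7 0 5 (Gp5 7 0 3 4 9 (Col 10 (case [:: (0,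
    Mid 3 10
  (case [:: (7, Clash 0 10); (8, Clash 0 10); (9, Clash 0 10)]));
    (1, Mid 7 10 (case [:: (0, Clash 4
  10); (3, Clash 4 10); (6, Clash 4 10); (8, Clash 4 10); (9, Clash 4 10)]));
    (2, Mid 8 10 (case [::
  (1, Clash 5 10); (3, Clash 5 10); (4, Clash 5 10); (7, Clash 5 10); (9, Clash 5 10)]));
    (3, Mid 9
  10 (case [:: (2, Clash 6 10); (3, Clash 6 10); (5, Clash 6 10); (7, Clash 6 10); (8, Clash 6
  10)]))])))))])))]))); (5, Gp5 9 3 7 0 5 (Mid 5 8 (case [:: (4,
    Gp5 8 3 9 0 4 (Gp5 8 6 9 0 4 (Mid 4
  7 (case [:: (6, Gp5 8 3 7 0 6 (Gp5 8 5 7 0 6 (Gp5 7 0 3 4 8 (Col 10 (case [:: (0, Mid 3 10 (case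
  [:: (7, Clash 0 10); (8, Clash 0 10); (9, Clash 0 10)]));
    (1, Mid 7 10 (case [:: (0, Clash 4 10);
  (3, Clash 4 10); (5, Clash 4 10); (8, Clash 4 10); (9, Clash 4 10)]));
    (2, Mid 8 10 (case [:: (1,
  Clash 5 10); (3, Clash 5 10); (6, Clash 5 10); (7, Clash 5 10); (9, Clash 5 10)])); (3, Mid 9 10
  (case [:: (2, Clash 6 10); (3, Clash 6 10); (4, Clash 6 10); (7, Clash 6 10); (8, Clash 6
  10)]))])))))]))))])))]))])); (3, Clash 6 8)])); (2, Clash 5 7); (3, Clash 6
  7)]))]))]))]))))))))))).

Lemma triangle10z_certE : closes (refutes 11 [:: 10] [:: 11; 11; 11; 11] triangle10z_cert)
  (init 11 [:: 10] [:: 11; 11; 11; 11] (triangle_signs 6) triangle_mids four_zero).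
Proof. exact: isT. Qed.

(** Applied to the sizes 4, 3, 3, 2. The larger caps 4, 3, 3, 3 make the colours 1, 2 and 3
    interchangeable for [redundant], which saves branches. *)
Definition triangle12_cert : cert :=
  Gp5 0 4 5 1 3 (Gp5 0 4 6 1 3 (Gp5 1 4 6 0 3 (Gp5 3 4 8 0 1 (Gp5 3 4 9 0 1 (Gp5 0 5 6 1 3 (Gp5 1 5
  6 0 3 (Gp5 3 5 7 0 1 (Gp5 3 5 9 0 1 (Gp5 0 6 10 1 3 (Gp5 1 6 10 0 3 (Gp5 4 2 5 0 1 (Gp5 4
    5 6 0 1
  (Gp5 4 5 9 0 1 (Gp5 7 8 9 0 1 (Gp5 3 6 7 0 2 (Gp5 3 6 8 0 2 (Gp5 4 6 8 0 2 (Gp5 5 6 7 1 2 (Col 4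
  (case [:: (1, Col 5 (case [:: (1, Mid 4 5 (case [:: (10, Col 10 (case [:: (1, Gp5 4 0 1 5 10
  Stop); (2, Col 6 (case [:: (1, Mid 5 6 (case [:: (11, Clash 4 6)])); (2, Mid 6 10 (case [:: (11,
  Col 7 (case [:: (1, Clash 5 7); (2, Clash 6 7); (3, Col 8 (case [:: (1, Clash 4 8); (2, Clash 6
  8); (3, Col 9 (case [:: (1, Clash 4 9); (2, Clash 9 10);
    (3, Col 11 (case [:: (1, Clash 4 11); (2,
  Gp5 6 0 1 10 11 Stop)]))]))]))]))])); (3, Col 7 (case [:: (1, Mid 4 7 (case [:: (6, Gp5 7 0 10 1 6
  (Gp5 10 5 7 0 6 (Mid 5 7 (case [:: (11,
    Gp5 10 1 11 5 7 (Gp5 10 6 11 1 7 (Col 8 (case [:: (2, Col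
  9 (case [:: (2, Clash 9 10);
    (3, Col 11 (case [:: (2, Mid 10 11 (case [:: (3, Clash 8 10)])); (3,
  Clash 6 11)]))])); (3, Clash 6 8)]))))])))); (11, Clash 5 7)]));
    (2, Mid 7 10 (case [:: (3, Gp5 3
  8 10 0 2 (Gp5 8 6 10 0 3 (Gp5 3 7 8 0 10 (Gp5 8 7 10 0 3 (Gp5 8 4 7 0 3 (Gp5 6 2 10 0 3 (Col 8
  (case [:: (1, Mid 4 8 (case [:: (11, Mid 5 8 (case [:: (6, Col 11 (case [:: (2,
    Clash 10 11); (3,
  Clash 6 11)]))]))])); (2, Mid 8 10 (case [:: (11,
    Gp5 6 2 11 8 10 (Gp5 0 5 11 1 10 (Mid 7 8 (case
  [:: (6, Gp5 6 5 11 2 7 (Col 9 (case [:: (1, Clash 5 9);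
    (3, Col 11 (case [:: (1, Clash 4 11); (3,
  Mid 9 11 (case [:: (3, Clash 6 11); (4, Clash 6 11); (5, Clash 6 9)]))]))])))]))))]));
    (3, Mid 6 8
  (case [:: (11, Gp5 10 3 11 6 8 (Gp5 10 7 11 3 8 (Col 11 (case [:: (1, Clash 4 11); (2, Clash 7
  11); (3, Gp5 6 0 1 8 11 Stop)]))))]))]))))))));
    (6, Gp5 6 8 10 0 2 (Gp5 10 3 8 0 6 (Gp5 6 7 8 0 10
  (Gp5 8 7 10 0 6 (Gp5 8 3 7 6 10 (Gp5 8 4 7 0 6 (Gp5 7 3 4 6 8 (Col 8 (case [:: (1, Mid 4 8 (case
  [:: (11, Gp5 7 3 11 4 8 (Mid 5 8 (case [:: (6, Col 11 (case [:: (2, Clash 7 11); (3, Clash 6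
  11)]))])))])); (2, Mid 8 10 (case [:: (11, Clash 7 8)]));
    (3, Mid 6 8 (case [:: (11, Col 11 (case
  [:: (1, Clash 4 11); (2, Clash 7 11); (3, Gp5 6 0 1 8 11 Stop)]))]))])))))))));
    (11, Gp5 2 4 11 0
  10 (Gp5 1 4 11 0 10 (Col 9 (case [:: (1, Clash 4 9); (2, Clash 9 10); (3, Col 8 (case [:: (1,
  Clash 4 8); (2, Mid 8 10 (case [:: (3,
    Gp5 8 3 7 0 1 (Gp5 3 7 10 0 8 (Gp5 6 2 10 0 3 (Gp5 6 7 10 1
  3 (Gp5 2 3 11 0 10 (Gp5 2 6 11 3 10 (Gp5 7 3 11 1 10 (Gp5 7 6 11 3 10 (Mid 7 8 (case [::
    (6, Gp5 6
  4 11 2 8 (Col 11 (case [:: (1, Clash 4 11); (3, Mid 9 11 (case [:: (3, Clash 6 11); (4, Clash 6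
  9); (5, Clash 6 11)]))])))])))))))))); (6, Gp5 8 6 7 0 1 (Clash 7 8))])); (3, Mid 6 8 (case [::
  (11, Col 11 (case [:: (1, Clash 4 11); (2, Gp5 7 0 1 10 11 Stop)]))]))]))]))))])); (3, Mid 6 7
  (case [:: (11, Gp5 2 4 11 0 6 (Gp5 1 4 11 0 6 (Gp5 1 10 11 0 6 (Col 8 (case [:: (1, Clash 4 8);
  (2, Col 9 (case [:: (1, Clash 4 9); (2, Clash 9 10);
    (3, Col 11 (case [:: (1, Clash 4 11); (2, Mid
  10 11 (case [:: (3, Clash 8 10)]))]))])); (3, Clash 6 8)])))))]))]))]))])); (11, Gp5 6 1 11 4 5
  (Gp5 3 1 11 0 5 (Col 6 (case [:: (1, Clash 4 6); (2, Col 7 (case [:: (1, Clash 5 7); (2, Clash 6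
  7); (3, Col 8 (case [:: (1, Clash 4 8); (2, Clash 6 8);
    (3, Col 10 (case [:: (1, Clash 4 10); (2,
  Col 11 (case [:: (1, Gp5 11 8 10 4 5 (Gp5 8 4 6 10 11 Stop)); (2, Clash 6 11);
    (3, Mid 8 11 (case
  [:: (3, Gp5 3 7 11 1 2 (Gp5 3 7 8 1 11 (Mid 7 11 (case [:: (10, Gp5 1 4 10 0 11 (Mid 6 10 (case
  [:: (5, Mid 7 8 (case [:: (6, Col 9 (case [:: (1, Clash 4 9);
    (2, Clash 9 10)]))]))])))])))); (6,
  Gp5 6 7 11 1 2 (Gp5 6 7 8 1 11 (Gp5 1 8 10 0 6 (Clash 7 8)))); (10, Gp5 2 5 10 0 11 (Mid 6 10
  (case [:: (4, Gp5 10 3 11 0 4 (Gp5 11 4 8 0 10 (Gp5 11 3 8 4 10 (Gp5 11 6 8 4 10 (Mid 7 11 (case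
  [:: (3, Mid 7 8 (case [:: (6, Col 9 (case [:: (1, Clash 4 9); (2, Clash 9 10)]))])); (6, Clash 7
  8)]))))))])))]))])); (3, Col 11 (case [:: (1, Gp5 11 6 10 4 5 (Gp5 11 4 7 6 10 Stop)); (2, Mid 6
  11 (case [:: (10, Col 9 (case [:: (1, Clash 4 9); (2, Clash 9 11)]))]))]))]))]))]))]))))])); (2,
  Col 6 (case [:: (1, Mid 4 6 (case [:: (11, Gp5 5 0 11 4 6 (Gp5 5 2 11 4 6 (Gp5 3 0 11 4 6 (Gp5 0
  10 11 3 6 (Col 7 (case [:: (1, Clash 6 7); (2, Clash 5 7); (3, Col 10 (case [:: (1, Clash 4 10);
  (2, Clash 5 10); (3, Col 8 (case [:: (1, Clash 4 8);
    (2, Col 11 (case [:: (1, Gp5 11 8 10 4 6 (Gp5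
  11 4 7 8 10 Stop)); (2, Clash 8 11); (3, Mid 10 11 (case [:: (3, Clash 7 11); (5, Gp5 5 7 11 1 2
  (Gp5 5 7 10 1 11 (Clash 7 10)))]))])); (3, Col 11 (case [:: (1, Gp5 11 5 10 4 6 (Gp5 11 4 7 5 10
  Stop)); (2, Mid 7 10 (case [:: (3, Mid 5 11 (case [:: (10, Mid 8 10 (case [:: (4,
    Col 9 (case [::
  (1, Clash 4 9); (2, Clash 5 9)]))]))])); (4, Gp5 4 5 10 0 1 (Clash 5 11)); (5, Clash 5 11); (6,
  Gp5 6 8 10 0 2 (Gp5 6 7 8 0 10 (Clash 7 8))); (11, Clash 5 11)]))]))]))]))]))))))])); (2, Mid 5 6
  (case [:: (11, Gp5 4 1 11 5 6 (Gp5 4 2 11 5 6 (Gp5 3 1 11 5 6 (Gp5 1 10 11 3 6 (Col 8 (case [::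
  (1, Clash 4 8); (2, Clash 6 8); (3, Col 10 (case [:: (1, Clash 4 10); (2, Clash 5 10); (3, Col 7
  (case [:: (1, Col 11 (case [:: (1, Clash 7 11); (2, Gp5 11 7 10 5 6 (Gp5 11 5 8 7 10 Stop)); (3,
  Mid 10 11 (case [:: (3, Clash 8 11);
    (4, Gp5 4 8 11 0 2 (Gp5 4 8 10 0 11 (Clash 8 10)))]))])); (2,
  Clash 5 7); (3, Col 11 (case [:: (1, Mid 8 10 (case [:: (3, Mid 4 11 (case [:: (10,
    Mid 7 10 (case
  [:: (5, Col 9 (case [:: (1, Clash 4 9); (2, Clash 5 9)]))]))])); (4, Clash 4 11);
    (5, Gp5 5 4 10 0
  1 (Clash 4 11)); (6, Gp5 6 7 10 1 2 (Gp5 6 7 8 1 10 (Clash 7 8))); (11, Clash 4 11)]));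
    (2, Gp5 5
  0 1 6 11 Stop)]))]))]))]))))))])); (3, Col 7 (case [:: (1, Col 8 (case [:: (1, Mid 4 8 (case [::
  (11, Gp5 6 3 11 4 8 (Gp5 0 5 11 1 4 (Gp5 0 10 11 1 4 (Col 10 (case [:: (2, Clash 5 10);
    (3, Col 9
  (case [:: (2, Mid 5 9 (case [:: (10, Mid 4 7 (case [:: (5, Col 11 (case [:: (2,
    Mid 9 11 (case [::
  (3, Gp5 3 6 10 0 11 (Clash 6 10)); (6, Clash 5 11)])); (3, Clash 6 11)])); (6, Gp5 0 7 10 1 6
  (Clash 7 8)); (10, Gp5 10 6 7 0 1 (Gp5 10 4 6 0 7 (Clash 6 10)))]))])); (3, Clash 9
  10)]))])))))])); (2, Col 9 (case [:: (1, Mid 4 9 (case [:: (10, Col 10 (case [:: (2, Mid 5 10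
  (case [:: (11, Mid 8 10 (case [:: (3, Gp5 3 6 9 0 8 (Mid 4 7 (case [:: (5, Clash 7 9);
    (6, Mid 5 8
  (case [:: (6, Col 11 (case [:: (3, Clash 6 11)]))])); (11, Clash 7 9)]))); (6, Clash 5 8)]))]));
  (3, Mid 6 10 (case [:: (5, Gp5 5 7 9 1 6 (Mid 7 9 (case [:: (11, Mid 5 8 (case [:: (4, Mid 4 7
  (case [:: (6, Col 11 (case [:: (2, Clash 5 11); (3, Clash 6 11)]))]))]))]))); (11, Col 11 (case
  [:: (2, Mid 8 11 (case [:: (3, Clash 5 11); (4, Clash 5 11)]));
    (3, Gp5 11 8 9 6 10 (Gp5 9 7 10 8
  11 Stop))]))]))])); (11, Gp5 5 3 11 4 9 (Gp5 0 6 11 1 4 (Col 10 (case [:: (2, Mid 5 10 (case [::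
  (11, Gp5 9 4 10 0 11 (Gp5 10 1 4 9 11 (Mid 5 8 (case [:: (4, Clash 8 10); (6, Mid 4 7 (case [::
  (5, Clash 7 9); (6, Col 11 (case [:: (3, Clash 6 11)]))]))]))))]));
    (3, Col 11 (case [:: (2, Mid 8
  11 (case [:: (3, Gp5 11 6 9 0 8 (Gp5 11 4 6 8 9 (Mid 6 10 (case [:: (4, Clash 5 11); (5, Clash 5
  8); (11, Clash 5 11)])))); (6, Gp5 3 5 8 6 11 (Clash 5 8)); (10, Clash 5 11)])); (3, Clash 10
  11)]))]))))])); (2, Mid 5 9 (case [:: (10, Col 10 (case [:: (1, Mid 4 10 (case [:: (11, Mid 7 10
  (case [:: (3, Gp5 3 6 9 0 7 (Mid 5 8 (case [:: (4, Clash 8 9); (6, Mid 4 7 (case [:: (6, Col 11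
  (case [:: (3, Clash 6 11)]))])); (11, Clash 8 9)]))); (6, Clash 4 7)]))]));
    (3, Mid 6 10 (case [::
  (4, Gp5 4 8 9 0 6 (Mid 8 9 (case [:: (11, Mid 4 7 (case [:: (5, Mid 5 8 (case [:: (6,
    Col 11 (case
  [:: (1, Clash 4 11); (3, Clash 6 11)]))]))]))]))); (11, Col 11 (case [:: (1, Mid 7 11 (case [::
  (3, Clash 4 11); (5, Clash 4 11)])); (3, Gp5 11 7 9 6 10 (Gp5 9 8 10 7 11 Stop))]))]))])); (11,
  Gp5 4 0 11 5 9 (Gp5 4 3 11 5 9 (Gp5 11 0 3 4 5 (Gp5 0 6 11 1 5 (Col 10 (case [:: (1, Mid 4 10
  (case [:: (11, Gp5 9 5 10 0 11 (Gp5 10 0 5 9 11 (Mid 5 8 (case [:: (4, Clash 8 9); (6, Mid 4 7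
  (case [:: (5, Clash 7 10); (6, Col 11 (case [:: (3, Clash 6 11)]))]))]))))])); (3, Col 11 (case
  [:: (1, Mid 7 11 (case [:: (3, Gp5 11 6 9 0 7 (Gp5 11 5 6 7 9 (Mid 6 10 (case [:: (4,
    Clash 4 7);
  (5, Clash 4 11); (11, Clash 4 11)])))); (6, Gp5 3 4 7 6 11 (Clash 4 7));
    (10, Clash 4 11)])); (3,
  Clash 10 11)]))]))))))]));
    (3, Col 10 (case [:: (1, Mid 4 10 (case [:: (11, Gp5 3 0 11 4 10 (Gp5 3
  5 11 0 10 (Mid 4 7 (case [:: (5, Gp5 7 6 9 1 5 (Gp5 7 0 6 4 9 (Clash 7 10)));
    (6, Col 11 (case [::
  (2, Clash 5 11); (3, Clash 9 11)]))]))))]));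
    (2, Mid 5 10 (case [:: (11, Gp5 3 4 11 5 10 (Mid 5 8
  (case [:: (4, Gp5 8 6 9 0 4 (Gp5 8 1 6 4 9 (Clash 8 10))); (6, Col 11 (case [:: (1, Clash 4 11);
  (3, Clash 9 11)]))])))])); (3, Mid 9 10 (case [:: (11, Gp5 1 5 11 0 10 (Gp5 0 4 11 1 10 (Col 11
  (case [:: (1, Clash 4 11); (2, Clash 5 11)]))))]))]))]));
    (3, Mid 6 8 (case [:: (11, Gp5 4 0 11 6
  8 (Gp5 2 5 11 0 6 (Gp5 0 5 11 1 6 (Gp5 0 10 11 1 6 (Col 10 (case [:: (1, Clash 4 10);
    (2, Clash 5
  10); (3, Mid 6 10 (case [:: (4, Clash 8 10); (5, Gp5 7 3 10 1 5 (Gp5 10 2 4 0 5 (Gp5 2 10 11 0 5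
  (Col 9 (case [:: (1, Mid 7 9 (case [:: (3, Clash 4 9); (5, Clash 4 9); (6, Clash 4 9);
    (10, Clash
  4 9); (11, Gp5 11 9 10 0 2 (Gp5 9 2 10 1 11 (Clash 4 9)))])); (2, Clash 5
  9)])))))]))]))))))]))])); (2, Mid 5 7 (case [:: (11,
    Gp5 6 3 11 5 7 (Gp5 2 4 11 0 5 (Gp5 1 4 11 0
  5 (Gp5 1 10 11 0 5 (Col 8 (case [:: (1, Clash 4 8); (2, Col 10 (case [:: (1, Clash 4 10);
    (3, Col
  9 (case [:: (1, Mid 4 9 (case [:: (10, Mid 5 8 (case [:: (4, Col 11 (case [:: (1, Mid 9 11 (case
  [:: (3, Gp5 3 6 10 0 11 (Clash 6 10)); (6, Clash 4 11)])); (3, Clash 6 11)]));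
    (6, Gp5 1 8 10 0 6
  (Clash 7 8)); (10, Gp5 10 6 8 0 1 (Gp5 10 5 6 0 8 (Clash 6 10)))]))]));
    (3, Clash 9 10)]))])); (3,
  Clash 6 8)]))))))])); (3, Mid 6 7 (case [:: (11, Gp5 5 1 11 6 7 (Gp5 2 4 11 0 6 (Gp5 1 4 11 0 6
  (Gp5 1 10 11 0 6 (Col 8 (case [:: (1, Clash 4 8); (2, Col 10 (case [:: (1, Clash 4 10);
    (2, Clash
  5 10); (3, Mid 6 10 (case [:: (4,
    Gp5 8 3 10 0 4 (Gp5 10 2 5 1 4 (Gp5 2 10 11 0 4 (Col 9 (case [::
  (1, Clash 4 9); (2, Mid 8 9 (case [:: (3, Clash 5 9); (4, Clash 5 9); (6, Clash 5 9);
    (10, Clash 5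
  9); (11, Gp5 11 9 10 1 2 (Gp5 9 7 10 1 11 (Gp5 9 2 10 7 11 (Clash 5 9))))]))]))))); (5, Clash 7
  10)]))])); (3, Clash 6 8)]))))))]))]))]))]))])))))))))))))))))))).

Lemma triangle12_certE : closes (refutes 12 [::] [:: 4; 3; 3; 3] triangle12_cert)
  (init 12 [::] [:: 4; 3; 3; 3] (triangle_signs 8 ++ [:: (3, 0, 10, pos);
    (3, 1, 10, neg)]) triangle_mids four_zero).
Proof. exact: isT. Qed.

Definition quad8_cert : cert :=
  Clash 1 3.

Lemma quad8_certE : closes (refutes 8 [::] [:: 10; 10; 10; 10] quad8_cert)
  (init 8 [::] [:: 10; 10; 10; 10] (quad_signs 4) quad_mids four_zero).
Proof. exact: isT. Qed.

Definition cert2 : cert :=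
  Clash 0 1.

Lemma cert2E : closes (refutes 2 [::] [:: 2; 0; 0; 0] cert2)
  (init 2 [::] [:: 2; 0; 0; 0] [::] [::] [:: (0, 0); (1, 0)]).
Proof. exact: isT. Qed.

Definition cert22 : cert :=
  Mid 2 3 (case [:: (0, Clash 0 1); (1, Clash 0 1)]).

Lemma cert22E : closes (refutes 4 [::] [:: 2; 2; 0; 0] cert22)
  (init 4 [::] [:: 2; 2; 0; 0] [::] [::] [:: (0, 0); (1, 0); (2, 1); (3, 1)]).
Proof. exact: isT. Qed.

Definition cert31 : cert :=
  Mid 1 2 (case [:: (3, Clash 0 1)]).

Lemma cert31E : closes (refutes 4 [::] [:: 3; 1; 0; 0] cert31)
  (init 4 [::] [:: 3; 1; 0; 0] [::] [::] [:: (0, 0); (1, 0); (2, 0); (3, 1)]).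
Proof. exact: isT. Qed.

Definition cert311 : cert :=
  Mid 1 2 (case [:: (3, Mid 0 2 (case [:: (4, Clash 0 1)])); (4, Mid 0 2 (case [:: (3, Clash 0
  1)]))]).

Lemma cert311E : closes (refutes 5 [::] [:: 3; 1; 1; 0] cert311)
  (init 5 [::] [:: 3; 1; 1; 0] [::] [::] [:: (0, 0); (1, 0); (2, 0); (3, 1); (4, 2)]).
Proof. exact: isT. Qed.

Definition cert321 : cert :=
  Sgn 2 4 5 (Sgn 2 3 5 (Mid 0 1 (case [:: (3, Clash 3 4); (4, Clash 3 4);
    (5, Mid 3 4 (case [:: (0,
  Clash 0 2); (1, Clash 1 2)]))])) (Sgn 1 4 5 (Mid 1 2 (case [:: (3, Gp5 5 3 4 1 2 (Mid 3 4 (case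
  [:: (0, Clash 0 1)])))])) (Sgn 1 2 4 (Sgn 1 3 5 (Mid 0 2 (case [:: (3,
    Mid 3 4 (case [:: (1, Clash
  0 1); (5, Clash 0 1)])); (4, Mid 3 4 (case [:: (1, Clash 0 1); (5, Clash 0 1)])); (5, Clash 0
  1)])) (Clash 1 2) (case [:: ])) (Gp4 1 2 5 4 (Clash 1 2)) (case [:: (4,
    Mid 0 2 (case [:: (3, Mid
  3 4 (case [:: (5, Clash 0 1)]));
    (5, Clash 0 1)]))])) (case [:: ])) (case [:: ])) (Sgn 2 3 5 (Sgn
  1 4 5 (Sgn 1 2 4 (Gp4 1 2 5 4 (Clash 1 2)) (Sgn 1 3 5 (Clash 1 2) (Mid 0 2 (case [:: (3, Mid 3 4
  (case [:: (1, Clash 0 1); (5, Clash 0 1)])); (4, Mid 3 4 (case [:: (1, Clash 0 1); (5, Clash 0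
  1)])); (5, Clash 0 1)])) (case [:: ])) (case [:: (4, Mid 0 2 (case [:: (3, Mid 3 4 (case [:: (5,
  Clash 0 1)])); (5, Clash 0 1)]))])) (Mid 1 2 (case [:: (3, Gp5 5 3 4 1 2 (Mid 3 4 (case [:: (0,
  Clash 0 1)])))])) (case [:: ])) (Mid 0 1 (case [:: (3, Clash 3 4); (4, Clash 3 4); (5, Mid 3 4
  (case [:: (0, Clash 0 2); (1, Clash 1 2)]))])) (case [:: ])) (case [:: ]).

Lemma cert321E : closes (refutes 6 [::] [:: 3; 2; 1; 0] cert321)
  (init 6 [::] [:: 3; 2; 1; 0] [::] [::] [:: (0, 0); (1, 0); (2, 0); (3, 1); (4, 1); (5, 2)]).
Proof. exact: isT. Qed.

(** The classes are 0 to 2, 3 to 5, 6 to 8 and the single point 9. Two sides of the first triangle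
    are blocked by one colour and the third side by another. *)
Definition bbc_cert : cert :=
  Gp5 1 3 4 0 2 (Gp5 0 3 6 1 2 (Gp5 0 4 6 1 2 (Gp5 4 3 6 0 1 (Mid 3 4 (case [:: (7, Gp5 6 1 7 3 4
  (Gp5 6 2 7 3 4 (Mid 6 7 (case [:: (5, Gp5 4 2 5 6 7 (Gp5 3 1 5 6 7 (Mid 4 5 (case [:: (8,
    Mid 7 8
  (case [:: (9, Clash 3 5)])); (9, Mid 7 8 (case [:: (0, Clash 3 5); (1, Clash 3 5);
    (2, Clash 3 5);
  (9, Clash 3 5)]))])))); (9,
    Gp5 4 3 9 0 7 (Gp5 4 2 9 6 7 (Gp5 3 1 9 6 7 (Mid 7 8 (case [:: (0, Gp5
  4 3 8 0 7 (Mid 4 5 (case [:: (1, Clash 3 5); (6, Clash 3 5); (8, Clash 3 5); (9, Clash 3 5)])));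
  (1, Gp5 6 3 8 1 7 (Mid 6 8 (case [:: (5, Clash 3 5)])));
    (2, Gp5 6 4 8 2 7 (Mid 6 8 (case [:: (5,
  Clash 4 5)]))); (5, Mid 6 8 (case [:: (0, Gp5 3 2 8 0 6 (Gp5 3 7 8 0 2 (Sync 7 5 8 3 (Clash 3
  5)))); (3, Sync 7 5 8 3 (Clash 3 5));
    (4, Gp5 7 3 8 0 4 (Sync 7 5 8 3 (Clash 3 5)))]))])))))]))));
  (8, Gp5 6 1 8 3 4 (Gp5 6 2 8 3 4 (Mid 6 8 (case [:: (5, Gp5 4 2 5 6 8 (Gp5 3 1 5 6 8 (Mid 4 5
  (case [:: (7, Mid 7 8 (case [:: (9, Clash 3 5)])); (9, Mid 7 8 (case [:: (0, Clash 3 5);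
    (1, Clash
  3 5); (2, Clash 3 5); (9, Clash 3 5)]))]))));
    (9, Gp5 4 3 9 0 8 (Gp5 4 2 9 6 8 (Gp5 3 1 9 6 8 (Mid
  7 8 (case [:: (0, Gp4 3 4 7 0 (Mid 4 5 (case [:: (1, Clash 3 5); (6, Clash 3 5); (7, Clash 3 5);
  (9, Clash 3 5)]))); (1, Gp4 3 6 7 1 (Mid 6 7 (case [:: (5, Clash 3 5)])));
    (2, Gp4 4 6 7 2 (Mid 6
  7 (case [:: (5, Clash 4 5)])));
    (5, Mid 6 7 (case [:: (0, Gp5 3 2 7 0 6 (Gp5 3 7 8 0 2 (Sync 7 5 8
  3 (Clash 3 5)))); (3, Sync 7 5 8 3 (Clash 3 5)); (4, Gp5 8 3 7 0 4 (Sync 7 5 8 3 (Clash 3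
  5)))]))])))))])))); (9, Gp5 6 1 9 3 4 (Gp5 6 2 9 3 4 (Gp5 9 1 2 3 6 (Gp5 2 0 9 1 4 (Gp5 1
    0 9 3 4
  (Mid 6 8 (case [:: (0, Gp5 4 1 8 0 6 (Gp5 4 8 9 0 1 (Gp5 4 3 8 0 6 (Gp5 3 1 8 0 2 (Gp5 3 2 8 0 6
  (Gp5 3 8 9 0 2 (Gp5 2 1 8 0 6 (Gp5 2 8 9 0 1 (Gp5 1 8 9 0 2 (Mid 4 5 (case [:: (1, Gp5 9 2 5 1 4
  (Gp5 9 5 8 1 2 (Gp4 2 5 8 1 (Mid 7 8 (case [:: (1, Clash 3 5); (2, Clash 3 5);
    (3, Clash 3 5); (4,
  Clash 3 5); (5, Clash 3 5); (9, Clash 3 5)]))))); (6, Gp4 2 5 8 6 (Mid 7 8 (case [:: (1, Clash 6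
  7); (2, Clash 3 5); (3, Clash 3 5); (4, Clash 3 5); (5, Clash 3 5); (9, Clash 6 7)])));
    (7, Mid 7
  8 (case [:: (1, Gp5 9 2 7 1 8 (Gp5 9 3 7 1 8 (Gp5 9 4 7 1 8 (Gp5 7 2 3 8 9 (Gp5 7 3 4 8 9
    (Gp5 6 3
  7 1 8 (Sync 4 7 5 3 (Clash 3 5)))))))); (2, Clash 6 7); (3, Sync 4 7 5 3 (Clash 3 5));
    (9, Clash 6
  7)])); (8, Gp5 3 1 5 4 8 (Mid 7 8 (case [:: (1, Clash 3 5); (2, Clash 3 5); (3, Clash 3 5); (9,
  Clash 3 5)])))])))))))))));
    (3, Gp5 9 4 8 0 3 (Gp5 4 1 8 3 6 (Gp5 2 1 8 3 6 (Gp5 1 0 8 2 3 (Mid 3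
  5 (case [:: (2, Gp5 9 1 5 2 3 (Gp5 9 5 6 1 2 (Gp5 6 0 5 2 3 (Mid 6 7 (case [:: (0,
    Clash 4 5); (4,
  Clash 4 5); (5, Clash 4 5); (9, Clash 4 5)])))));
    (7, Mid 7 8 (case [:: (0, Sync 3 7 5 0 (Sync 0 3
  1 5 (Gp5 0 5 6 1 7 (Gp5 0 5 8 1 7 (Gp4 1 5 8 0 (Clash 4 5)))))); (1, Clash 6 7);
    (2, Gp5 6 1 7 0 2
  (Gp5 6 3 7 2 8 (Gp5 6 4 7 2 8 (Gp5 7 1 3 6 8 (Gp5 3 0 7 1 2 (Gp5 3 4 7 0 2 (Gp5 1 0 7 2 3
    (Gp5 1 4
  7 0 2 (Sync 3 7 5 4 (Clash 4 5)))))))))); (4, Sync 3 7 5 4 (Clash 4 5));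
    (9, Gp5 6 3 7 8 9 (Gp5 4
  3 7 0 9 (Gp5 3 1 7 6 9 (Sync 3 7 5 1 (Sync 3 7 5 4 (Sync 3 7 5 6 (Clash 4
    5)))))))]))])))))); (4,
  Gp5 3 2 8 4 6 (Gp5 2 0 8 1 4 (Gp5 2 1 8 4 6 (Mid 4 5 (case [:: (1, Gp5 9 2 5 1 4 (Gp5 9 5 6 1 2
  (Gp5 6 0 5 1 4 (Mid 6 7 (case [:: (0, Clash 3 5); (3, Clash 3 5); (5, Clash 3 5); (9, Clash 3
  5)]))))); (7, Mid 7 8 (case [:: (0,
    Sync 4 7 5 0 (Sync 0 4 2 5 (Gp5 0 5 6 2 7 (Gp5 0 5 8 2 7 (Gp4
  2 5 8 0 (Clash 3 5)))))); (1,
    Gp5 6 2 7 0 1 (Gp5 6 3 7 1 8 (Gp5 6 4 7 1 8 (Gp5 7 2 4 6 8 (Gp5 4 0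
  7 1 2 (Gp5 4 3 7 0 1 (Gp5 2 3 7 1 4 (Sync 4 7 5 3 (Clash 3 5))))))))); (2, Clash 6 7);
    (3, Sync 4
  7 5 3 (Clash 3 5)); (9, Gp5 6 4 7 8 9 (Gp5 4 3 7 0 9 (Gp5 4 2 7 6 9 (Sync 4 7 5 2 (Sync 4 7 5 3
  (Sync 4 7 5 6 (Clash 3 5)))))))]))]))))); (5, Sgn 2 6 7 (Gp5 2 1 7 0 6 (Sgn 2 3 7 (Mid 4 5 (case
  [:: (1, Gp5 3 2 5 1 4 (Clash 3 5));
    (7, Mid 6 7 (case [:: (0, Gp5 4 2 7 0 1 (Gp5 7 1 4 0 2 (Gp5 4
  3 7 0 1 (Sync 4 7 5 3 (Clash 3 5))))); (3, Sync 4 7 5 3 (Clash 3 5));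
    (9, Gp5 4 3 7 0 9 (Sync 4 7
  5 3 (Clash 3 5)))]))])) (Gp5 2 0 7 1 3 (Gp5 2 7 9 0 3 (Gp5 0 4 7 1 2 (Clash 6 7)))) (case
    [:: ])))
  (Clash 6 7) (case [:: ])); (9, Gp5 4 3 8 0 9 (Mid 6 7 (case [:: (0, Gp5 4 3 7 0 6 (Mid 4 5 (case
  [:: (1, Clash 3 5); (6, Clash 3 5); (7, Clash 7 8); (8, Clash 7 8)])));
    (3, Mid 4 5 (case [:: (1,
  Clash 3 5); (6, Clash 3 5); (7, Clash 3 5); (8, Clash 3 5)])); (4, Mid 4 5 (case [:: (1, Clash 3
  5); (8, Clash 3 5)])); (5, Mid 4 5 (case [:: (1, Clash 3 5);
    (8, Clash 3 5)]))])))])))))))]))))).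

Lemma bbc_certE : closes (refutes 10 [::] [:: 3; 3; 3; 1] bbc_cert)
  (init 10 [::] [:: 3; 3; 3; 1] [:: (0, 1, 2, pos)] [:: (0, 3, 1); (0, 4, 2);
    (1, 6, 2)] [seq (i, i %/ 3) | i <- iota 0 10]).
Proof. exact: isT. Qed.

(** Numbering as for [bbc_cert]; here point 9 blocks one side of each of the three triangles, and in
    each the third corner lies to the left of that side. *)
Definition ddd_cert : cert :=
  Sgn 4 7 9 (Gp5 4 3 7 5 9 (Gp5 9 3 7 4 5 (Gp5 7 4 6 8 9 (Gp5 9 4 6 7 8 (Gp5 7 3 6 8 9 (Gp5
    9 3 6 7
  8 (Gp5 4 3 6 7 9 (Sgn 1 7 9 (Gp5 1 0 7 2 9 (Gp5 9 0 7 1 2 (Gp5 7 1 6 3 9 (Gp5 9 1 6 3 7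
    (Gp5 7 0 6
  3 9 (Gp5 9 0 6 3 7 (Gp5 1 0 6 7 9 (Sgn 1 4 9 (Gp5 9 0 4 1 2 (Gp5 4 1 3 5 9 (Gp5 9 1 3 4 5
    (Gp5 9 0
  3 4 5 (Gp4 0 4 6 9 (Gp4 1 3 7 9 (Mid 7 8 (case [:: (1,
    Gp5 9 0 8 1 2 (Gp5 9 3 8 1 6 (Gp5 9 4 8 1 6
  (Mid 6 8 (case [:: (2, Gp5 7 2 3 6 8 (Mid 1 2 (case [:: (5,
    Gp5 9 0 5 1 2 (Gp5 9 5 6 0 2 (Gp5 8 5
  6 1 2 (Mid 4 5 (case [:: (8, Clash 3 5)])))))])));
    (5, Gp5 9 0 5 3 8 (Mid 1 2 (case [:: (3, Gp5 9
  2 5 0 3 (Gp5 9 2 6 0 3 (Clash 0 2))); (5, Clash 3 5); (6, Mid 3 5 (case [:: (2, Clash 0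
  2)]))])))]))))); (2, Gp5 9 1 8 2 7 (Gp5 9 2 3 0 7 (Gp5 9 2 4 0 7 (Gp4 2 3 7 9 (Gp5 2 3 8
    6 7 (Gp5
  8 3 7 2 6 (Gp5 4 2 3 7 9 (Gp5 3 4 8 2 7 (Gp5 3 8 9 2 4 (Mid 6 8 (case [:: (5,
    Gp5 9 2 5 3 8 (Clash
  1 2))]))))))))))); (4, Mid 6 8 (case [:: (1, Mid 4 5 (case [:: (1, Mid 1 2 (case [:: (3,
    Gp5 4 2 6
  1 3 (Clash 0 2))])); (2, Clash 1 2); (6, Mid 3 5 (case [:: (2, Clash 0 2)]))]));
    (2, Gp5 4 2 3 6 8
  (Mid 4 5 (case [:: (1, Clash 1 2); (2, Clash 1 2);
    (6, Gp5 9 5 7 0 6 (Gp5 9 1 5 3 6 (Gp5 8 2 5 4 6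
  (Gp5 8 5 7 4 6 (Gp5 5 2 7 4 8 (Gp4 1 5 7 9 (Clash 1 2)))))))])));
    (5, Mid 4 5 (case [:: (1, Gp5 8
  1 6 4 5 (Mid 1 2 (case [:: (3, Clash 3 5); (6, Mid 3 5 (case [:: (2, Clash 0 2)])); (8, Clash 3
  5)]))); (2, Gp5 9 1 5 2 4 (Clash 3 5))]))]));
    (5, Gp5 9 3 8 5 7 (Gp5 9 4 8 5 7 (Gp5 4 3 8 5 9 (Mid
  4 5 (case [:: (1, Gp5 9 1 8 3 5 (Mid 6 8 (case [:: (2, Gp5 9 2 4 6 8 (Gp5 4 2 3 8 9 (Clash 1
  2)))]))); (2, Gp5 9 0 5 2 4 (Gp5 9 2 7 0 5 (Gp5 9 2 3 4 5 (Gp5 9 2 8 3 5 (Gp5 7 2 6 4 9 (Clash 1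
  2))))))])))))])))))))) (Gp5 1 0 4 2 9 (Gp5 9 0 4 1 2 (Gp5 9 1 3 4 5 (Gp5 9 0 3 4 5 (Gp4 0 4 7 9
  (Gp4 1 3 6 9 (Mid 7 8 (case [:: (1, Gp5 9 0 8 1 2 (Mid 6 8 (case [:: (2,
    Mid 1 2 (case [:: (4, Gp5
  8 4 6 1 2 (Mid 4 5 (case [:: (0, Clash 0 2); (6, Mid 3 5 (case [:: (0, Clash 0 2)]));
    (8, Clash 0
  2)]))); (5, Gp5 9 0 5 1 2 (Gp5 9 2 4 0 5 (Clash 0 2)))]));
    (4, Mid 1 2 (case [:: (4, Mid 4 5 (case
  [:: (0, Gp5 2 1 5 0 4 (Gp5 1 5 6 0 2 (Clash 3 5)))])); (5, Clash 4 5); (6, Mid 4 5 (case [:: (0,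
  Clash 0 2); (2, Clash 0 2)]))]));
    (5, Gp5 9 0 5 6 8 (Gp5 9 5 7 6 8 (Mid 4 5 (case [:: (2, Gp5 9 2
  7 0 5 (Gp5 7 2 6 5 9 (Clash 1 2)))]))))])));
    (2, Gp5 9 0 8 2 7 (Gp5 9 1 8 2 7 (Gp4 0 2 7 9 (Gp5 2
  0 8 6 7 (Gp5 8 0 7 2 6 (Mid 1 2 (case [:: (4, Gp5 9 4 8 0 2 (Mid 6 8 (case [:: (5, Gp5 7 0 5 6 8
  (Clash 4 5))]))); (5, Gp5 9 0 5 1 2 (Gp5 9 5 7 0 2 (Gp5 9 5 8 0 2 (Gp5 7 5 6 1 9 (Clash 4
  5)))))]))))))); (4, Gp5 9 0 8 4 6 (Gp5 9 1 8 4 6 (Mid 6 8 (case [:: (2, Mid 4 5 (case [:: (0,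
  Clash 0 2); (2, Clash 0 2); (6, Mid 3 5 (case [:: (0, Clash 0 2)]))]));
    (5, Gp5 9 0 5 6 8 (Mid 4 5
  (case [:: (2, Gp5 9 2 6 0 5 (Gp5 8 2 6 4 5 (Mid 1 2 (case [:: (8, Clash 0 2)]))))])))])))); (5,
  Gp5 9 4 8 5 7 (Gp5 9 0 5 3 7 (Gp4 0 5 7 9 (Gp5 9 1 5 3 7 (Gp5 5 0 8 6 7 (Gp5 8 0 7 5 6 (Gp5 1 0 5
  7 9 (Gp5 0 1 8 5 7 (Gp5 0 8 9 1 5 (Mid 6 8 (case [:: (2, Gp5 9 2 4 0 8 (Clash 0
  2))])))))))))))])))))))) (case [:: ]))))))))) (Gp5 1 0 7 2 9 (Gp5 9 0 7 1 2 (Gp5 9 1 6 3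
    7 (Gp5 7
  0 6 3 9 (Gp5 9 0 6 3 7 (Gp5 1 0 6 7 9 (Sgn 1 4 9 (Gp5 1 0 4 2 9 (Gp5 9 0 4 1 2 (Gp5 9 1 3
    4 5 (Gp5
  9 0 3 4 5 (Gp5 1 0 3 4 9 (Gp4 0 3 6 9 (Mid 7 8 (case [:: (0, Mid 0 2 (case [:: (3, Gp5 9 2 7 0 3
  (Mid 4 5 (case [:: (1, Clash 1 2); (2, Clash 1 2); (6, Clash 6 8); (8, Clash 6 8)])));
    (5, Gp5 9 2
  3 0 5 (Gp5 9 2 7 0 3 (Clash 1 2)))])); (2, Gp5 9 2 3 0 7 (Mid 3 5 (case [:: (1, Clash 0 2); (6,
  Gp5 9 1 5 3 6 (Gp5 1 0 5 6 9 (Clash 0 2))); (8, Gp5 9 0 8 2 3 (Gp4 0 3 8 9 (Gp5 9 1 8 2 3 (Gp5 8 0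
  5 3 4 (Gp5 3 0 5 4 8 (Gp5 1 0 8 3 9 (Gp5 0 1 5 3 8 (Clash 0 2))))))))])));
    (4, Gp5 9 0 8 4 6 (Gp5
  9 1 8 4 6 (Mid 6 8 (case [:: (2, Gp5 9 0 2 6 8 Stop); (5, Gp5 9 0 5 6 8 (Gp5 9 1 5 6 8 (Mid 4 5
  (case [:: (2, Gp5 9 0 2 4 5 Stop)]))))]))));
    (5, Gp5 9 4 8 5 7 (Gp5 9 0 5 3 7 (Gp5 9 1 5 3 7 (Gp4
  1 5 7 9 (Gp5 5 1 8 6 7 (Gp5 8 1 7 5 6 (Gp5 1 8 9 5 7 (Gp5 1 0 5 7 9 (Gp5 1 0 8 7 9 (Gp5 0
    8 9 1 5
  (Mid 6 8 (case [:: (2, Gp5 9 0 2 6 8 Stop)]))))))))))))])))))))) (Gp5 1 0 4 2 9 (Gp5 9 0 4 1 2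
  (Gp5 4 1 3 5 9 (Gp5 9 1 3 4 5 (Gp5 4 0 3 5 9 (Gp5 9 0 3 4 5 (Gp5 1 0 3 4 9 (Gp4 0 3 7 9 (Mid 3 5
  (case [:: (0, Gp5 9 5 6 0 3 (Mid 4 5 (case [:: (2, Gp5 3 2 7 4 5 (Mid 0 2 (case [:: (8,
    Gp5 5 4 8
  0 2 (Mid 7 8 (case [:: (4, Clash 6 8)])))]))); (8, Gp5 3 0 8 1 5 (Gp5 3 1 8 4 5 (Gp5 3 7 8 4 5
  (Mid 0 2 (case [:: (4, Mid 7 8 (case [:: (2, Clash 1 2)])); (7, Gp5 9 2 4 0 7 (Gp5 3 2 8 0 7
  (Clash 1 2))); (8, Clash 6 8)])))))])));
    (2, Gp5 9 2 7 0 3 (Gp4 1 2 3 9 (Gp4 2 3 7 9 (Gp5 2 5 7 3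
  4 (Gp5 5 3 7 2 4 (Gp5 7 5 9 2 3 (Gp5 3 1 5 2 7 (Gp5 7 5 6 3 9 (Gp5 2 1 5 3 4 (Gp5 1 0 5 2
    3 (Mid 7
  8 (case [:: (0, Clash 0 2); (2, Clash 0 2); (4, Clash 4 5); (5, Clash 4 5)]))))))))))));
    (6, Mid 4
  5 (case [:: (0, Mid 6 8 (case [:: (0, Mid 1 2 (case [:: (4, Gp5 9 2 7 0 4 (Clash 0 2));
    (7, Clash
  0 2); (8, Clash 0 2)])); (2, Clash 0 2); (4, Mid 7 8 (case [:: (2, Clash 0 2)]))]));
    (2, Gp5 3 2 7
  4 5 (Mid 6 8 (case [:: (0, Clash 0 2); (2, Clash 0 2);
    (4, Gp5 9 3 8 0 4 (Gp5 9 0 8 4 6 (Gp5 5 2 8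
  3 4 (Gp5 5 3 8 4 6 (Gp5 8 2 3 5 6 (Gp4 0 3 8 9 (Clash 0 2)))))))]))); (8, Mid 6 8 (case [:: (0,
  Gp5 5 0 4 3 8 (Mid 0 2 (case [:: (4, Mid 7 8 (case [:: (2, Clash 1 2)])); (5, Clash 7 8); (7,
  Clash 7 8)]))); (2, Gp4 1 2 6 9 (Gp5 2 1 8 6 7 (Gp5 8 1 6 2 7 (Gp5 1 0 8 2 6 (Clash 7
  8)))))]))])); (8, Gp5 9 4 8 3 5 (Gp5 9 5 6 3 8 (Gp4 3 7 8 9 (Gp5 8 5 7 3 4 (Gp4 3 5 7 8 (Mid 6 8
  (case [:: (0, Gp5 9 0 5 3 8 (Mid 4 5 (case [:: (2, Gp5 3 2 7 4 5 (Clash 0 2))])));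
    (2, Gp5 9 2 4 6
  8 (Gp5 9 2 5 6 8 (Clash 0 2)))])))))))])))))))))) (case [:: ])))))))) (case [::
    ]))))))))) (Gp5 4
  3 7 5 9 (Gp5 9 3 7 4 5 (Gp5 7 4 6 8 9 (Gp5 9 4 6 7 8 (Gp5 7 3 6 8 9 (Gp5 9 3 6 7 8 (Gp5 4
    3 6 7 9
  (Sgn 1 7 9 (Gp5 1 0 7 2 9 (Gp5 9 0 7 1 2 (Gp5 7 1 6 3 9 (Gp5 9 1 6 3 7 (Gp5 9 0 6 3 7 (Sgn 1 4 9
  (Gp5 1 0 4 2 9 (Gp5 9 0 4 1 2 (Gp5 4 1 3 5 9 (Gp5 9 1 3 4 5 (Gp4 1 4 6 9 (Gp5 4 0 3 5 9
    (Gp5 9 0 3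
  4 5 (Gp5 1 0 3 4 9 (Gp4 0 3 7 9 (Mid 4 5 (case [:: (1,
    Gp5 9 5 7 1 3 (Mid 3 5 (case [:: (2, Gp5 4
  2 6 3 5 (Mid 1 2 (case [:: (8,
    Gp5 9 0 8 1 2 (Gp5 9 3 8 0 2 (Gp5 5 3 8 1 2 (Mid 7 8 (case [:: (5,
  Clash 6 8)])))))]))); (8, Gp5 4 1 8 0 5 (Gp5 4 0 8 3 5 (Gp5 4 6 8 3 5 (Mid 1 2 (case [::
    (3, Mid 6
  8 (case [:: (2, Clash 0 2)])); (6, Gp5 4 2 3 1 6 (Gp5 4 2 8 1 6 (Clash 0 2))); (8, Clash 6
  8)])))))]))); (2, Gp5 9 0 5 2 4 (Gp5 9 1 5 2 4 (Gp5 9 2 3 4 5 (Gp5 9 2 6 0 4 (Gp4 0 2 4 9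
    (Gp4 2 4
  6 9 (Gp5 2 5 6 3 4 (Gp5 5 4 6 2 3 (Gp5 6 5 9 2 4 (Gp5 2 0 5 3 4 (Gp5 1 0 5 2 9 (Gp5 9 5 7
    0 3 (Gp4
  0 5 7 9 (Mid 7 8 (case [:: (1, Clash 1 2); (2, Clash 1 2);
    (3, Gp5 9 2 8 3 6 (Clash 1 2)); (5, Gp5
  9 1 8 5 6 (Gp5 1 0 8 5 9 (Gp5 0 2 8 1 5 (Clash 1 2))))])))))))))))))));
    (7, Mid 3 5 (case [:: (1,
  Mid 7 8 (case [:: (1, Mid 1 2 (case [:: (6, Gp5 4 2 3 1 6 (Clash 0 2))]));
    (2, Clash 1 2); (3, Mid
  6 8 (case [:: (2, Clash 0 2)]))])); (2, Gp5 4 2 6 3 5 (Mid 7 8 (case [:: (1, Clash 1 2);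
    (2, Clash
  1 2); (3, Gp5 9 4 8 0 3 (Gp5 9 1 8 3 6 (Gp5 5 2 8 3 4 (Gp5 5 4 8 3 7 (Gp5 8 2 4 5 7 (Gp4 1 4 8 9
  (Clash 1 2)))))))]))); (8, Mid 7 8 (case [:: (1, Gp5 5 1 3 4 8 (Mid 1 2 (case [:: (3, Mid 6 8
  (case [:: (2, Clash 0 2)])); (5, Clash 6 8); (6, Clash 6 8)]))); (2, Gp5 9 1 8 2 7 (Clash 6
  8))]))])); (8, Gp5 9 3 8 4 5 (Gp5 9 5 7 3 8 (Gp4 4 6 8 9 (Gp5 8 5 6 3 4 (Gp4 4 5 6 8 (Mid 7 8
  (case [:: (1, Gp5 9 1 5 3 8 (Mid 3 5 (case [:: (2, Gp5 4 2 6 3 5 (Clash 1 2))])));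
    (2, Gp5 9 2 4 7
  8 (Gp5 9 2 5 7 8 (Gp5 4 2 3 7 9 (Clash 1 2))))])))))))]))))))))))) (Gp5 9 0 4 1 2 (Gp5 9 1 3 4 5
  (Gp4 1 4 7 9 (Gp5 9 0 3 4 5 (Gp4 0 3 6 9 (Mid 7 8 (case [:: (1,
    Gp5 9 3 8 1 6 (Gp5 9 4 8 1 6 (Mid
  6 8 (case [:: (2, Gp5 9 2 4 6 8 (Gp5 7 1 2 0 8 (Mid 4 5 (case [:: (0, Clash 0 2); (7, Clash 1
  2)])))); (5, Gp5 9 3 5 6 8 Stop)]))));
    (2, Gp5 9 1 8 2 7 (Gp5 9 2 3 0 7 (Gp5 9 2 4 0 7 (Gp4 2 4 7
  9 (Gp5 2 4 8 6 7 (Gp5 8 4 7 2 6 (Gp5 4 8 9 2 7 (Gp5 4 2 3 7 9 (Gp5 4 3 8 7 9 (Gp5 3 8 9 2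
    4 (Mid 6
  8 (case [:: (5, Gp5 9 3 5 6 8 Stop)]))))))))))));
    (3, Mid 3 5 (case [:: (0, Gp5 9 5 7 0 3 (Mid 1 2
  (case [:: (4, Clash 4 5); (5, Clash 4 5); (6, Clash 6 8); (8, Clash 6 8)]))); (2, Gp5 9 0 5 2 3
  (Gp5 9 5 7 0 3 (Clash 4 5)))])); (5, Gp5 9 0 5 3 7 (Mid 3 5 (case [:: (2, Gp5 9 0 2 3 5
  Stop)])))]))))))) (case [:: ]))))))) (Gp5 1 0 7 2 9 (Gp5 9 0 7 1 2 (Gp5 9 1 6 3 7 (Gp5 7 0 6 3 9
  (Gp5 9 0 6 3 7 (Gp5 1 0 6 7 9 (Sgn 1 4 9 (Gp5 1 0 4 2 9 (Gp5 9 0 4 1 2 (Gp5 4 1 3 5 9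
    (Gp5 9 1 3 4
  5 (Gp5 4 0 3 5 9 (Gp5 9 0 3 4 5 (Gp4 0 4 7 9 (Gp5 1 0 3 4 9 (Gp4 1 3 6 9 (Mid 6 8 (case [:: (0,
  Gp5 9 1 8 0 2 (Mid 7 8 (case [:: (2, Mid 0 2 (case [:: (3, Gp5 8 3 7 0 2 (Mid 3 5 (case [:: (1,
  Clash 1 2); (7, Mid 4 5 (case [:: (1, Clash 1 2)])); (8, Clash 1 2)])));
    (5, Gp4 0 4 5 9 (Gp5 5 2
  4 0 8 (Gp5 0 2 4 5 8 (Gp5 4 2 3 0 5 (Clash 1 2)))))])); (3, Mid 0 2 (case [:: (3, Mid 4 5 (case
  [:: (1, Clash 3 5); (2, Clash 3 5); (7, Gp5 9 1 5 3 7 (Clash 3 5))])); (5, Clash 3 5);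
    (7, Mid 4 5
  (case [:: (1, Clash 1 2); (2, Clash 1 2); (7, Clash 1 2)]))])); (5, Gp5 9 0 5 7 8 (Gp5 9 1 5 7 8
  (Mid 3 5 (case [:: (2, Gp5 9 2 7 0 5 (Clash 0 2))]))))])));
    (2, Gp5 9 0 8 2 6 (Gp5 9 2 7 0 8 (Gp5
  9 1 8 2 6 (Mid 0 2 (case [:: (3, Gp5 9 3 8 0 2 (Mid 7 8 (case [:: (5, Gp5 9 1 5 7 8 (Clash 3
  5))]))); (5, Gp5 9 5 7 0 2 (Gp5 9 5 8 0 2 (Clash 3 5)))]))))); (3, Gp5 9 0 8 3 6 (Gp5 9 1 8 3 6
  (Mid 7 8 (case [:: (2, Mid 3 5 (case [:: (1, Clash 1 2); (2, Clash 0 2);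
    (7, Mid 4 5 (case [:: (1,
  Clash 1 2)]))])); (5, Gp5 9 1 5 7 8 (Mid 3 5 (case [:: (2, Gp5 8 2 7 3 5 (Mid 1 2 (case [:: (7,
  Clash 0 2)])))])))])))); (5,
    Gp5 9 4 8 5 6 (Gp5 9 0 5 3 6 (Gp5 9 1 5 3 6 (Gp4 1 5 6 9 (Gp4 4 5 6 9
  (Gp5 5 1 8 6 7 (Gp5 8 1 6 5 7 (Gp5 5 4 8 6 7 (Gp5 8 4 6 5 7 (Gp5 4 3 8 5 6 (Gp5 1 8 9 5 6
    (Gp5 1 0
  5 6 9 (Gp5 1 0 8 6 9 (Gp5 0 8 9 1 5 (Mid 7 8 (case [:: (2, Gp5 9 2 4 0 8 (Gp5 4 2 3 8 9 (Clash 1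
  2)))]))))))))))))))))]))))))))))) (Gp5 1 0 4 2 9 (Gp5 9 0 4 1 2 (Gp5 9 1 3 4 5 (Gp5 4 0 3
    5 9 (Gp5
  9 0 3 4 5 (Gp4 0 4 6 9 (Gp5 1 0 3 4 9 (Mid 6 8 (case [:: (0,
    Gp5 9 3 8 0 6 (Gp5 9 4 8 0 6 (Mid 7 8
  (case [:: (2, Gp5 9 2 4 7 8 (Mid 0 2 (case [:: (5, Gp5 8 5 7 0 2 (Mid 4 5 (case [:: (7, Clash 3
  5)])))]))); (5, Gp5 9 0 5 3 8 (Mid 0 2 (case [:: (4, Gp5 9 2 5 0 4 (Gp5 9 2 7 0 4 (Clash 1 2)));
  (5, Clash 3 5); (7, Mid 4 5 (case [:: (2, Clash 1 2)]))])))]))));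
    (2, Gp5 9 0 8 2 6 (Gp5 9 2 3 0 6
  (Gp5 9 2 4 0 6 (Gp4 2 4 6 9 (Gp5 2 4 8 6 7 (Gp5 8 4 6 2 7 (Gp5 4 8 9 2 6 (Gp5 4 2 3 6 9
    (Gp5 4 3 8
  6 9 (Gp5 3 8 9 2 4 (Mid 7 8 (case [:: (5, Gp5 9 2 5 3 8 (Clash 0 2))]))))))))))));
    (3, Gp5 9 4 8 0
  3 (Mid 7 8 (case [:: (0, Mid 3 5 (case [:: (0, Mid 1 2 (case [:: (4, Clash 0 2); (5, Clash 0 2);
  (7, Gp5 9 2 4 0 7 (Clash 0 2))])); (2, Clash 0 2);
    (7, Mid 4 5 (case [:: (2, Clash 0 2)]))])); (2,
  Gp5 9 2 4 7 8 (Mid 3 5 (case [:: (0, Clash 0 2); (2, Clash 0 2); (7, Gp5 9 0 5 3 7 (Gp5 9 5 6 0 7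
  (Gp5 8 2 5 3 7 (Gp5 8 5 6 3 7 (Gp5 5 2 6 3 8 (Gp4 0 5 6 9 (Clash 0 2)))))))])));
    (5, Mid 3 5 (case
  [:: (0, Gp5 8 0 7 3 5 (Mid 0 2 (case [:: (4, Clash 4 5);
    (7, Mid 4 5 (case [:: (2, Clash 1 2)]));
  (8, Clash 4 5)]))); (2, Gp4 1 2 3 9 (Gp5 2 1 5 3 8 (Gp5 5 1 3 2 8 (Gp5 1 0 5 2 3 (Clash 4
  5)))))]))]))); (5, Gp5 9 3 8 5 6 (Gp5 9 5 7 3 8 (Gp5 9 4 8 5 6 (Mid 3 5 (case [:: (0,
    Gp5 9 0 8 3
  5 (Mid 7 8 (case [:: (2, Gp5 9 2 4 7 8 (Clash 0 2))])));
    (2, Gp5 9 0 5 2 3 (Gp5 9 2 7 0 5 (Gp5 9 2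
  8 3 5 (Clash 0 2))))])))))]))))))))) (case [:: ])))))))) (case [:: ]))))))))) (case [:: ]).

Lemma ddd_certE : closes (refutes 10 [::] [:: 3; 3; 3; 1] ddd_cert)
  (init 10 [::] [:: 3; 3; 3; 1] [:: (0, 1, 2, pos); (3, 4, 5, pos);
    (6, 7, 8, pos)] [:: (0, 9, 1); (3, 9, 4); (6, 9, 7)] [seq (i, i %/ 3) | i <- iota 0 10]).
Proof. exact: isT. Qed.

End Certificates.

(** * Class sizes *)

Section Representable.
Variable R : realType.
Local Notation plane := 'rV[R]_2.

Definition class_size (s : seq plane) (col : plane -> nat) (c : nat) : nat :=
  count (fun x => col x == c) s.

(** Passes from finite sets coloured by ['I_4] to lists with a colouring of the plane. The
    permutation that labels the colours turns into [perm_eq] of the lists of sizes. *)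
Lemma representableP a b c d : representable R [tuple a; b; c; d] <->
  exists s, exists col : plane -> nat, [/\ blocked s col,
    {in s, forall x, col x < 4}%N
  & perm_eq [:: a; b; c; d] [seq class_size s col i | i <- iota 0 4]].
Proof.
split=> [[P [col [hb [sg hsg]]]]|[s [col [hb h4 hp]]]].
  pose col' (x : plane) : nat := oapp (fun v : P => nat_of_ord (col v)) 0%N (insub x).
  have colE (v : P) : col' (val v) = col v by rewrite /col' valK.
  have cE i : class_size P col' (nat_of_ord i) = #|[set v : P | col v == i]|.
    rewrite /class_size enum_fsetE count_map cardsE cardE /enum_mem size_filter count_filter.
    by apply: eq_count => v /=; rewrite colE inE andbT.
  exists P, col'; split.
  - split; first exact: fset_uniq.
    move=> v w hv hw vw.
    have := hb [` hv]%fset [` hw]%fset.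
    rewrite -(inj_eq val_inj) /= vw => /(_ isT) [h1 h2].
    rewrite (colE [` hv]%fset) (colE [` hw]%fset) (inj_eq val_inj).
    apply/idP/idP => [|/eqP e].
      case/hasP => x hx hbx; apply/negPn/negP => /h2 /(_ x hx); apply.
      by apply/(btwP _ vw).
    apply/negPn/negP => hn; have /negP [] : ~~ (col [` hv]%fset != col [` hw]%fset)
      by rewrite e eqxx.
    apply: h1 => x hx /(btwP _ vw) hbx; case/negP: hn; apply/hasP; by exists x.
  - by move=> x hx; rewrite (colE [` hx]%fset).
  have -> : [:: a; b; c; d] = [seq class_size P col' (sg i : 'I_4) | i <- enum 'I_4].
    have hs := val_enum_ord 4.
    apply: (@eq_from_nth _ 0%N) => [|j]; first by rewrite size_map size_enum_ord.
    move=> hj; rewrite (nth_map ord0) ?size_enum_ord // cE hsg.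
    by rewrite -[j]/(val (Ordinal hj)) nth_ord_enum (tnth_nth 0%N).
  have -> : [seq class_size P col' i | i <- iota 0 4] = [seq class_size P col' (i : 'I_4) |
    i <- enum 'I_4].
    by rewrite -val_enum_ord -map_comp.
  rewrite (map_comp (fun i : 'I_4 => class_size P col' i) sg).
  apply: (perm_map (fun i : 'I_4 => class_size P col' i)).
  apply: uniq_perm; [by rewrite (map_inj_uniq perm_inj) enum_uniq|exact: enum_uniq|].
  move=> i; rewrite mem_enum; apply/mapP; exists (sg^-1%g i); rewrite ?mem_enum //.
  by rewrite permKV.
pose P : {fset plane} := [fset x in s]%fset.
have hP x : (x \in P) = (x \in s) by rewrite inE.
pose col' (v : P) : 'I_4 := inord (col (val v)).
have colE v : col' v = col (val v) :> nat.
  by rewrite inordK // h4 // -hP; exact: valP.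
exists P, col'; split.
  move=> v w vw; have [us hs] := hb.
  have nvw : val v != val w by rewrite (inj_eq val_inj).
  have hv : val v \in s by rewrite -hP; exact: valP.
  have hw : val w \in s by rewrite -hP; exact: valP.
  rewrite -(inj_eq val_inj) /= !colE -(hs _ _ hv hw nvw); split.
    by move=> h; apply/hasPn => x hx; apply/negP => /(btwP _ nvw); apply: h; rewrite hP.
  by move/hasPn => h x; rewrite hP => /h /negP hx /(btwP _ nvw).
have cE (i : 'I_4) : #|[set v : P | col' v == i]| = class_size s col i.
  have us : uniq s by case: hb.
  have <- : class_size P col i = class_size s col i.
    have e : perm_eq P s by apply: uniq_perm; rewrite ?fset_uniq.
    by move/seq.permP: e; apply.
  rewrite /class_size enum_fsetE count_map cardsE cardE /enum_mem size_filter count_filter.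
  by apply: eq_count => v /=; rewrite -colE inE (inj_eq val_inj) ?andbT.
have e4 : [seq class_size s col i | i <- iota 0 4] = [tuple class_size s col (i : 'I_4) | i < 4].
  by rewrite -val_enum_ord -map_comp.
have [sg hsg] : exists sg : 'S_4, [tuple a; b; c;
  d] = [tuple tnth [tuple class_size s col (i : 'I_4) | i < 4] (sg i) | i < 4] :> seq nat.
  by apply/tuple_permP; rewrite -e4.
exists sg => i; rewrite cE.
have -> : [tuple a; b; c; d] = [tuple tnth [tuple class_size s col (i : 'I_4) | i < 4] (sg
  i) | i < 4] by apply: val_inj.
by rewrite !tnth_mktuple.
Qed.

End Representable.

Ltac perm_tac := apply/seq.permP => ? /=; clear; lia.

(** * Points that block no pair, and the convex hull *)

Section Hull.
Variable R : realType.
Local Notation plane := 'rV[R]_2.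
Implicit Types (p q r u v w x : plane) (s : seq plane) (col : plane -> nat).

Definition removable s x := all (fun v => all (fun w => ~~ btw x v w) s) s.

Lemma removableP s x : reflect {in s &, forall v w, ~~ btw x v w} (removable s x).
Proof.
apply: (iffP allP) => [h v w hv hw|h v hv]; first exact: (allP (h v hv)).
by apply/allP => w hw; exact: h.
Qed.

Lemma blocked_remove s col (K : seq plane) : all (removable s) K ->
  blocked s col -> blocked [seq x <- s | x \notin K] col.
Proof.
move=> /allP hK bs; apply: blocked_filter bs _ => v w x hv hw hx _ _ hb.
by apply/negP => /hK /removableP /(_ v w hv hw); rewrite hb.
Qed.

Lemma seq_min (T : eqType) (le : rel T) (l : seq T) : total le -> transitive le ->
  l != [::] -> exists2 x, x \in l & {in l, forall y, le x y}.
Proof.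
move=> tot tr; elim: l => // a [|b l] IH _.
  by exists a; rewrite ?inE // => y; rewrite inE => /eqP ->; have := tot a a; rewrite orbb.
have [x hx hm] := IH isT; have /orP [h|h] := tot a x.
  exists a; rewrite ?inE ?eqxx // => y; rewrite inE => /orP [/eqP ->|/hm]; last exact: tr.
  by have := tot a a; rewrite orbb.
by exists x; [rewrite inE hx orbT|move=> y; rewrite inE => /orP [/eqP ->|/hm]].
Qed.

(* A point of s minimising f, with ties broken lexicographically, blocks no
   pair of points of s. *)
Lemma hull_ge0 s (S : pred plane) (f : plane -> R) :
  (forall x v w, blocks x v w ->
    exists2 t : R, 0 < t < 1 & f x = f v + t * (f w - f v)) ->
  {in s, forall x, removable s x -> S x} ->
  {in s, forall x, S x -> 0 <= f x} -> {in s, forall x, 0 <= f x}.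
Proof.
move=> haff hS hpos u hu; rewrite leNgt; apply/negP => fu.
pose key y : R *l (R *l R) := (f y, (px y, py y)).
have [|||x hx hm] := @seq_min _ (fun y z => key y <= key z)%O s.
- by move=> y z; exact: le_total.
- by move=> y x z; exact: le_trans.
- by case: (s) hu.
have {}hm y : y \in s -> (f x <= f y) && ((f y <= f x) ==>
    ((px x <= px y) && ((px y <= px x) ==> (py x <= py y)))).
  by move=> /hm; rewrite /key !Order.ProdLexiOrder.lexi_pair.
have hxr : removable s x.
  apply/removableP => v w hv hw; apply/negP => hb.
  have [nxv nxw nvw] := btw_neq hb.
  have hbl := elimT (btwP _ nvw) hb.
  have [t /andP [t0 t1] ef] := haff _ _ _ hbl.
  have /blocksE [t' [/andP [t0' t1'] ex ey]] := hbl.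
  have /andP [fv hv'] := hm _ hv; have /andP [fw hw'] := hm _ hw.
  have fvx : f v = f x by nra.
  have fwx : f w = f x by nra.
  move: hv' hw'; rewrite fvx fwx lexx /= => /andP [pv hv'] /andP [pw hw'].
  have pvx : px v = px x by nra.
  have pwx : px w = px x by nra.
  move: hv' hw'; rewrite pvx pwx lexx /= => hv' hw'.
  have pyv : py v = py x by nra.
  by case/eqP: nxv; apply: plane_eqP.
have := hpos _ hx (hS _ hx hxr); rewrite leNgt => /negP; apply.
by have /andP [h _] := hm _ hu; exact: le_lt_trans h fu.
Qed.

(** Otherwise [hull_ge0] with the empty [S] would apply to the constant function -1. *)
Lemma removable_exists s : s != [::] -> exists2 x, x \in s & removable s x.
Proof.
move=> s0; apply/hasP; apply/negPn/negP => /hasPn hn.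
have h x : x \in s -> (0 : R) <= -1.
  move=> hx; apply: (@hull_ge0 s pred0 (fun=> -1)) hx => //.
    by move=> y v w _; exists (1 / 2); [apply/andP; split; lra|ring].
  by move=> y hy hr; have := hn _ hy; rewrite hr.
by case: s s0 {hn} h => // x s _ /(_ x); rewrite inE eqxx => /(_ isT); lra.
Qed.

Lemma orient_affine p q x v w : blocks x v w -> exists2 t : R, 0 < t < 1 &
  orient p q x = orient p q v + t * (orient p q w - orient p q v).
Proof.
move=> /blocksE [t [ht hx hy]]; exists t => //.
by rewrite /orient hx hy; ring.
Qed.

Lemma orient_convex p q x v w : btw x v w ->
  0 <= orient p q v -> 0 <= orient p q w -> 0 <= orient p q x.
Proof.
move=> hb; have [_ _ nvw] := btw_neq hb.
have [t /andP [t0 t1] ->] := orient_affine p q (elimT (btwP _ nvw) hb).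
by move=> h1 h2; nra.
Qed.

Lemma orient_convex_gt0 p q x v w : btw x v w ->
  0 < orient p q v -> 0 < orient p q w -> 0 < orient p q x.
Proof.
move=> hb; have [_ _ nvw] := btw_neq hb.
have [t /andP [t0 t1] ->] := orient_affine p q (elimT (btwP _ nvw) hb).
by move=> h1 h2; nra.
Qed.

(** The points that block nothing span the convex hull, so a half-plane that contains them contains
    the whole set. *)
Lemma hull_orient s (S : pred plane) p q :
  {in s, forall x, removable s x -> S x} ->
  {in s, forall x, S x -> 0 <= orient p q x} -> {in s, forall x, 0 <= orient p q x}.
Proof. by apply: hull_ge0 => x v w; exact: orient_affine. Qed.

(** A pair blocked by [p] lies in the half-planes bounded by the lines [p q] and [r p], hence on
    both lines, and these meet only in [p]. *)
Lemma corner_removable s p q r : orient p q r != 0 ->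
  {in s, forall u, 0 <= orient p q u} -> {in s, forall u, 0 <= orient r p u} ->
  removable s p.
Proof.
move=> h0 hq hr; apply/removableP => v w hv hw; apply/negP => hb.
have [npv _ nvw] := btw_neq hb.
have hbl := elimT (btwP _ nvw) hb.
have [t /andP [t0 t1] e1] := orient_affine p q hbl.
have [t' /andP [t0' t1'] e2] := orient_affine r p hbl.
have z1 : orient p q p = 0 by rewrite /orient; ring.
have z2 : orient r p p = 0 by rewrite /orient; ring.
have := hq v hv; have := hq w hw; have := hr v hv; have := hr w hw => g1 g2 g3 g4.
have o1 : orient p q v = 0 by nra.
have o2 : orient r p v = 0 by nra.
(* Cramer's rule recovers [p - v] from the two vanishing orientations. *)
case/eqP: npv; apply: plane_eqP; apply: (mulfI h0); apply/eqP; rewrite -subr_eq0.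
  have -> : orient p q r * px p - orient p q r * px v =
    - (px r - px p) * orient p q v - (px q - px p) * orient r p v.
    by rewrite /orient; ring.
  by rewrite o1 o2 !mulr0 subrr.
have -> : orient p q r * py p - orient p q r * py v =
    - (py r - py p) * orient p q v - (py q - py p) * orient r p v.
  by rewrite /orient; ring.
by rewrite o1 o2 !mulr0 subrr.
Qed.

(** With [p0 p1 p2] counterclockwise, the three remaining signs locate [p3]. No negative sign means
    that it lies inside, one that the points are in convex position, two that another point lies in
    the triangle formed by the rest. *)
Lemma four_points (p0 p1 p2 p3 : plane) : orient p0 p1 p2 != 0 ->
  orient p0 p1 p3 != 0 -> orient p1 p2 p3 != 0 -> orient p2 p0 p3 != 0 ->
  exists A0 A1 A2 A3, perm_eq [:: p0; p1; p2; p3] [:: A0; A1; A2; A3] /\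
  ([/\ 0 < orient A0 A1 A3, 0 < orient A1 A2 A3 & 0 < orient A2 A0 A3] \/
   [/\ 0 < orient A0 A1 A2, 0 < orient A0 A1 A3, 0 < orient A0 A2 A3 & 0 < orient A1 A2 A3]).
Proof.
wlog h012 : p0 p1 / 0 < orient p0 p1 p2.
  move=> W n0 n1 n2 n3; case: (ltgtP (orient p0 p1 p2) 0) (n0) => // h _; last exact: W.
  have [||||| A0 [A1 [A2 [A3 [hp hA]]]]] := W p1 p0.
  - by rewrite orient_swap oppr_gt0.
  - by rewrite orient_swap oppr_eq0.
  - by rewrite orient_swap oppr_eq0.
  - by rewrite orient_swap oppr_eq0.
  - by rewrite orient_swap oppr_eq0.
  exists A0, A1, A2, A3; split=> //; apply: perm_trans hp; perm_tac.
move=> _ n1 n2 n3.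
(* This identity between areas excludes three negative signs. *)
have hs : orient p0 p1 p2 = orient p0 p1 p3 + orient p1 p2 p3 + orient p2 p0 p3.
  by rewrite /orient; ring.
have E1 : orient p0 p3 p1 = - orient p0 p1 p3 by rewrite /orient; ring.
have E2 : orient p0 p3 p2 = orient p2 p0 p3 by rewrite /orient; ring.
have E3 : orient p3 p1 p2 = orient p1 p2 p3 by rewrite /orient; ring.
have E4 : orient p1 p3 p2 = - orient p1 p2 p3 by rewrite /orient; ring.
have E5 : orient p1 p3 p0 = orient p0 p1 p3 by rewrite /orient; ring.
have E6 : orient p1 p2 p0 = orient p0 p1 p2 by rewrite /orient; ring.
have E7 : orient p3 p2 p0 = orient p2 p0 p3 by rewrite /orient; ring.
have E8 : orient p2 p3 p0 = - orient p2 p0 p3 by rewrite /orient; ring.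
have E9 : orient p2 p3 p1 = orient p1 p2 p3 by rewrite /orient; ring.
have E10 : orient p2 p0 p1 = orient p0 p1 p2 by rewrite /orient; ring.
have E11 : orient p3 p0 p1 = orient p0 p1 p3 by rewrite /orient; ring.
have E12 : orient p3 p1 p0 = - orient p0 p1 p3 by rewrite /orient; ring.
have E13 : orient p3 p2 p1 = - orient p1 p2 p3 by rewrite /orient; ring.
have E14 : orient p3 p0 p2 = - orient p2 p0 p3 by rewrite /orient; ring.
case: (ltgtP (orient p0 p1 p3) 0) n1 => // h1 _; case: (ltgtP (orient p1 p2 p3) 0) n2 => // h2 _;
  case: (ltgtP (orient p2 p0 p3) 0) n3 => // h3 _.
- lra.
- exists p3, p2, p0, p1; split; [perm_tac|left].
  by rewrite E13 E10 E1 ?oppr_gt0; split.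
- exists p3, p1, p2, p0; split; [perm_tac|left].
  by rewrite E12 E6 E8 ?oppr_gt0; split.
- exists p0, p3, p1, p2; split; [perm_tac|right].
  by rewrite E1 E2 E3 ?oppr_gt0; split.
- exists p3, p0, p1, p2; split; [perm_tac|left].
  by rewrite E14 E4 ?oppr_gt0; split.
- exists p1, p3, p2, p0; split; [perm_tac|right].
  by rewrite E4 E5 E6 E7 ?oppr_gt0; split.
- exists p2, p3, p0, p1; split; [perm_tac|right].
  by rewrite E8 E9 E10 E11 ?oppr_gt0; split.
- by exists p0, p1, p2, p3; split; [perm_tac|left].
Qed.

End Hull.

(** * Arithmetic of the class sizes *)

(* Sizes of the four colour classes in decreasing order; the classes may be
   empty, so that the condition is inherited by subsets. *)
Definition allowed_sorted (t : seq nat) : bool :=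
  match t with
  | [:: a; b; c; d] =>
      if d == 0%N then
        if c == 0%N then (a <= 1)%N || (a == 2)%N && (b == 1)%N else (a <= 2)%N
      else [|| (a <= 3)%N && (t != [:: 3; 3; 3; 1]), t == [:: 4; 2; 2; 1]
             | t == [:: 4; 2; 2; 2]]
  | _ => false
  end.

Definition allowed (t : seq nat) : bool := allowed_sorted (sort geq t).

Lemma geq_total : total geq.
Proof. by move=> a b; exact: leq_total. Qed.
Lemma geq_trans : transitive geq.
Proof. by move=> a b c h h'; exact: leq_trans h' h. Qed.
Lemma geq_anti : antisymmetric geq.
Proof. by move=> a b; rewrite /= andbC => /anti_leq. Qed.

Lemma allowed_perm t t' : perm_eq t t' -> allowed t = allowed t'.
Proof. by move/(perm_sortP geq_total geq_trans geq_anti); rewrite /allowed => ->. Qed.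

Lemma allowed_le4 t : allowed t -> all (fun n => n <= 4)%N t.
Proof.
rewrite /allowed -(all_sort _ geq).
have := sort_sorted geq_total t.
case: (sort geq t) => [|a [|b [|c [|d [|]]]]] //= /and4P [ba cb dc _] h.
suff ha : (a <= 4)%N by rewrite ha (leq_trans ba) // (leq_trans cb) ?(leq_trans ba) //
  (leq_trans dc) // (leq_trans cb) // (leq_trans ba).
move: h; case: ifP => _; first case: ifP => _.
- by case/orP => [h|/andP [/eqP -> _]] //; apply: leq_trans h _.
- by move=> h; apply: leq_trans h _.
by case/or3P => [/andP [h _]|/eqP [->]|/eqP [->]] //; apply: leq_trans h _.
Qed.

Definition decr (t : seq nat) (i : nat) : seq nat :=
  [seq nth 0 t j - (i == j) | j <- iota 0 4]%N.

(** The sorted sizes that are not allowed but become so when some nonempty class loses a point; a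
    smallest counterexample has one of them. *)
Definition minimal_forbidden : seq (seq nat) := [::
  [:: 2; 0; 0; 0]; [:: 2; 2; 0; 0]; [:: 3; 1; 0; 0]; [:: 3; 1; 1; 0];
  [:: 3; 2; 1; 0]; [:: 3; 2; 2; 0]; [:: 3; 3; 3; 1]; [:: 4; 1; 1; 1];
  [:: 4; 2; 1; 1]; [:: 4; 3; 1; 1]; [:: 4; 3; 2; 1]; [:: 4; 3; 2; 2];
  [:: 4; 3; 3; 2]; [:: 4; 3; 3; 3]; [:: 5; 2; 2; 1]; [:: 5; 2; 2; 2]]%N.

(** Allowed sizes are at most 4 and only one size drops, by one, so all sizes are at most 5 and a
    finite enumeration decides. *)
Lemma minimal_forbiddenP a b c d i : (b <= a)%N -> (c <= b)%N -> (d <= c)%N ->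
  (i < 4)%N -> (0 < nth 0 [:: a; b; c; d] i)%N -> ~~ allowed [:: a; b; c; d] ->
  allowed (decr [:: a; b; c; d] i) -> [:: a; b; c; d] \in minimal_forbidden.
Proof.
move=> ba cb dc i4 ni hn hd.
have H : all (fun a => all (fun b => all (fun c => all (fun d => all (fun i =>
   [&& b <= a, c <= b, d <= c, 0 < nth 0 [:: a; b; c; d] i, ~~ allowed [:: a; b; c;
     d] & allowed (decr [:: a; b; c; d] i)]%N
   ==> ([:: a; b; c; d] \in minimal_forbidden)) (iota 0 4)) (iota 0 6)) (iota 0 6)) (iota 0
     6)) (iota 0 6).
  exact: isT.
have a6 : (a < 6)%N.
  have /= /and4P [h _ _ _] := allowed_le4 hd; move: h; rewrite leq_subLR => h.
  by rewrite ltnS (leq_trans h) // (leq_add2r 4 _ 1) leq_b1.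
have m6 n : (n <= a)%N -> n \in iota 0 6 by rewrite mem_iota => h; exact: leq_ltn_trans h a6.
have i4' : i \in iota 0 4 by rewrite mem_iota.
move/allP/(_ a (m6 _ (leqnn _)))/allP/(_ b (m6 _ ba)): H.
move/allP/(_ c (m6 _ (leq_trans cb ba)))/allP/(_ d (m6 _ (leq_trans dc (leq_trans cb ba)))).
by move/allP/(_ i i4'); rewrite ba cb dc ni hn hd.
Qed.

Section Sizes.
Variable R : realType.
Local Notation plane := 'rV[R]_2.
Implicit Types (p q r u v w x : plane) (s : seq plane) (col : plane -> nat).

Definition sizes s col : seq nat := [seq class_size s col i | i <- iota 0 4].
Definition bounded s col := {in s, forall x, col x < 4}%N.

Lemma sizes_perm s s' col : perm_eq s s' -> sizes s col = sizes s' col.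
Proof. by move=> /seq.permP e; apply: eq_map => i; exact: e. Qed.

Lemma nth_sizes s col i : (i < 4)%N -> nth 0 (sizes s col) i = class_size s col i.
Proof. by move=> hi; rewrite (nth_map 0) ?size_iota // nth_iota. Qed.

Lemma sizes_eqP s col t i : sizes s col = t -> (i < 4)%N -> class_size s col i = nth 0 t i.
Proof. by move=> <- /nth_sizes ->. Qed.

Lemma size_sizes s col : bounded s col -> size s = sumn (sizes s col).
Proof.
move=> h4; rewrite /sizes /= addn0.
elim: s h4 => // x s IH h4; rewrite /= IH; last by move=> y hy; apply: h4; rewrite inE hy orbT.
have : (col x < 4)%N by apply: h4; rewrite inE eqxx.
by case: (col x) => [|[|[|[|]]]] //= _; rewrite /class_size; lia.
Qed.

Lemma perm_named s (K : seq plane) : uniq s -> uniq K -> {subset K <= s} ->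
  perm_eq s (K ++ [seq x <- s | x \notin K]).
Proof.
move=> us uK sub; apply: uniq_perm => //.
  rewrite cat_uniq uK filter_uniq // andbT; apply/hasPn => x.
  by rewrite mem_filter => /andP [].
by move=> x; rewrite mem_cat mem_filter; case: (boolP (x \in K)) => //= /sub ->.
Qed.

Lemma sizes_remove s (K : seq plane) col i : uniq s -> uniq K -> {subset K <= s} ->
  class_size [seq x <- s | x \notin K] col i = (class_size s col i - class_size K col i)%N.
Proof.
move=> us uK sub; have /seq.permP := perm_named us uK sub.
by rewrite /class_size => ->; rewrite count_cat addKn.
Qed.

Lemma remove_bounded s (a : pred plane) col : bounded s col -> bounded (filter a s) col.
Proof. by move=> h x; rewrite mem_filter => /andP [_]; exact: h. Qed.

Lemma sizes_remove1 s x col : uniq s -> x \in s ->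
  sizes [seq y <- s | y \notin [:: x]] col = decr (sizes s col) (col x).
Proof.
move=> us hx; apply/eq_in_map => i; rewrite mem_iota /= => hi.
rewrite sizes_remove // ?nth_sizes //; last by move=> y; rewrite inE => /eqP ->.
by rewrite /class_size /= addn0.
Qed.

(** A permutation of the four colours sorts the sizes; it is extended by the identity to all of
    [nat], since [blocked_col] asks for an injection there. *)
Lemma relabel s col : bounded s col -> exists f : nat -> nat, [/\ injective f,
  bounded s (f \o col) & sizes s (f \o col) = sort geq (sizes s col)].
Proof.
move=> h4.
have e4 : sizes s col = [tuple class_size s col (i : 'I_4) | i < 4] :> seq nat.
  by rewrite /sizes -val_enum_ord -map_comp.
have : perm_eq (sort geq (sizes s col)) [tuple class_size s col (i : 'I_4) | i < 4].
  by rewrite -e4 perm_sort.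
have sz : size (sort geq (sizes s col)) == 4%N by rewrite size_sort size_map size_iota.
move/(@tuple_permP _ _ (sort geq (sizes s col)) _).
case=> sg hsg.
pose f (i : nat) : nat := oapp (fun j : 'I_4 => nat_of_ord (sg^-1%g j)) i (insub i).
have fE (i : 'I_4) : f i = sg^-1%g i by rewrite /f valK.
have fK i : (4 <= i)%N -> f i = i by move=> hi; rewrite /f insubF // ltnNge hi.
have f4 i : (f i < 4)%N = (i < 4)%N.
  case: (ltnP i 4) => hi; last by rewrite fK // ltnNge hi.
  by rewrite (fE (Ordinal hi)) ltn_ord.
exists f; split.
- move=> i j; case: (ltnP i 4) => hi; case: (ltnP j 4) => hj.
  + by rewrite (fE (Ordinal hi)) (fE (Ordinal hj)) => /val_inj /perm_inj [].
  + by move=> e; have := f4 i; rewrite e f4 hi ltnNge hj.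
  + by move=> e; have := f4 i; rewrite e f4 hj ltnNge hi.
  by rewrite !fK.
- by move=> x hx /=; rewrite f4 h4.
rewrite hsg /sizes -val_enum_ord -map_comp; apply: eq_map => i /=.
rewrite tnth_mktuple; apply: eq_in_count => x hx /=.
rewrite (fE (Ordinal (h4 x hx))) [LHS](inj_eq val_inj).
by rewrite -(inj_eq (@perm_inj _ sg)) permKV.
Qed.

End Sizes.

(** * Classes of four points *)

Section Quadruples.
Variable R : realType.
Local Notation plane := 'rV[R]_2.
Implicit Types (p q r u v w x : plane) (s : seq plane) (col : plane -> nat).

Lemma allows_pos (y : R) : allows pos y = (0 < y).
Proof. by rewrite /allows; case: ltgtP. Qed.
Lemma allows_neg (y : R) : allows neg y = (y < 0).
Proof. by rewrite /allows; case: ltgtP. Qed.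
Lemma allows_nonneg (y : R) : allows nonneg y = (0 <= y).
Proof. by rewrite /allows; case: ltgtP. Qed.

Lemma mono_blocker s col v w : blocked s col -> v \in s -> w \in s -> v != w ->
  col v = col w -> exists x, [/\ x \in s, btw x v w & col x != col v].
Proof.
move=> bs hv hw vw e; have [us hs] := bs.
have : has (fun x => btw x v w) s by rewrite hs // e.
case/hasP => x hx hb; exists x; split=> //.
by have [] := blocked_btw_col bs hv hx hw hb.
Qed.

(** Each colour class is in general position: the line through [p] and [q] already carries a blocker
    of another colour and has no room for [r]. *)
Lemma mono_orient s col p q r : blocked s col -> p \in s -> q \in s -> r \in s ->
  p != q -> p != r -> q != r -> col p = col q -> col p = col r -> orient p q r != 0.
Proof.
move=> bs hp hq hr pq pr qr epq epr.
have [x [hx hb hc]] := mono_blocker bs hp hq pq epq.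
apply/eqP => /(blocked_collinear bs hp hx hq hr hb).
rewrite !inE eq_sym (negbTE pr) eq_sym [r == q]eq_sym (negbTE qr) orbF /= => /eqP e.
by rewrite e epr eqxx in hc.
Qed.

(** A common blocker of [v, w] and [v, w'] would put four points on one line. *)
Lemma blockers_neq s col x y v w w' : blocked s col -> v \in s -> x \in s ->
  w \in s -> w' \in s -> btw x v w -> btw y v w' -> w != w' -> x != y.
Proof.
move=> bs hv hx hw hw' hb + ww'; apply: contraTneq => <-; apply/negP => hb'.
have [nxv nxw' nvw'] := btw_neq hb'; have [nxv' nxw nvw] := btw_neq hb.
have [t [/andP [t0 t1] e _]] := blocks_orient w' (elimT (btwP _ nvw) hb).
have h0 : orient v w w' = 0.
  by case/andP: hb' => /eqP; rewrite e => /eqP; rewrite mulf_eq0 gt_eqF //= => /eqP.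
have := blocked_collinear bs hv hx hw hw' hb h0.
rewrite !inE => /or3P [] /eqP ew.
- by rewrite ew eqxx in nvw'.
- by rewrite ew eqxx in nxw'.
- by rewrite ew eqxx in ww'.
Qed.

Lemma blockers_sep x y v w v' w' : btw x v w -> btw y v' w' ->
  0 < orient v w v' -> 0 < orient v w w' -> x != y.
Proof.
move=> hx hy h1 h2; apply: contraTneq (orient_convex_gt0 hy h1 h2) => <-.
case/andP: hx => /eqP h _.
by rewrite orient_flip h oppr0 ltxx.
Qed.

Definition triangle_conf s col A0 A1 A2 O :=
  [/\ perm_eq [seq x <- s | col x == 0%N] [:: A0; A1; A2; O],
      [/\ 0 < orient A0 A1 O, 0 < orient A1 A2 O & 0 < orient A2 A0 O]
    & {in s, forall u, [/\ 0 <= orient A0 A1 u, 0 <= orient A1 A2 u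
        & 0 <= orient A2 A0 u]}].

Definition quad_conf s col A0 A1 A2 A3 :=
  [/\ perm_eq [seq x <- s | col x == 0%N] [:: A0; A1; A2; A3],
      [/\ 0 < orient A0 A1 A2, 0 < orient A0 A1 A3, 0 < orient A0 A2 A3
        & 0 < orient A1 A2 A3]
    & {in s, forall u, [/\ 0 <= orient A0 A1 u, 0 <= orient A1 A2 u,
        0 <= orient A2 A3 u & 0 <= orient A3 A0 u]}].

Lemma conf_exists s col : blocked s col -> class_size s col 0 = 4%N ->
  {in s, forall x, removable s x -> col x = 0%N} ->
  (exists A0 A1 A2 O, triangle_conf s col A0 A1 A2 O) \/
  (exists A0 A1 A2 A3, quad_conf s col A0 A1 A2 A3).
Proof.
move=> bs h4 hrem; have [us _] := bs.
pose c0 := [seq x <- s | col x == 0%N].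
have sz : size c0 = 4%N by rewrite size_filter.
have uc : uniq c0 by exact: filter_uniq.
have mem0 x : (x \in c0) = (x \in s) && (col x == 0%N) by rewrite mem_filter andbC.
have orient0 p q r : p \in c0 -> q \in c0 -> r \in c0 -> p != q -> p != r -> q != r ->
  orient p q r != 0.
  rewrite !mem0 => /andP [hp /eqP ep] /andP [hq /eqP eq] /andP [hr /eqP er] pq pr qr.
  by apply: (mono_orient bs); rewrite // ep ?eq ?er.
have hull p q : {in c0, forall x, 0 <= orient p q x} -> {in s, forall x, 0 <= orient p q x}.
  move=> h; apply: (@hull_orient _ _ (fun x => col x == 0%N)).
    by move=> x hx hr; rewrite (hrem x hx hr).
  by move=> x hx hc; apply: h; rewrite mem0 hx.
move: sz uc orient0; rewrite -/c0; case E: c0 => [|p0 [|p1 [|p2 [|p3 [|]]]]] //= _.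
rewrite !inE !negb_or => /and4P [/and3P [n01 n02 n03] /andP [n12 n13] n23 _] orient0.
have [|||| A0 [A1 [A2 [A3 [hp hA]]]]] := @four_points R p0 p1 p2 p3.
- by apply: orient0; rewrite ?inE ?eqxx ?orbT.
- by apply: orient0; rewrite ?inE ?eqxx ?orbT.
- by apply: orient0; rewrite ?inE ?eqxx ?orbT.
- by apply: orient0; rewrite ?inE ?eqxx ?orbT // eq_sym.
have hp' : perm_eq c0 [:: A0; A1; A2; A3] by rewrite E.
have in0 x : x \in c0 -> [\/ x = A0, x = A1, x = A2 | x = A3].
  rewrite (perm_mem hp') !inE => /or4P [] /eqP ->;
    [constructor 1|constructor 2|constructor 3|constructor 4]; by [].
have z1 p q : orient p q p = 0 by rewrite /orient; ring.
have z2 p q : orient p q q = 0 by rewrite /orient; ring.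
case: hA => [[h1 h2 h3]|[h1 h2 h3 h4']]; [left|right]; exists A0, A1, A2, A3; split=> //.
  have e : orient A0 A1 A2 = orient A0 A1 A3 + orient A1 A2 A3 + orient A2 A0 A3.
    by rewrite /orient; ring.
  have e1 : orient A1 A2 A0 = orient A0 A1 A2 by rewrite /orient; ring.
  have e2 : orient A2 A0 A1 = orient A0 A1 A2 by rewrite /orient; ring.
  by move=> u hu; split; apply: hull hu => x /in0 [] ->; rewrite ?z1 ?z2 //; lra.
have e1 : orient A1 A2 A0 = orient A0 A1 A2 by rewrite /orient; ring.
have e2 : orient A2 A3 A0 = orient A0 A2 A3 by rewrite /orient; ring.
have e3 : orient A2 A3 A1 = orient A1 A2 A3 by rewrite /orient; ring.
have e4 : orient A3 A0 A1 = orient A0 A1 A3 by rewrite /orient; ring.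
have e5 : orient A3 A0 A2 = orient A0 A2 A3 by rewrite /orient; ring.
by move=> u hu; split; apply: hull hu => x /in0 [] ->; rewrite ?z1 ?z2 //; lra.
Qed.

End Quadruples.

(** * A class with one point inside the triangle of the others *)

Lemma all_flatten (T : Type) (a : pred T) (ss : seq (seq T)) :
  all a (flatten ss) = all (all a) ss.
Proof. by elim: ss => //= t ss IH; rewrite all_cat IH. Qed.

Lemma perm_rotate (T : eqType) (a b c o x y z u v w : T) r :
  perm_eq ([:: a; b; c; o; x; y; z; u; v; w] ++ r)
    ([:: b; c; a; o; y; z; x; v; w; u] ++ r).
Proof.
have rot3 (d e f : T) : perm_eq [:: d; e; f] [:: e; f; d].
  by rewrite perm_sym (perm_rot 1 [:: d; e; f]).
rewrite perm_cat2r (perm_cat (rot3 a b c)) //= perm_cons.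
by rewrite (perm_cat (rot3 x y z)) // rot3.
Qed.

Section Refutations.
Variable R : realType.
Local Notation plane := 'rV[R]_2.
Implicit Types (p q r u v w x y z : plane) (s : seq plane) (col : plane -> nat).

Lemma bounded_caps s col (n : nat) : bounded s col -> (size s <= n)%N ->
  forall d, (count (fun x => col x == d) s <= nth 0 [:: n; n; n; n] d)%N.
Proof.
move=> h4 hn [|[|[|[|d]]]]; try by exact: leq_trans (count_size _ _) hn.
rewrite nth_default // leqNgt -has_count; apply/hasPn => x hx.
by apply: contraTneq (h4 x hx) => ->.
Qed.

Lemma sizes_caps s col t : bounded s col -> size t = 4%N ->
  all (fun i => nth 0 (sizes s col) i <= nth 0 t i)%N (iota 0 4) ->
  forall d, (count (fun x => col x == d) s <= nth 0 t d)%N.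
Proof.
move=> h4 ht /allP h d; case: (ltnP d 4) => hd.
  by rewrite -[count _ s](nth_sizes s col hd); apply: h; rewrite mem_iota.
rewrite nth_default ?ht // leqNgt -has_count; apply/hasPn => x hx.
by apply: contraTneq (h4 x hx) => ->; rewrite -leqNgt.
Qed.

Definition triangle_named s col A0 A1 A2 O x0 x1 x2 y0 y1 y2 :=
  let l := [:: A0; A1; A2; O; x0; x1; x2; y0; y1; y2] in
  [/\ triangle_conf s col A0 A1 A2 O, uniq l, {subset l <= s}
    & [&& btw x0 A0 O, btw x1 A1 O, btw x2 A2 O, btw y0 A1 A2, btw y1 A2 A0
        & btw y2 A0 A1]].

(** The six blockers are distinct. Two blocked segments with a common end are covered by
    [blockers_neq]. The remaining pairs consist of a side and the segment from [O] to the opposite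
    corner, which lies strictly on one side of it apart from no common point. *)
Lemma triangle_named_exists s col A0 A1 A2 O : blocked s col ->
  triangle_conf s col A0 A1 A2 O ->
  exists x0 x1 x2 y0 y1 y2, triangle_named s col A0 A1 A2 O x0 x1 x2 y0 y1 y2.
Proof.
move=> bs hT; have [hp [h1 h2 h3] hs] := hT; have [us _] := bs.
have mem0 x : x \in [:: A0; A1; A2; O] -> x \in s /\ col x = 0%N.
  by rewrite -(perm_mem hp) mem_filter => /andP [/eqP].
have : uniq [:: A0; A1; A2; O] by rewrite -(perm_uniq hp) filter_uniq.
rewrite /= !inE !negb_or => /and4P [/and3P [n01 n02 n03] /andP [n12 n13] n23 _].
have [[i0 c0] [i1 c1]] : (A0 \in s /\ col A0 = 0%N) /\ (A1 \in s /\ col A1 = 0%N).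
  by split; apply: mem0; rewrite !inE eqxx ?orbT.
have [[i2 c2] [i3 c3]] : (A2 \in s /\ col A2 = 0%N) /\ (O \in s /\ col O = 0%N).
  by split; apply: mem0; rewrite !inE eqxx ?orbT.
have blk v w : v \in [:: A0; A1; A2; O] -> w \in [:: A0; A1; A2; O] -> v != w ->
    exists x, [/\ x \in s, btw x v w & x \notin [:: A0; A1; A2; O]].
  move=> /mem0 [hv cv] /mem0 [hw cw] vw.
  have [|x [hx hb hc]] := mono_blocker bs hv hw vw; first by rewrite cv.
  by exists x; split=> //; apply: contra hc => /mem0 [_ ->]; rewrite cv.
have [|||x0 [j0 b0 m0]] := blk A0 O; rewrite ?inE ?eqxx ?orbT //.
have [|||x1 [j1 b1 m1]] := blk A1 O; rewrite ?inE ?eqxx ?orbT //.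
have [|||x2 [j2 b2 m2]] := blk A2 O; rewrite ?inE ?eqxx ?orbT //.
have [|||y0 [k0 d0 l0]] := blk A1 A2; rewrite ?inE ?eqxx ?orbT //.
have [|||y1 [k1 d1 l1]] := blk A2 A0; rewrite ?inE ?eqxx ?orbT // 1?eq_sym //.
have [|||y2 [k2 d2 l2]] := blk A0 A1; rewrite ?inE ?eqxx ?orbT //.
exists x0, x1, x2, y0, y1, y2; split=> //; last by rewrite b0 b1 b2 d0 d1 d2.
  have e : orient A0 A1 A2 = orient A0 A1 O + orient A1 A2 O + orient A2 A0 O.
    by rewrite /orient; ring.
  have e1 : orient A1 A2 A0 = orient A0 A1 A2 by rewrite /orient; ring.
  have e2 : orient A2 A0 A1 = orient A0 A1 A2 by rewrite /orient; ring.
  have p012 : 0 < orient A0 A1 A2 by lra.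
  have share v w w' x y : v \in s -> w \in s -> w' \in s -> x \in s ->
      btw x v w -> btw y v w' -> w != w' -> x != y.
    by move=> hv hw hw' hx; exact: (blockers_neq bs hv hx hw hw').
  have b0' : btw x0 O A0 by rewrite btw_sym.
  have b1' : btw x1 O A1 by rewrite btw_sym.
  have b2' : btw x2 O A2 by rewrite btw_sym.
  have d0' : btw y0 A2 A1 by rewrite btw_sym.
  have d1' : btw y1 A0 A2 by rewrite btw_sym.
  have d2' : btw y2 A1 A0 by rewrite btw_sym.
  have [n10 n20 n21] : [/\ A1 != A0, A2 != A0 & A2 != A1] by split; rewrite eq_sym.
  have [n30 n31 n32] : [/\ O != A0, O != A1 & O != A2] by split; rewrite eq_sym.
  have s1 : x0 != x1 by exact: (share O A0 A1).
  have s2 : x0 != x2 by exact: (share O A0 A2).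
  have s3 : x1 != x2 by exact: (share O A1 A2).
  have s4 : y0 != y1 by exact: (share A2 A1 A0).
  have s5 : y0 != y2 by exact: (share A1 A2 A0).
  have s6 : y1 != y2 by exact: (share A0 A2 A1).
  have s7 : x0 != y1 by exact: (share A0 O A2).
  have s8 : x0 != y2 by exact: (share A0 O A1).
  have s9 : x1 != y0 by exact: (share A1 O A2).
  have s10 : x1 != y2 by exact: (share A1 O A0).
  have s11 : x2 != y0 by exact: (share A2 O A1).
  have s12 : x2 != y1 by exact: (share A2 O A0).
  have t0 : x0 != y0 by rewrite eq_sym (blockers_sep d0 b0) // e1.
  have t1 : x1 != y1 by rewrite eq_sym (blockers_sep d1 b1) // e2.
  have t2 : x2 != y2 by rewrite eq_sym (blockers_sep d2 b2).
  rewrite (cat_uniq [:: A0; A1; A2; O] [:: x0; x1; x2; y0; y1; y2]).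
  rewrite -(perm_uniq hp) filter_uniq //= (negbTE m0) (negbTE m1) (negbTE m2)
    (negbTE l0) (negbTE l1) (negbTE l2) /=.
  by rewrite !inE !negb_or s1 s2 s3 s4 s5 s6 s7 s8 s9 s10 s11 s12 t0 t1 t2.
by move=> u; rewrite !inE =>
  /or4P [/eqP->|/eqP->|/eqP->|/or4P [/eqP->|/eqP->|/eqP->|/or4P [/eqP->|/eqP->|/eqP->|/eqP->]]].
Qed.

Lemma triangle_named_rot s col A0 A1 A2 O x0 x1 x2 y0 y1 y2 :
  triangle_named s col A0 A1 A2 O x0 x1 x2 y0 y1 y2 ->
  triangle_named s col A1 A2 A0 O x1 x2 x0 y1 y2 y0.
Proof.
case=> [[hp [h1 h2 h3] hs] hu hsub hb]; split.
- split; [|by split|by move=> u /hs []].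
  by apply: perm_trans hp _; perm_tac.
- rewrite -(perm_uniq (s1 := [:: A0; A1; A2; O; x0; x1; x2; y0; y1; y2])) //.
  by have := perm_rotate A0 A1 A2 O x0 x1 x2 y0 y1 y2 [::]; rewrite !cats0.
- move=> u hu'; apply: hsub.
  have := perm_rotate A0 A1 A2 O x0 x1 x2 y0 y1 y2 [::].
  by rewrite !cats0 => /perm_mem ->.
by case/and5P: hb => b0 b1 b2 d0 /andP [d1 d2]; rewrite b0 b1 b2 d0 d1 d2.
Qed.

(** The list [l] may exceed [s] by an added point; the hull inequalities are available only for its
    first [k + 4] entries, which belong to [s]. *)
Lemma triangle_refutes s col A0 A1 A2 O x0 x1 x2 y0 y1 y2 (r : seq plane) k n nb caps sg c :
  let l := [:: A0; A1; A2; O; x0; x1; x2; y0; y1; y2] ++ r in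
  triangle_named s col A0 A1 A2 O x0 x1 x2 y0 y1 y2 ->
  blocked l col -> bounded l col -> size l = n -> size caps = 4%N ->
  (k + 4 <= n)%N -> {subset take (k + 4) l <= s} ->
  (forall d, (count (fun x => col x == d) l <= nth 0 caps d)%N) ->
  (forall i, i \in nb -> removable l (nth 0 l i)) ->
  all (sign_holds l) sg ->
  ~~ closes (refutes n nb caps c)
    (init n nb caps (triangle_signs k ++ sg) triangle_mids four_zero).
Proof.
move=> l [[hp [h1 h2 h3] hs] _ hsub hb] bl b4 sn sc kn hk hcap hnb hsg.
apply/negP => hr.
have mem0 x : x \in [:: A0; A1; A2; O] -> col x = 0%N.
  by rewrite -(perm_mem hp) mem_filter => /andP [/eqP].
apply: (refutation sn _ hr bl hcap) => //.
- by move=> z v w /hnb /removableP h; exact: h.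
- by move=> x hx; rewrite sc; exact: b4.
- by rewrite /= !mem0 ?eqxx // !inE eqxx ?orbT.
- rewrite all_cat hsg andbT /triangle_signs all_cat; apply/andP; split.
    by rewrite /= !allows_pos h1 h2 h3.
  rewrite all_flatten all_map; apply/allP => u; rewrite mem_iota => /andP [u1 u2] /=.
  have hu : nth 0 l u \in s.
    have uk : (u < k + 4)%N by rewrite addnC.
    by apply: hk; rewrite -(nth_take 0 uk) mem_nth // size_takel ?sn.
  have [g1 g2 g3] := hs _ hu.
  by move: g1 g2 g3; rewrite /l /= !allows_nonneg => -> -> ->.
by move/and5P: hb => [b0 b1 b2 d0 /andP [d1 d2]]; rewrite /= b0 b1 b2 d0 d1 d2.
Qed.

Lemma triangle_10 s col A0 A1 A2 O : blocked s col -> bounded s col ->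
  triangle_conf s col A0 A1 A2 O -> (10 <= size s)%N.
Proof.
move=> bs b4 /(triangle_named_exists bs) [x0 [x1 [x2 [y0 [y1 [y2 [_ ul sub _]]]]]]].
exact: (uniq_leq_size ul sub).
Qed.

Lemma triangle_listed s col A0 A1 A2 O : blocked s col -> bounded s col ->
  triangle_conf s col A0 A1 A2 O ->
  exists x0 x1 x2 y0 y1 y2 (r : seq plane), let l := [:: A0; A1; A2; O; x0; x1; x2; y0; y1; y2] in
  [/\ triangle_named s col A0 A1 A2 O x0 x1 x2 y0 y1 y2, perm_eq s (l ++ r)
    & size s = (10 + size r)%N].
Proof.
move=> bs b4 /(triangle_named_exists bs) [x0 [x1 [x2 [y0 [y1 [y2 hn]]]]]].
have [_ ul sub _] := hn; have [us _] := bs.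
have hp := perm_named us ul sub.
by exists x0, x1, x2, y0, y1, y2, [seq x <- s | x \notin [:: A0; A1; A2; O; x0; x1; x2; y0;
  y1; y2]];
  split=> //; rewrite (perm_size hp) size_cat.
Qed.

Lemma bounded_perm s s' col : perm_eq s s' -> bounded s col -> bounded s' col.
Proof. by move=> e h x; rewrite -(perm_mem e); exact: h. Qed.

Lemma triangle_4321 s col A0 A1 A2 O : blocked s col -> bounded s col ->
  sizes s col = [:: 4; 3; 2; 1]%N -> ~ triangle_conf s col A0 A1 A2 O.
Proof.
move=> bs b4 hz /(triangle_listed bs b4) [x0 [x1 [x2 [y0 [y1 [y2 [r [hn hp hs]]]]]]]].
have : size s = 10%N by rewrite (size_sizes b4) hz.
rewrite hs; case: r hp hs => // hp hs _.
have bl := blocked_perm hp bs; have b4' := bounded_perm hp b4.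
have := @triangle_refutes s col A0 A1 A2 O x0 x1 x2 y0 y1 y2 [::] 6 10 [::] [:: 4; 3; 2;
  1]%N [::] triangle10_cert hn bl b4'.
rewrite !cats0 triangle10_certE => H; suff: false by []; apply: H => //.
  by move=> u /mem_take; rewrite (perm_mem hp).
by apply: sizes_caps => //; rewrite -(sizes_perm col hp) hz.
Qed.

(** The lines from [O] to the corners contain only a corner, [O] and their blocker, so all three
    orientations are nonzero. Weighted by the positive areas at [O] they add up to zero, hence both
    signs occur, and in cyclic order some positive one is followed by a negative one. *)
Lemma triangle_sector s col A0 A1 A2 O y0 : blocked s col ->
  triangle_conf s col A0 A1 A2 O -> y0 \in s -> col y0 != 0%N ->
  ~~ btw y0 A0 O -> ~~ btw y0 A1 O -> ~~ btw y0 A2 O ->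
  [\/ 0 < orient O A0 y0 /\ orient O A1 y0 < 0,
      0 < orient O A1 y0 /\ orient O A2 y0 < 0
    | 0 < orient O A2 y0 /\ orient O A0 y0 < 0].
Proof.
move=> bs [hp [h1 h2 h3] _] hy cy nb0 nb1 nb2.
have mem0 x : x \in [:: A0; A1; A2; O] -> x \in s /\ col x = 0%N.
  by rewrite -(perm_mem hp) mem_filter => /andP [/eqP].
have [us _] := bs.
have : uniq [:: A0; A1; A2; O] by rewrite -(perm_uniq hp) filter_uniq.
rewrite /= !inE !negb_or => /and4P [/and3P [n01 n02 n03] /andP [n12 n13] n23 _].
have nz A : A \in [:: A0; A1; A2; O] -> A != O -> ~~ btw y0 A O -> orient O A y0 != 0.
  move=> hA nAO nb; have [iA cA] := mem0 A hA.
  have [iO cO] : O \in s /\ col O = 0%N by apply: mem0; rewrite !inE eqxx !orbT.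
  have [x [hx hb _]] := mono_blocker bs iA iO nAO (etrans cA (esym cO)).
  apply/eqP => h0; have : y0 \in [:: A; x; O].
    by apply: (blocked_collinear bs iA hx iO hy hb); rewrite orient_swap h0 oppr0.
  rewrite !inE => /or3P [] /eqP e.
  - by rewrite e cA in cy.
  - by rewrite e hb in nb.
  - by rewrite e cO in cy.
have g0 := nz A0 _ n03 nb0; have g1 := nz A1 _ n13 nb1; have g2 := nz A2 _ n23 nb2.
have {}g0 := g0 ltac:(by rewrite !inE eqxx). have {}g1 := g1 ltac:(by rewrite !inE eqxx ?orbT).
have {}g2 := g2 ltac:(by rewrite !inE eqxx ?orbT).
have e : orient A1 A2 O * orient O A0 y0 + orient A2 A0 O * orient O A1 y0 +
    orient A0 A1 O * orient O A2 y0 = 0 by rewrite /orient; ring.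
move: g0 g1 g2 e; set f0 := orient O A0 y0; set f1 := orient O A1 y0; set f2 := orient O A2 y0.
case: (ltgtP f0 0) => // k0 _; case: (ltgtP f1 0) => // k1 _; case: (ltgtP f2 0) => // k2 _ e;
  try (by constructor 1); try (by constructor 2); try (by constructor 3); exfalso; nra.
Qed.

(** The configuration is invariant under cyclic rotation of the corners and their blockers, so the
    eleventh point may be assumed to lie in the first sector. *)
Lemma triangle_listed_sector s col A0 A1 A2 O : blocked s col -> bounded s col ->
  triangle_conf s col A0 A1 A2 O -> (10 < size s)%N ->
  exists A0 A1 A2 O x0 x1 x2 y0 y1 y2 z (r : seq plane),
  let l := [:: A0; A1; A2; O; x0; x1; x2; y0; y1; y2] ++ z :: r in
  [/\ triangle_named s col A0 A1 A2 O x0 x1 x2 y0 y1 y2, perm_eq s l,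
    size s = (11 + size r)%N & 0 < orient O A0 z /\ orient O A1 z < 0].
Proof.
move=> bs b4 hT; have [x0 [x1 [x2 [y0 [y1 [y2 [r [hn hp hs]]]]]]]] := triangle_listed bs b4 hT.
case: r hp hs => [|z r hp hs _]; first by move=> _ ->.
have [us _] := bs; have [_ _ sub hb] := hn.
have hz : z \in s by rewrite (perm_mem hp) !inE eqxx !orbT.
have znot u : u \in [:: A0; A1; A2; O; x0; x1; x2; y0; y1; y2] -> u != z.
  move: us; rewrite (perm_uniq hp) cat_uniq => /and3P [_ /hasPn h _] hu.
  by apply: contraTneq hu => ->; apply: h; rewrite inE eqxx.
have nbt x A : x \in [:: A0; A1; A2; O; x0; x1; x2; y0; y1;
  y2] -> btw x A O -> A \in s -> O \in s -> ~~ btw z A O.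
  move=> hx hbx hA hO; apply/negP => hbz; have /eqP := znot x hx; apply.
  exact: (blocked_btw_uniq bs hA hz (sub _ hx) hO hbz hbx).
have [i0 [i1 [i2 i3]]] : A0 \in s /\ A1 \in s /\ A2 \in s /\ O \in s.
  by do !split; apply: sub; rewrite !inE eqxx ?orbT.
have cz : col z != 0%N.
  have [[hp0 _ _] _ _ _] := hn; apply/eqP => e.
  have : z \in [:: A0; A1; A2; O] by rewrite -(perm_mem hp0) mem_filter e eqxx.
  move=> h; have : z != z by apply: znot; move: h; rewrite !inE => /or4P [] ->; rewrite ?orbT.
  by rewrite eqxx.
have /and5P [b0 b1 b2 _ _] := hb.
have [|||h|h|h] := @triangle_sector s col A0 A1 A2 O z bs hT hz cz.
- by apply: (nbt x0); rewrite // !inE eqxx ?orbT.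
- by apply: (nbt x1); rewrite // !inE eqxx ?orbT.
- by apply: (nbt x2); rewrite // !inE eqxx ?orbT.
- by exists A0, A1, A2, O, x0, x1, x2, y0, y1, y2, z, r; split.
- exists A1, A2, A0, O, x1, x2, x0, y1, y2, y0, z, r; split; [ | | |exact: h].
  + exact: triangle_named_rot hn.
  + exact: perm_trans hp (perm_rotate _ _ _ _ _ _ _ _ _ _ _).
  by rewrite hs.
exists A2, A0, A1, O, x2, x0, x1, y2, y0, y1, z, r; split; [ | | |exact: h].
- exact: triangle_named_rot (triangle_named_rot hn).
- apply: perm_trans hp (perm_trans (perm_rotate _ _ _ _ _ _ _ _ _ _ _) _).
  exact: perm_rotate.
by rewrite hs.
Qed.

Lemma triangle_11 s col A0 A1 A2 O : blocked s col -> bounded s col ->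
  size s = 11%N -> ~ triangle_conf s col A0 A1 A2 O.
Proof.
move=> bs b4 hs /(triangle_listed_sector bs b4); rewrite hs => /(_ isT).
case=> B0 [B1 [B2 [Q [x0 [x1 [x2 [y0 [y1 [y2 [z [r [hn hp hr [hz1 hz2]]]]]]]]]]]]].
case: r hp hr => // hp _.
have bl := blocked_perm hp bs; have b4' := bounded_perm hp b4.
have := @triangle_refutes s col B0 B1 B2 Q x0 x1 x2 y0 y1 y2 [:: z] 7 11 [::] [:: 11; 11;
  11; 11]%N [:: (3, 0, 10, pos); (3, 1, 10, neg)]%N triangle11_cert hn bl b4'.
rewrite triangle11_certE => H; suff: false by []; apply: H => //.
- by move=> u /mem_take; rewrite (perm_mem hp).
- exact: bounded_caps.
by rewrite /= allows_pos allows_neg hz1 hz2.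
Qed.

Lemma triangle_12 s col A0 A1 A2 O : blocked s col -> bounded s col ->
  sizes s col = [:: 4; 3; 3; 2]%N -> ~ triangle_conf s col A0 A1 A2 O.
Proof.
move=> bs b4 hz /(triangle_listed_sector bs b4).
have hs : size s = 12%N by rewrite (size_sizes b4) hz.
rewrite hs => /(_ isT).
case=> B0 [B1 [B2 [Q [x0 [x1 [x2 [y0 [y1 [y2 [z [r [hn hp hr [hz1 hz2]]]]]]]]]]]]].
case: r hp hr => [|z' [|]] // hp _.
have bl := blocked_perm hp bs; have b4' := bounded_perm hp b4.
have := @triangle_refutes s col B0 B1 B2 Q x0 x1 x2 y0 y1 y2 [:: z; z'] 8 12 [::] [:: 4; 3;
  3; 3]%N [:: (3, 0, 10, pos); (3, 1, 10, neg)]%N triangle12_cert hn bl b4'.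
rewrite triangle12_certE => H; suff: false by []; apply: H => //.
- by move=> u /mem_take; rewrite (perm_mem hp).
- by apply: sizes_caps => //; rewrite -(sizes_perm col hp) hz.
by rewrite /= allows_pos allows_neg hz1 hz2.
Qed.

(** The point [z] is listed last and so has number 10, the one that the certificate forbids as a
    blocker. *)
Lemma triangle_10_extended s z col A0 A1 A2 O : blocked s col -> bounded s col ->
  size s = 10%N -> blocked (z :: s) col -> (col z < 4)%N -> removable (z :: s) z ->
  ~ triangle_conf s col A0 A1 A2 O.
Proof.
move=> bs b4 hs bz cz hrem /(triangle_listed bs b4) [x0 [x1 [x2 [y0 [y1 [y2 [r [hn hp]]]]]]]].
rewrite hs; case: r hp => // hp _; rewrite cats0 in hp.
set l := [:: A0; A1; A2; O; x0; x1; x2; y0; y1; y2] in hp.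
have hpz : perm_eq (z :: s) (l ++ [:: z]).
  by rewrite perm_sym perm_catC /= perm_cons perm_sym.
have bl := blocked_perm hpz bz.
have b4' : bounded (l ++ [:: z]) col.
  by apply: bounded_perm hpz _ => x; rewrite inE => /orP [/eqP ->|/b4].
have := @triangle_refutes s col A0 A1 A2 O x0 x1 x2 y0 y1 y2 [:: z] 6 11 [:: 10%N] [:: 11;
  11; 11; 11]%N [::] triangle10z_cert hn bl b4'.
rewrite cats0 triangle10z_certE => H; suff: false by []; apply: H => //.
- by move=> u; rewrite take_cat /= => hu; rewrite (perm_mem hp).
- exact: bounded_caps.
move=> i; rewrite inE => /eqP ->; apply/removableP => v w.
by rewrite -!(perm_mem hpz); exact: (removableP _ _ hrem).
Qed.

End Refutations.

(** * A class in convex position *)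

Section Quadrilaterals.
Variable R : realType.
Local Notation plane := 'rV[R]_2.
Implicit Types (p q r u v w x y z : plane) (s : seq plane) (col : plane -> nat).

Definition quad_named s col A0 A1 A2 A3 x0 x1 x2 x3 :=
  let l := [:: A0; A1; A2; A3; x0; x1; x2; x3] in
  [/\ quad_conf s col A0 A1 A2 A3, uniq l, {subset l <= s}
    & [&& btw x0 A0 A1, btw x1 A1 A2, btw x2 A2 A3 & btw x3 A3 A0]].

Lemma quad_named_exists s col A0 A1 A2 A3 : blocked s col ->
  quad_conf s col A0 A1 A2 A3 ->
  exists x0 x1 x2 x3, quad_named s col A0 A1 A2 A3 x0 x1 x2 x3.
Proof.
move=> bs hT; have [hp [h1 h2 h3 h4] hs] := hT; have [us _] := bs.
have mem0 x : x \in [:: A0; A1; A2; A3] -> x \in s /\ col x = 0%N.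
  by rewrite -(perm_mem hp) mem_filter => /andP [/eqP].
have : uniq [:: A0; A1; A2; A3] by rewrite -(perm_uniq hp) filter_uniq.
rewrite /= !inE !negb_or => /and4P [/and3P [n01 n02 n03] /andP [n12 n13] n23 _].
have [[i0 c0] [i1 c1]] : (A0 \in s /\ col A0 = 0%N) /\ (A1 \in s /\ col A1 = 0%N).
  by split; apply: mem0; rewrite !inE eqxx ?orbT.
have [[i2 c2] [i3 c3]] : (A2 \in s /\ col A2 = 0%N) /\ (A3 \in s /\ col A3 = 0%N).
  by split; apply: mem0; rewrite !inE eqxx ?orbT.
have blk v w : v \in [:: A0; A1; A2; A3] -> w \in [:: A0; A1; A2; A3] -> v != w ->
    exists x, [/\ x \in s, btw x v w & x \notin [:: A0; A1; A2; A3]].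
  move=> /mem0 [hv cv] /mem0 [hw cw] vw.
  have [|x [hx hb hc]] := mono_blocker bs hv hw vw; first by rewrite cv.
  by exists x; split=> //; apply: contra hc => /mem0 [_ ->]; rewrite cv.
have [|||x0 [j0 b0 m0]] := blk A0 A1; rewrite ?inE ?eqxx ?orbT //.
have [|||x1 [j1 b1 m1]] := blk A1 A2; rewrite ?inE ?eqxx ?orbT //.
have [|||x2 [j2 b2 m2]] := blk A2 A3; rewrite ?inE ?eqxx ?orbT //.
have [|||x3 [j3 b3 m3]] := blk A3 A0; rewrite ?inE ?eqxx ?orbT // 1?eq_sym //.
exists x0, x1, x2, x3; split=> //; last by rewrite b0 b1 b2 b3.
  have e1 : orient A1 A2 A0 = orient A0 A1 A2 by rewrite /orient; ring.
  have share v w w' x y : v \in s -> w \in s -> w' \in s -> x \in s ->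
      btw x v w -> btw y v w' -> w != w' -> x != y.
    by move=> hv hw hw' hx; exact: (blockers_neq bs hv hx hw hw').
  have b0' : btw x0 A1 A0 by rewrite btw_sym.
  have b1' : btw x1 A2 A1 by rewrite btw_sym.
  have b2' : btw x2 A3 A2 by rewrite btw_sym.
  have b3' : btw x3 A0 A3 by rewrite btw_sym.
  have [n20 n31] : A2 != A0 /\ A3 != A1 by split; rewrite eq_sym.
  have s1 : x0 != x1 by exact: (share A1 A0 A2).
  have s2 : x1 != x2 by exact: (share A2 A1 A3).
  have s3 : x2 != x3 by exact: (share A3 A2 A0).
  have s4 : x0 != x3 by exact: (share A0 A1 A3).
  have t0 : x0 != x2 by rewrite (blockers_sep b0 b2).
  have t1 : x1 != x3 by rewrite (blockers_sep b1 b3) // e1.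
  rewrite (cat_uniq [:: A0; A1; A2; A3] [:: x0; x1; x2; x3]).
  rewrite -(perm_uniq hp) filter_uniq //= (negbTE m0) (negbTE m1) (negbTE m2) (negbTE m3) /=.
  by rewrite !inE !negb_or s1 s2 s3 s4 t0 t1.
by move=> u; rewrite !inE =>
  /or4P [/eqP->|/eqP->|/eqP->|/or4P [/eqP->|/eqP->|/eqP->|/orP [/eqP->|/eqP->]]].
Qed.

Lemma quad_refutes s col A0 A1 A2 A3 x0 x1 x2 x3 (r : seq plane) k n nb caps c :
  let l := [:: A0; A1; A2; A3; x0; x1; x2; x3] ++ r in
  quad_named s col A0 A1 A2 A3 x0 x1 x2 x3 ->
  blocked l col -> bounded l col -> size l = n -> size caps = 4%N ->
  (k + 4 <= n)%N -> {subset take (k + 4) l <= s} ->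
  (forall d, (count (fun x => col x == d) l <= nth 0 caps d)%N) ->
  (forall i, i \in nb -> removable l (nth 0 l i)) ->
  ~~ closes (refutes n nb caps c)
    (init n nb caps (quad_signs k) quad_mids four_zero).
Proof.
move=> l [[hp [h1 h2 h3 h4] hs] _ hsub hb] bl b4 sn sc kn hk hcap hnb.
apply/negP => hr.
have mem0 x : x \in [:: A0; A1; A2; A3] -> col x = 0%N.
  by rewrite -(perm_mem hp) mem_filter => /andP [/eqP].
apply: (refutation sn _ hr bl hcap) => //.
- by move=> z v w /hnb /removableP h; exact: h.
- by move=> x hx; rewrite sc; exact: b4.
- by rewrite /= !mem0 ?eqxx // !inE eqxx ?orbT.
- rewrite /quad_signs all_cat; apply/andP; split.
    by rewrite /= !allows_pos h1 h2 h3 h4.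
  rewrite all_flatten all_map; apply/allP => u; rewrite mem_iota => /andP [u1 u2] /=.
  have hu : nth 0 l u \in s.
    have uk : (u < k + 4)%N by rewrite addnC.
    by apply: hk; rewrite -(nth_take 0 uk) mem_nth // size_takel ?sn.
  have [g1 g2 g3 g4] := hs _ hu.
  by move: g1 g2 g3 g4; rewrite /l /= !allows_nonneg => -> -> -> ->.
by move/and4P: hb => [b0 b1 b2 b3]; rewrite /= b0 b1 b2 b3.
Qed.

Lemma quad_listed s col A0 A1 A2 A3 : blocked s col ->
  quad_conf s col A0 A1 A2 A3 ->
  exists x0 x1 x2 x3 (r : seq plane), let l := [:: A0; A1; A2; A3; x0; x1; x2; x3] in
  [/\ quad_named s col A0 A1 A2 A3 x0 x1 x2 x3, perm_eq s (l ++ r)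
    & size s = (8 + size r)%N].
Proof.
move=> bs /(quad_named_exists bs) [x0 [x1 [x2 [x3 hn]]]].
have [_ ul sub _] := hn; have [us _] := bs.
have hp := perm_named us ul sub.
by exists x0, x1, x2, x3, [seq x <- s | x \notin [:: A0; A1; A2; A3; x0; x1; x2; x3]];
  split=> //; rewrite (perm_size hp) size_cat.
Qed.

(** A diagonal needs a blocker, and none of the eight named points can be one. *)
Lemma quad_9 s col A0 A1 A2 A3 : blocked s col -> bounded s col ->
  quad_conf s col A0 A1 A2 A3 -> (9 <= size s)%N.
Proof.
move=> bs b4 /(quad_listed bs) [x0 [x1 [x2 [x3 [r [hn hp ->]]]]]].
case: r hp => // hp.
have bl := blocked_perm hp bs; have b4' := bounded_perm hp b4.
have := @quad_refutes s col A0 A1 A2 A3 x0 x1 x2 x3 [::] 4 8 [::] [:: 10; 10; 10;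
  10]%N quad8_cert hn bl b4'.
rewrite quad8_certE => H; suff: false by []; apply: H => //.
  by move=> u /mem_take; rewrite (perm_mem hp).
exact: bounded_caps.
Qed.

Lemma quad_4222 s col A0 A1 A2 A3 : blocked s col -> bounded s col ->
  sizes s col = [:: 4; 2; 2; 2]%N -> ~ quad_conf s col A0 A1 A2 A3.
Proof.
move=> bs b4 hz /(quad_listed bs) [x0 [x1 [x2 [x3 [r [hn hp]]]]]].
have -> : size s = 10%N by rewrite (size_sizes b4) hz.
case: r hp => [|y [|y' [|]]] // hp _.
have bl := blocked_perm hp bs; have b4' := bounded_perm hp b4.
have := @quad_refutes s col A0 A1 A2 A3 x0 x1 x2 x3 [:: y; y'] 6 10 [::] [:: 4; 2; 2;
  2]%N quad10_cert hn bl b4'.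
rewrite quad10_certE => H; suff: false by []; apply: H => //.
  by move=> u /mem_take; rewrite (perm_mem hp).
by apply: sizes_caps => //; rewrite -(sizes_perm col hp) hz.
Qed.

Lemma quad_9_extended s z col A0 A1 A2 A3 : blocked s col -> bounded s col ->
  size s = 9%N -> blocked (z :: s) col -> (col z < 4)%N -> removable (z :: s) z ->
  ~ quad_conf s col A0 A1 A2 A3.
Proof.
move=> bs b4 hs bz cz hrem /(quad_listed bs) [x0 [x1 [x2 [x3 [r [hn hp]]]]]].
rewrite hs; case: r hp => [|y [|]] // hp _.
set l := [:: A0; A1; A2; A3; x0; x1; x2; x3; y].
have hpz : perm_eq (z :: s) (l ++ [:: z]).
  by rewrite perm_sym perm_catC /= perm_cons perm_sym.
have bl := blocked_perm hpz bz.
have b4' : bounded (l ++ [:: z]) col.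
  by apply: bounded_perm hpz _ => x; rewrite inE => /orP [/eqP ->|/b4].
have := @quad_refutes s col A0 A1 A2 A3 x0 x1 x2 x3 [:: y; z] 5 10 [:: 9%N] [:: 10; 10; 10;
  10]%N quad9z_cert hn bl b4'.
rewrite quad9z_certE => H; suff: false by []; apply: H => //.
- by move=> u; rewrite /= => hu; rewrite (perm_mem hp).
- exact: bounded_caps.
move=> i; rewrite inE => /eqP ->; apply/removableP => v w.
by rewrite -!(perm_mem hpz); exact: (removableP _ _ hrem).
Qed.

Lemma triangle_corners s col A0 A1 A2 O : triangle_conf s col A0 A1 A2 O ->
  all (removable s) [:: A0; A1; A2].
Proof.
case=> _ [h1 h2 h3] hs.
have e : orient A0 A1 A2 = orient A0 A1 O + orient A1 A2 O + orient A2 A0 O.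
  by rewrite /orient; ring.
have e1 : orient A1 A2 A0 = orient A0 A1 A2 by rewrite /orient; ring.
have e2 : orient A2 A0 A1 = orient A0 A1 A2 by rewrite /orient; ring.
have hp : 0 < orient A0 A1 A2 by lra.
rewrite /= andbT; apply/and3P; split.
- apply: (@corner_removable _ _ A0 A1 A2); first exact: lt0r_neq0.
    by move=> u /hs [].
  by move=> u /hs [].
- apply: (@corner_removable _ _ A1 A2 A0); first by rewrite e1 lt0r_neq0.
    by move=> u /hs [].
  by move=> u /hs [].
apply: (@corner_removable _ _ A2 A0 A1); first by rewrite e2 lt0r_neq0.
  by move=> u /hs [].
by move=> u /hs [].
Qed.

Lemma quad_corners s col A0 A1 A2 A3 : quad_conf s col A0 A1 A2 A3 ->
  all (removable s) [:: A0; A1; A2; A3].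
Proof.
case=> _ [h1 h2 h3 h4] hs.
have e1 : orient A2 A3 A1 = orient A1 A2 A3 by rewrite /orient; ring.
have e2 : orient A3 A0 A2 = orient A0 A2 A3 by rewrite /orient; ring.
have e3 : orient A0 A1 A3 = orient A3 A0 A1 by rewrite /orient; ring.
rewrite /= andbT; apply/and4P; split.
- by apply: (@corner_removable _ _ A0 A1 A3); rewrite ?lt0r_neq0 // => u /hs [].
- apply: (@corner_removable _ _ A1 A2 A0) => [|u /hs []|u /hs []] //.
  by rewrite -orient_cycle lt0r_neq0 // -orient_cycle.
- by apply: (@corner_removable _ _ A2 A3 A1); rewrite ?e1 ?lt0r_neq0 // => u /hs [].
by apply: (@corner_removable _ _ A3 A0 A2); rewrite ?e2 ?lt0r_neq0 // => u /hs [].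
Qed.

End Quadrilaterals.

(** * Class sizes 3, 3, 3, 1 *)

Section Classes.
Variable R : realType.
Local Notation plane := 'rV[R]_2.
Implicit Types (p q u v w x y z : plane) (s : seq plane) (col : plane -> nat).

Definition class s col i := [seq x <- s | col x == i].

Lemma mem_class s col i x : (x \in class s col i) = (x \in s) && (col x == i).
Proof. by rewrite mem_filter andbC. Qed.

Lemma size_class s col i : size (class s col i) = class_size s col i.
Proof. exact: size_filter. Qed.

Lemma perm_classes s col : bounded s col ->
  perm_eq s (class s col 0 ++ class s col 1 ++ class s col 2 ++ class s col 3).
Proof.
move=> h4; apply/seq.permP => a; rewrite !count_cat !count_filter.
elim: s h4 => // x s IH h4 /=; rewrite IH; last by move=> y hy; apply: h4; rewrite inE hy orbT.
have : (col x < 4)%N by apply: h4; rewrite inE eqxx.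
by case: (col x) => [|[|[|[|]]]] //= _; rewrite ?andbT ?andbF; clear; lia.
Qed.

Lemma class_extend s col i (K : seq plane) t : blocked s col -> uniq K ->
  {subset K <= s} -> all (fun x => col x == i) K -> sizes s col = t -> (i < 4)%N ->
  exists r, perm_eq (class s col i) (K ++ r) /\ size r = (nth 0 t i - size K)%N.
Proof.
move=> [us _] uK sub /allP hc ht hi.
have subc : {subset K <= class s col i} by move=> x hx; rewrite mem_class sub //= hc.
have hp := perm_named (filter_uniq _ us) uK subc.
eexists; split; first exact: hp.
by rewrite -(sizes_eqP ht hi) -size_class (perm_size hp) size_cat addKn.
Qed.

Lemma sizes_relabel s (f : nat -> nat) col i : involutive f ->
  class_size s (f \o col) i = class_size s col (f i).
Proof. by move=> fK; apply: eq_count => x /=; rewrite -(inj_eq (inv_inj fK)) fK. Qed.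

Lemma col_holds_all s col : all (col_holds s col) (zip (iota 0 (size s)) (map col s)).
Proof.
have -> : map col s = [seq col (nth 0 s i) | i <- iota 0 (size s)].
  by rewrite -[in LHS](mkseq_nth 0 s) /mkseq -map_comp.
have -> : zip (iota 0 (size s)) [seq col (nth 0 s i) | i <- iota 0 (size s)] =
    [seq (i, col (nth 0 s i)) | i <- iota 0 (size s)].
  by elim: (iota _ _) => //= i l ->.
by rewrite all_map; apply/allP => i; rewrite mem_iota /col_holds /= => ->; rewrite eqxx.
Qed.

Definition class_colours (t : seq nat) : seq nat :=
  nseq (nth 0 t 0) 0%N ++ nseq (nth 0 t 1) 1%N ++ nseq (nth 0 t 2) 2%N ++ nseq (nth 0 t 3) 3%N.

(** For refutations from the sizes alone: the points are listed class by class, so that their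
    numbers determine their colours. *)
Lemma small_refutes s col t k (l := class_colours t) : blocked s col -> bounded s col ->
  sizes s col = t -> ~~ closes (refutes (size l) [::] t k)
    (init (size l) [::] t [::] [::] (zip (iota 0 (size l)) l)).
Proof.
move=> bs b4 ht; apply/negP => hr.
have hp := perm_classes b4; set s' := _ ++ _ in hp.
have bs' := blocked_perm hp bs; have b4' := bounded_perm hp b4.
have nz i : (i < 4)%N -> map col (class s col i) = nseq (nth 0 t i) i.
  move=> hi; rewrite -(sizes_eqP ht hi) -size_class -(size_map col).
  by apply/all_pred1P; rewrite all_map; apply/allP => x; rewrite mem_class => /andP [].
have el : map col s' = l by rewrite !map_cat !nz.
have sn : size s' = size l by rewrite -el size_map.
have st : size t = 4%N by rewrite -ht size_map.
apply: (refutation sn _ hr bs') => //.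
- apply: sizes_caps => //; apply/allP => i _.
  by rewrite -(sizes_perm col hp) ht.
- by rewrite st.
- by move: (col_holds_all s' col); rewrite el sn.
Qed.

End Classes.

Section SingletonClass.
Variable R : realType.
Local Notation plane := 'rV[R]_2.
Implicit Types (p q u v w x y z : plane) (s : seq plane) (col : plane -> nat).

Lemma oriented_pair s col i p q D : blocked s col -> sizes s col = [:: 3; 3; 3; 1]%N ->
  (i < 3)%N -> p \in s -> q \in s -> col p = i -> col q = i -> btw D p q ->
  exists p' q' r', [/\ perm_eq (class s col i) [:: p'; q'; r'], btw D p' q'
    & 0 < orient p' q' r'].
Proof.
move=> bs hz hi hp hq cp cq hb; have [_ _ npq] := btw_neq hb.
have [|||r [hperm sr]] := @class_extend _ s col i [:: p;
  q] _ bs _ _ _ hz (ltn_trans hi (ltnSn 3)).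
- by rewrite /= inE npq.
- by move=> x; rewrite !inE => /orP [] /eqP ->.
- by rewrite /= cp cq eqxx.
have {}sr : size r = 1%N by rewrite sr; case: (i) hi => [|[|[|]]].
case: r sr hperm => [|r [|]] // _ hperm.
have hr : r \in s /\ col r = i.
  have : r \in class s col i by rewrite (perm_mem hperm) !inE eqxx !orbT.
  by rewrite mem_class => /andP [h /eqP].
have : uniq [:: p; q; r] by rewrite -(perm_uniq hperm) filter_uniq //; case: bs.
rewrite /= !inE negb_or => /and3P [/andP [_ npr] nqr _].
have o0 : orient p q r != 0 by apply: (mono_orient bs); rewrite ?cp ?cq; case: hr.
case: (ltgtP (orient p q r) 0) o0 => // h _; last by exists p, q, r.
exists q, p, r; split; last by rewrite orient_swap oppr_gt0.
  by apply: perm_trans hperm _; perm_tac.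
by rewrite btw_sym.
Qed.

Lemma single_blocks_all_classes s col D p0 q0 p1 q1 p2 q2 : blocked s col -> bounded s col ->
  sizes s col = [:: 3; 3; 3; 1]%N -> D \in s -> col D = 3%N ->
  [/\ p0 \in s, q0 \in s, p1 \in s, q1 \in s & p2 \in s /\ q2 \in s] ->
  [/\ col p0 = 0, col q0 = 0, col p1 = 1, col q1 = 1 & col p2 = 2 /\ col q2 = 2]%N ->
  btw D p0 q0 -> btw D p1 q1 -> btw D p2 q2 -> False.
Proof.
move=> bs b4 hz hD cD [i1 i2 i3 i4 [i5 i6]] [c1 c2 c3 c4 [c5 c6]] h0 h1 h2.
have [a0 [b0 [d0 [e0 f0 g0]]]] := oriented_pair bs hz (isT : 0 < 3)%N i1 i2 c1 c2 h0.
have [a1 [b1 [d1 [e1 f1 g1]]]] := oriented_pair bs hz (isT : 1 < 3)%N i3 i4 c3 c4 h1.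
have [a2 [b2 [d2 [e2 f2 g2]]]] := oriented_pair bs hz (isT : 2 < 3)%N i5 i6 c5 c6 h2.
have [|||r [e3 sr]] := @class_extend _ s col 3 [:: D] _ bs _ _ _ hz isT => //.
- by move=> x; rewrite inE => /eqP ->.
- by rewrite /= cD.
case: r sr e3 => // _ e3.
have cE i l : perm_eq (class s col i) l -> all (fun x => col x == i) l.
  by move=> e; rewrite -(perm_all _ e); apply/allP => x; rewrite mem_class => /andP [].
have := perm_classes b4 => hp.
have {}hp : perm_eq s ([:: a0; b0; d0] ++ [:: a1; b1; d1] ++ [:: a2; b2; d2] ++ [:: D]).
  by apply: perm_trans hp _; rewrite !perm_cat.
have bs' := blocked_perm hp bs; have b4' := bounded_perm hp b4.
have /and4P [/eqP k1 /eqP k2 /eqP k3 _] := cE _ _ e0.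
have /and4P [/eqP k4 /eqP k5 /eqP k6 _] := cE _ _ e1.
have /and4P [/eqP k7 /eqP k8 /eqP k9 _] := cE _ _ e2.
apply: (refutation (n := 10) _ _ ddd_certE bs') => //.
- by apply: sizes_caps => //; rewrite -(sizes_perm col hp) hz.
- by rewrite /= /col_holds /= k1 k2 k3 k4 k5 k6 k7 k8 k9 cD.
- by rewrite /= !allows_pos g0 g1 g2.
by rewrite /= f0 f1 f2.
Qed.

(** Reflecting the roles of [a1] and [a2] keeps the pattern of colours, so the triangle may be taken
    counterclockwise, as [bbc_cert] assumes. *)
Lemma two_one_blockers s col a0 a1 a2 x01 x02 x12 : blocked s col -> bounded s col ->
  sizes s col = [:: 3; 3; 3; 1]%N -> perm_eq (class s col 0) [:: a0; a1; a2] ->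
  x01 \in s -> x02 \in s -> x12 \in s ->
  btw x01 a0 a1 -> btw x02 a0 a2 -> btw x12 a1 a2 ->
  col x01 = 1%N -> col x02 = 1%N -> col x12 = 2%N -> False.
Proof.
wlog ho : a1 a2 x01 x02 / 0 < orient a0 a1 a2.
  move=> W bs b4 hz hp h01 h02 h12 b01 b02 b12 c01 c02 c12.
  have hin a : a \in [:: a0; a1; a2] -> a \in s /\ col a = 0%N.
    by rewrite -(perm_mem hp) mem_class => /andP [? /eqP].
  have [[i0 k0] [i1 k1] [i2 k2]] : [/\ a0 \in s /\ col a0 = 0%N,
    a1 \in s /\ col a1 = 0%N & a2 \in s /\ col a2 = 0%N].
    by split; apply: hin; rewrite !inE eqxx ?orbT.
  have [_ _ n01] := btw_neq b01; have [_ _ n02] := btw_neq b02; have [_ _ n12] := btw_neq b12.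
  have o0 : orient a0 a1 a2 != 0 by apply: (mono_orient bs); rewrite ?k0 ?k1 ?k2.
  case: (ltgtP (orient a0 a1 a2) 0) o0 => // h _; last exact: (W a1 a2 x01 x02).
  apply: (W a2 a1 x02 x01) => //; first by rewrite orient_flip oppr_gt0.
    by apply: perm_trans hp _; perm_tac.
  by rewrite btw_sym.
move=> bs b4 hz e0 h01 h02 h12 b01 b02 b12 c01 c02 c12.
have cE i l : perm_eq (class s col i) l -> all (fun x => (x \in s) && (col x == i)) l.
  by move=> e; rewrite -(perm_all _ e); apply/allP => x; rewrite mem_class.
have /and4P [/andP [i0 /eqP k0] /andP [i1 /eqP k1] /andP [i2 /eqP k2] _] := cE _ _ e0.
have [_ _ n12] := btw_neq b12.
have nx : x01 != x02 := blockers_neq bs i0 h01 i1 i2 b01 b02 n12.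
have [|||r1 [e1 sr1]] := @class_extend _ s col 1 [:: x01; x02] _ bs _ _ _ hz isT.
- by rewrite /= inE nx.
- by move=> x; rewrite !inE => /orP [] /eqP ->.
- by rewrite /= c01 c02.
have [|||r2 [e2 sr2]] := @class_extend _ s col 2 [:: x12] _ bs _ _ _ hz isT => //.
- by move=> x; rewrite inE => /eqP ->.
- by rewrite /= c12.
have [|||r3 [e3 sr3]] := @class_extend _ s col 3 [::] _ bs _ _ _ hz isT => //.
case: r1 sr1 e1 => [|b2 [|]] // _ e1; case: r2 sr2 e2 => [|d1 [|d2 [|]]] // _ e2.
case: r3 sr3 e3 => [|D [|]] // _ e3.
have hp : perm_eq s ([:: a0; a1; a2] ++ [:: x01; x02; b2] ++ [:: x12; d1; d2] ++ [:: D]).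
  by apply: perm_trans (perm_classes b4) _; rewrite !perm_cat.
have bs' := blocked_perm hp bs; have b4' := bounded_perm hp b4.
have /and4P [_ _ /andP [_ /eqP k5] _] := cE _ _ e1.
have /and4P [_ /andP [_ /eqP k7] /andP [_ /eqP k8] _] := cE _ _ e2.
have /andP [/andP [_ /eqP k9] _] := cE _ _ e3.
apply: (refutation (n := 10) _ _ bbc_certE bs') => //.
- by apply: sizes_caps => //; rewrite -(sizes_perm col hp) hz.
- by rewrite /= /col_holds /= k0 k1 k2 c01 c02 k5 c12 k7 k8 k9.
- by rewrite /= !allows_pos ho.
by rewrite /= b01 b02 b12.
Qed.

End SingletonClass.

Lemma allowed_zero t : size t = 4%N -> allowed t -> 0%N \in t -> all (fun n => n <= 2)%N t.
Proof.
rewrite /allowed => st + h0; rewrite -(all_sort _ geq).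
have := sort_sorted geq_total t; have : 0%N \in sort geq t by rewrite mem_sort.
have : size (sort geq t) = 4%N by rewrite size_sort.
case: (sort geq t) => [|a [|b [|c [|d [|]]]]] // _ /=; rewrite !inE !(eq_sym 0%N).
move=> h /and4P [ba cb dc _].
have -> : d == 0%N.
  by case/or4P: h => // /eqP e; move: ba cb dc; rewrite e ?leqn0; case: (d) => //; clear; lia.
case: eqP => [->|_] hh; last by rewrite hh (leq_trans ba hh) (leq_trans cb (leq_trans ba hh)) (leq_trans dc (leq_trans cb (leq_trans ba hh))).
by move: hh ba cb dc; clear; lia.
Qed.

Section Step.
Variable R : realType.
Local Notation plane := 'rV[R]_2.
Implicit Types (p q u v w x y z : plane) (s : seq plane) (col : plane -> nat).

(** The induction hypothesis. It ranges over all colourings because colours are permuted freely in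
    the proof. *)
Definition hereditary n := forall s col, (size s < n)%N -> blocked s col ->
  bounded s col -> allowed (sizes s col).

Lemma hereditary_le m n : (m <= n)%N -> hereditary n -> hereditary m.
Proof. by move=> mn h s col hs; apply: h; exact: leq_trans hs mn. Qed.

(** Keep only the points in the closed triangle and delete its corners. Class 0 is then empty, so by
    the induction hypothesis and [allowed_zero] every class has at most two points, yet the three
    blockers of the sides remain and share a colour. *)
Lemma triangle_few s col a0 a1 a2 c x01 x02 x12 : hereditary (size s) ->
  blocked s col -> bounded s col ->
  perm_eq (class s col 0) [:: a0; a1; a2] -> x01 \in s -> x02 \in s -> x12 \in s ->
  btw x01 a0 a1 -> btw x02 a0 a2 -> btw x12 a1 a2 ->
  col x01 = c -> col x02 = c -> col x12 = c -> False.
Proof.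
wlog ho : a1 a2 x01 x02 / 0 < orient a0 a1 a2.
  move=> W IH bs b4 hp h01 h02 h12 b01 b02 b12 c01 c02 c12.
  have hin a : a \in [:: a0; a1; a2] -> a \in s /\ col a = 0%N.
    by rewrite -(perm_mem hp) mem_class => /andP [? /eqP].
  have [[i0 k0] [i1 k1] [i2 k2]] : [/\ a0 \in s /\ col a0 = 0%N,
    a1 \in s /\ col a1 = 0%N & a2 \in s /\ col a2 = 0%N].
    by split; apply: hin; rewrite !inE eqxx ?orbT.
  have [_ _ n01] := btw_neq b01; have [_ _ n02] := btw_neq b02; have [_ _ n12] := btw_neq b12.
  have o0 : orient a0 a1 a2 != 0 by apply: (mono_orient bs); rewrite ?k0 ?k1 ?k2.
  case: (ltgtP (orient a0 a1 a2) 0) o0 => // h _; last exact: (W a1 a2 x01 x02).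
  apply: (W a2 a1 x02 x01) => //; first by rewrite orient_flip oppr_gt0.
    by apply: perm_trans hp _; perm_tac.
  by rewrite btw_sym.
move=> IH bs b4 hp h01 h02 h12 b01 b02 b12 c01 c02 c12; have [us _] := bs.
have hin a : a \in [:: a0; a1; a2] -> a \in s /\ col a = 0%N.
  by rewrite -(perm_mem hp) mem_class => /andP [? /eqP].
have [[i0 k0] [i1 k1] [i2 k2]] : [/\ a0 \in s /\ col a0 = 0%N,
  a1 \in s /\ col a1 = 0%N & a2 \in s /\ col a2 = 0%N].
  by split; apply: hin; rewrite !inE eqxx ?orbT.
pose a : pred plane := fun u =>
  [&& 0 <= orient a0 a1 u, 0 <= orient a1 a2 u & 0 <= orient a2 a0 u].
have o1 : orient a1 a2 a0 = orient a0 a1 a2 by rewrite /orient; ring.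
have o2 : orient a2 a0 a1 = orient a0 a1 a2 by rewrite /orient; ring.
have z1 p q : orient p q p = 0 by rewrite /orient; ring.
have z2 p q : orient p q q = 0 by rewrite /orient; ring.
have aa0 : a a0 by rewrite /a z1 z2 o1 lexx (ltW ho).
have aa1 : a a1 by rewrite /a z1 z2 o2 lexx (ltW ho).
have aa2 : a a2 by rewrite /a z1 z2 lexx (ltW ho).
have cvx x v w : a v -> a w -> btw x v w -> a x.
  move=> /and3P [v1 v2 v3] /and3P [w1 w2 w3] hb.
  by apply/and3P; split; apply: orient_convex hb _ _.
have bs1 : blocked (filter a s) col.
  by apply: blocked_filter bs _ => v w x _ _ _; exact: cvx.
have hr : all (removable (filter a s)) [:: a0; a1; a2].
  have ha u : u \in filter a s ->
    [/\ 0 <= orient a0 a1 u, 0 <= orient a1 a2 u & 0 <= orient a2 a0 u].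
    by rewrite mem_filter => /andP [/and3P].
  rewrite /= andbT; apply/and3P; split.
  - by apply: (@corner_removable _ _ a0 a1 a2); rewrite ?lt0r_neq0 // => u /ha [].
  - by apply: (@corner_removable _ _ a1 a2 a0); rewrite ?o1 ?lt0r_neq0 // => u /ha [].
  by apply: (@corner_removable _ _ a2 a0 a1); rewrite ?o2 ?lt0r_neq0 // => u /ha [].
have bs2 := blocked_remove hr bs1.
set s2 := filter _ _ in bs2.
have mem2 x : (x \in s2) = [&& x \in s, a x & x \notin [:: a0; a1; a2]].
  by rewrite mem_filter mem_filter andbC [a x && _]andbC -andbA.
have us2 : uniq s2 by case: bs2.
have sz : (size s2 < size s)%N.
  have us2' : uniq (a0 :: s2) by rewrite /= us2 andbT mem2 mem_head /= !andbF.
  apply: (uniq_leq_size us2') => x; rewrite inE => /orP [/eqP -> //|].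
  by rewrite mem2 => /and3P [].
have b42 : bounded s2 col by move=> x; rewrite mem2 => /and3P [/b4].
have := IH s2 col sz bs2 b42 => hal.
have z0 : class_size s2 col 0 = 0%N.
  apply/eqP; rewrite -leqn0 leqNgt -has_count; apply/hasPn => x.
  rewrite mem2 => /and3P [hx _]; apply: contra => cx.
  by rewrite -(perm_mem hp) mem_class hx.
have in2 x v w : v \in s -> w \in s -> x \in s -> btw x v w -> a v -> a w -> col v = 0%N ->
  x \in s2.
  move=> hv hw hx hb av aw cv; rewrite mem2 hx (cvx _ _ _ av aw hb) /=.
  have [_] := blocked_btw_col bs hv hx hw hb; rewrite cv.
  by apply: contra => /hin [_ ->].
have [_ _ n01] := btw_neq b01; have [_ _ n02] := btw_neq b02; have [_ _ n12] := btw_neq b12.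
have d1 : x01 != x02 := blockers_neq bs i0 h01 i1 i2 b01 b02 n12.
have d2 : x01 != x12.
  by apply: (blockers_neq bs i1 h01 i0 i2 _ b12 n02); rewrite btw_sym.
have d3 : x02 != x12.
  by apply: (blockers_neq bs i2 h02 i0 i1 _ _ n01); rewrite btw_sym.
have c4 : (c < 4)%N by rewrite -c01 b4.
have h3 : (3 <= class_size s2 col c)%N.
  rewrite -size_class; apply: (@uniq_leq_size _ [:: x01; x02; x12]).
    by rewrite /= !inE negb_or d1 d2 d3.
  move=> x; rewrite !inE mem_class => /or3P [] /eqP ->.
  - by rewrite c01 eqxx andbT (in2 _ a0 a1).
  - by rewrite c02 eqxx andbT (in2 _ a0 a2).
  by rewrite c12 eqxx andbT (in2 _ a1 a2).
have /allP /(_ (class_size s2 col c)) : all (fun n => n <= 2)%N (sizes s2 col).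
  apply: allowed_zero => //; apply/mapP; exists 0%N; rewrite ?mem_iota //.
rewrite leqNgt h3 => H; suff: false by []; apply: H.
by apply/mapP; exists c; rewrite ?mem_iota.
Qed.

Lemma sizes_swap s col i j : blocked s col -> bounded s col ->
  sizes s col = [:: 3; 3; 3; 1]%N -> (i < 3)%N -> (j < 3)%N ->
  [/\ blocked s (swapn i j \o col), bounded s (swapn i j \o col) &
    sizes s (swapn i j \o col) = [:: 3; 3; 3; 1]%N].
Proof.
move=> bs b4 hz hi hj; split.
- exact: blocked_col (inv_inj (swapnK i j)) bs.
- move=> x hx; rewrite /= /swapn; case: ifP => _; first exact: ltn_trans hj _.
  by case: ifP => _; [exact: ltn_trans hi _|exact: b4].
rewrite -[RHS](_ : [seq nth 0 [:: 3; 3; 3; 1] k | k <- iota 0 4] = _)%N //.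
apply/eq_in_map => k; rewrite mem_iota /= => hk.
have hs : (swapn i j k < 4)%N.
  rewrite /swapn; case: ifP => _; first exact: ltn_trans hj _.
  by case: ifP => _ //; exact: ltn_trans hi _.
rewrite sizes_relabel; last exact: swapnK.
rewrite (sizes_eqP hz hs) /swapn.
by case: i hi {hs} => [|[|[|]]] // _; case: j hj => [|[|[|]]] // _; case: k hk => [|[|[|[|]]]].
Qed.

(** The blockers of the sides have colours 1 and 2 only. Either all agree, or exactly two do, and
    then the corner common to their sides is moved to the front. *)
Lemma single_avoids_class s col a0 a1 a2 x01 x02 x12 : hereditary (size s) ->
  blocked s col -> bounded s col -> sizes s col = [:: 3; 3; 3; 1]%N ->
  perm_eq (class s col 0) [:: a0; a1; a2] ->
  x01 \in s -> x02 \in s -> x12 \in s ->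
  btw x01 a0 a1 -> btw x02 a0 a2 -> btw x12 a1 a2 ->
  col x01 != 3%N -> col x02 != 3%N -> col x12 != 3%N -> False.
Proof.
move=> IH bs b4 hz hp h01 h02 h12 b01 b02 b12 n01 n02 n12.
have hin u : u \in [:: a0; a1; a2] -> u \in s /\ col u = 0%N.
  by rewrite -(perm_mem hp) mem_class => /andP [? /eqP].
have col12 x v w : v \in [:: a0; a1; a2] -> w \in [:: a0; a1; a2] -> x \in s -> btw x v w ->
    col x != 3%N -> col x = 1%N \/ col x = 2%N.
  move=> /hin [hv cv] /hin [hw _] hx hb n3.
  have [_] := blocked_btw_col bs hv hx hw hb; rewrite cv.
  by have := b4 x hx; move: n3; case: (col x) => [|[|[|[|]]]] // _ _ _; [left|right].
(* If the repeated colour is 2, the colours 1 and 2 are exchanged. *)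
have two u0 u1 u2 y01 y02 y12 : perm_eq (class s col 0) [:: u0; u1; u2] ->
    y01 \in s -> y02 \in s -> y12 \in s -> btw y01 u0 u1 -> btw y02 u0 u2 -> btw y12 u1 u2 ->
    col y01 = col y02 -> (col y01 = 1%N /\ col y12 = 2%N) \/ (col y01 = 2%N /\ col y12 =
      1%N) -> False.
  move=> hpu hy1 hy2 hy3 hb1 hb2 hb3 e [[e1 e2]|[e1 e2]].
    by apply: (two_one_blockers bs b4 hz hpu hy1 hy2 hy3); rewrite // -e.
  have [bs' b4' hz'] := sizes_swap bs b4 hz (isT : 1 < 3)%N (isT : 2 < 3)%N.
  apply: (two_one_blockers bs' b4' hz' _ hy1 hy2 hy3 hb1 hb2 hb3); rewrite /= -?e ?e1 ?e2 //.
  apply: etrans hpu; congr perm_eq; apply: eq_in_filter => x hx /=.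
  by case: (col x) => [|[|[|]]].
have [i0 i1 i2] : [/\ a0 \in [:: a0; a1; a2], a1 \in [:: a0; a1; a2] & a2 \in [:: a0; a1; a2]].
  by rewrite !inE !eqxx ?orbT.
have k1 := col12 _ _ _ i0 i1 h01 b01 n01; have k2 := col12 _ _ _ i0 i2 h02 b02 n02.
have k3 := col12 _ _ _ i1 i2 h12 b12 n12.
have [e|ne] := eqVneq (col x01) (col x02).
  have [e'|ne'] := eqVneq (col x01) (col x12).
    by apply: (triangle_few IH bs b4 hp h01 h02 h12 b01 b02 b12 (erefl (col x01))).
  apply: (two _ _ _ _ _ _ hp h01 h02 h12) => //.
  by case: k1 k3 ne' => -> [] -> //; [left|right].
have [e'|ne'] := eqVneq (col x01) (col x12).
  apply: (two a1 a0 a2 x01 x12 x02) => //; first by apply: perm_trans hp _; perm_tac.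
    by rewrite btw_sym.
  by case: k1 k2 ne => -> [] -> //; [left|right].
apply: (two a2 a0 a1 x02 x12 x01) => //.
- by apply: perm_trans hp _; perm_tac.
- by rewrite btw_sym.
- by rewrite btw_sym.
- by case: k1 k2 k3 ne ne' => -> [] -> [] ->.
by case: k1 k2 ne => -> [] -> //; [right|left].
Qed.

(** Exchanging the colours [i] and 0 reduces to class 0. If [D] blocked none of its pairs, no
    blocker of its three sides would have colour 3, since [D] is the only point of that colour. *)
Lemma single_blocks_class s col D i : hereditary (size s) -> blocked s col ->
  bounded s col -> sizes s col = [:: 3; 3; 3; 1]%N -> D \in s -> col D = 3%N ->
  (i < 3)%N -> exists p q, [/\ p \in s, q \in s, col p = i, col q = i & btw D p q].
Proof.
move=> IH bs b4 hz hD cD hi.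
suff : has (fun p => has (fun q => [&& col p == i, col q == i & btw D p q]) s) s.
  by case/hasP => p hp /hasP [q hq /and3P [/eqP cp /eqP cq hb]]; exists p, q.
apply/negPn/negP => /hasPn hno.
have [bs' b4' hz'] := sizes_swap bs b4 hz (isT : 0 < 3)%N hi.
set col' := swapn 0 i \o col in bs' b4' hz'.
have h0 x : (col' x == 0%N) = (col x == i).
  rewrite /col' /= /swapn; case: (eqVneq (col x) 0%N) => [->|n0]; first by rewrite eq_sym.
  by case: (eqVneq (col x) i) => //= _; exact: negbTE.
have h3 x : (col' x == 3%N) = (col x == 3%N).
  rewrite /col' /= /swapn; case: (eqVneq (col x) 0%N) => [->|_].
    by case: (i) hi => [|[|[|]]].
  by case: (eqVneq (col x) i) => [->|_] //; case: (i) hi => [|[|[|]]].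
have uniqD x : x \in s -> col x = 3%N -> x = D.
  move=> hx cx; have sz1 : size (class s col 3) = 1%N by rewrite size_class (sizes_eqP hz).
  have : x \in class s col 3 by rewrite mem_class hx cx.
  have : D \in class s col 3 by rewrite mem_class hD cD.
  by case: (class s col 3) sz1 => [|y [|]] // _; rewrite !inE => /eqP -> /eqP.
have sz3 : size (class s col' 0) = 3%N by rewrite size_class (sizes_eqP hz').
have us : uniq (class s col' 0) by rewrite filter_uniq //; case: bs.
have mem0 x : x \in class s col' 0 -> x \in s /\ col' x = 0%N.
  by rewrite mem_class => /andP [? /eqP].
move: sz3 us mem0; case E: (class s col' 0) => [|a0 [|a1 [|a2 [|]]]] // _.
rewrite /= !inE negb_or => /and3P [/andP [n01 n02] n12 _] mem0.
have [[i0 k0] [i1 k1] [i2 k2]] : [/\ a0 \in s /\ col' a0 = 0%N,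
  a1 \in s /\ col' a1 = 0%N & a2 \in s /\ col' a2 = 0%N].
  by split; apply: mem0; rewrite !inE eqxx ?orbT.
have blk v w : v \in s -> w \in s -> v != w -> col' v = 0%N -> col' w = 0%N ->
    exists x, [/\ x \in s, btw x v w & col' x != 3%N].
  move=> hv hw vw cv cw.
  have [|x [hx hb _]] := mono_blocker bs' hv hw vw; first by rewrite cv.
  exists x; split=> //; rewrite h3; apply/eqP => /(uniqD _ hx) eD; subst x.
  have /hasPn /(_ w hw) := hno v hv.
  by rewrite hb -!h0 cv cw eqxx.
have [x01 [hx1 hb1 hc1]] := blk _ _ i0 i1 n01 k0 k1.
have [x02 [hx2 hb2 hc2]] := blk _ _ i0 i2 n02 k0 k2.
have [x12 [hx3 hb3 hc3]] := blk _ _ i1 i2 n12 k1 k2.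
by apply: (single_avoids_class IH bs' b4' hz' _ hx1 hx2 hx3 hb1 hb2 hb3); rewrite ?E.
Qed.

Lemma not_3331 s col : hereditary (size s) -> blocked s col -> bounded s col ->
  sizes s col != [:: 3; 3; 3; 1]%N.
Proof.
move=> IH bs b4; apply/eqP => hz.
have : (0 < class_size s col 3)%N by rewrite (sizes_eqP hz).
rewrite -has_count => /hasP [D hD /eqP cD].
have [p0 [q0 [? ? ? ? h0]]] := single_blocks_class IH bs b4 hz hD cD (isT : 0 < 3)%N.
have [p1 [q1 [? ? ? ? h1]]] := single_blocks_class IH bs b4 hz hD cD (isT : 1 < 3)%N.
have [p2 [q2 [? ? ? ? h2]]] := single_blocks_class IH bs b4 hz hD cD (isT : 2 < 3)%N.
by apply: (single_blocks_all_classes bs b4 hz hD cD _ _ h0 h1 h2).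
Qed.

End Step.

(** * The classification *)

Section Classification.
Variable R : realType.
Local Notation plane := 'rV[R]_2.
Implicit Types (p q u v w x y z : plane) (s : seq plane) (col : plane -> nat).

Lemma removable_allowed s col n x : hereditary R n -> (size s <= n)%N -> blocked s col ->
  bounded s col -> x \in s -> removable s x -> allowed (decr (sizes s col) (col x)).
Proof.
move=> IH sn bs b4 hx hr; have [us _] := bs; rewrite -sizes_remove1 //.
apply: IH.
- apply: leq_trans sn; have := perm_named us (isT : uniq [:: x]) _.
  by move=> /(_ _) /perm_size -> //= y; rewrite inE => /eqP ->.
- by apply: blocked_remove bs; rewrite /= hr.
exact: remove_bounded.
Qed.

(** With the induction hypothesis this forces every point that blocks no pair into class 0, since a
    deletion must lead to allowed sizes. *)
Definition only_colour0 (t : seq nat) : bool :=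
  all (fun i => allowed (decr t i) ==> (i == 0%N)) (iota 0 4).

Lemma conf_exists_allowed s col n : hereditary R n -> (size s <= n)%N -> blocked s col ->
  bounded s col -> only_colour0 (sizes s col) -> class_size s col 0 = 4%N ->
  (exists A0 A1 A2 O, triangle_conf s col A0 A1 A2 O) \/
  (exists A0 A1 A2 A3, quad_conf s col A0 A1 A2 A3).
Proof.
move=> IH sn bs b4 /allP h0 h4; apply: conf_exists => // x hx hr.
have hin : col x \in iota 0 4 by rewrite mem_iota b4.
by have /implyP /(_ (removable_allowed IH sn bs b4 hx hr)) /eqP := h0 _ hin.
Qed.

Lemma corner_sizes s col (K L : seq plane) i : blocked s col ->
  perm_eq (class s col 0) (K ++ L) ->
  class_size [seq x <- s | x \notin K] col i =
  (class_size s col i - (if i == 0 then size K else 0))%N.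
Proof.
move=> [us _] hp.
have hK x : x \in K -> x \in s /\ col x = 0%N.
  have : x \in K -> x \in class s col 0 by rewrite (perm_mem hp) mem_cat => ->.
  by rewrite mem_class => h /h /andP [? /eqP].
have uK : uniq K.
  by have := filter_uniq (fun x => col x == 0%N) us; rewrite (perm_uniq hp) cat_uniq => /andP [].
rewrite sizes_remove // => [|x /hK []] //.
congr (_ - _)%N; rewrite /class_size; case: (eqVneq i 0%N) => [->|ni].
  by apply/eqP; rewrite -all_count; apply/allP => x /hK [_ ->].
apply/eqP; rewrite -leqn0 leqNgt -has_count; apply/hasPn => x /hK [_ ->].
by rewrite eq_sym.
Qed.

Lemma remove_allowed s col n (K : seq plane) : hereditary R n -> (size s <= n)%N ->
  blocked s col -> bounded s col -> all (removable s) K -> K != [::] -> {subset K <= s} ->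
  allowed (sizes [seq x <- s | x \notin K] col).
Proof.
move=> IH sn bs b4 hK K0 sub; apply: IH; last exact: remove_bounded.
  apply: leq_trans sn; rewrite size_filter ltn_neqAle count_size andbT -all_count.
  by case: K K0 sub {hK} => // x K _ sub; apply/allPn; exists x;
    [exact: sub (mem_head _ _)|rewrite mem_head].
exact: blocked_remove.
Qed.

(** The three corners block nothing and can be deleted together; [O] is what remains of class 0. *)
Lemma triangle_inner s col n A0 A1 A2 O : hereditary R n -> (size s <= n)%N ->
  blocked s col -> bounded s col -> triangle_conf s col A0 A1 A2 O ->
  allowed [seq class_size s col i - (if i == 0 then 3 else 0) | i <- iota 0 4]%N.
Proof.
move=> IH sn bs b4 hT; have [hp _ _] := hT.
have hp' : perm_eq (class s col 0) ([:: A0; A1; A2] ++ [:: O]) by [].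
have := remove_allowed IH sn bs b4 (triangle_corners hT) isT.
rewrite /sizes (eq_map (fun i => corner_sizes i bs hp')); apply.
move=> x hx; have : x \in class s col 0 by rewrite (perm_mem hp') mem_cat hx.
by rewrite mem_class => /andP [].
Qed.

Lemma quad_inner s col n A0 A1 A2 A3 : hereditary R n -> (size s <= n)%N ->
  blocked s col -> bounded s col -> quad_conf s col A0 A1 A2 A3 ->
  allowed [seq class_size s col i - (if i == 0 then 4 else 0) | i <- iota 0 4]%N.
Proof.
move=> IH sn bs b4 hT; have [hp _ _] := hT.
have hp' : perm_eq (class s col 0) ([:: A0; A1; A2; A3] ++ [::]) by rewrite cats0.
have := remove_allowed IH sn bs b4 (quad_corners hT) isT.
rewrite /sizes (eq_map (fun i => corner_sizes i bs hp')); apply.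
move=> x hx; have : x \in class s col 0 by rewrite (perm_mem hp') mem_cat hx.
by rewrite mem_class => /andP [].
Qed.

(* Nine points of this kind form a projective 3 x 3 grid, which cannot be extended. *)
Lemma no_grid_extension s z col : hereditary R (size s) -> blocked s col -> bounded s col ->
  sizes s col \in [:: [:: 4; 2; 2; 1]; [:: 4; 2; 1; 2]; [:: 4; 1; 2; 2]]%N ->
  blocked (z :: s) col -> (col z < 4)%N -> removable (z :: s) z -> False.
Proof.
move=> IH bs b4 hz bz cz hr.
have hs : size s = 9%N.
  by rewrite (size_sizes b4); move: hz; rewrite !inE => /or3P [] /eqP ->.
have h0 : only_colour0 (sizes s col).
  by move: hz; rewrite !inE => /or3P [] /eqP ->; exact: isT.
have h4 : class_size s col 0 = 4%N.
  by rewrite -(nth_sizes s col (isT : 0 < 4)%N); move: hz; rewrite !inE => /or3P [] /eqP ->.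
case: (conf_exists_allowed IH (leqnn _) bs b4 h0 h4) => -[A0 [A1 [A2 [O hT]]]].
  by have := triangle_10 bs b4 hT; rewrite hs.
exact: (quad_9_extended bs b4 hs bz cz hr hT).
Qed.

Lemma perm_remove1 s x : uniq s -> x \in s -> perm_eq s (x :: [seq y <- s | y \notin [:: x]]).
Proof.
by move=> us hx; apply: (perm_named us (isT : uniq [:: x])) => y; rewrite inE => /eqP ->.
Qed.

(** If some point of another class blocks nothing in [s], then without it [s] has sizes 4, 2, 2, 1
    in some order, and putting the point back contradicts [no_grid_extension]. Otherwise [s] lies in
    the hull of class 0, where convex position is impossible and the triangular position admits no
    extension by [z]. *)
Lemma no_4222_extension s z col : hereditary R (size s) -> blocked s col -> bounded s col ->
  sizes s col = [:: 4; 2; 2; 2]%N ->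
  blocked (z :: s) col -> (col z < 4)%N -> removable (z :: s) z -> False.
Proof.
move=> IH bs b4 hz bz cz hr; have [us _] := bs.
have hs : size s = 10%N by rewrite (size_sizes b4) hz.
have h4 : class_size s col 0 = 4%N by rewrite -(nth_sizes s col (isT : 0 < 4)%N) hz.
case: (boolP (has (fun x => removable s x && (col x != 0%N)) s)).
  case/hasP => x hx /andP [hrx cx].
  have hp := perm_remove1 us hx; set s' := filter _ _ in hp.
  have bs' : blocked s' col by apply: blocked_remove bs; rewrite /= hrx.
  have b4' : bounded s' col by exact: remove_bounded.
  have hsz : sizes s' col = decr [:: 4; 2; 2; 2]%N (col x) by rewrite sizes_remove1 ?hz.
  have ss : (size s' <= size s)%N by rewrite (perm_size hp).
  apply: (@no_grid_extension s' x col) => //.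
  - exact: hereditary_le IH.
  - by rewrite hsz; move: cx (b4 x hx); case: (col x) => [|[|[|[|]]]].
  - exact: blocked_perm hp bs.
  - exact: b4.
  by apply/removableP => v w; rewrite -!(perm_mem hp); exact: (removableP _ _ hrx).
move=> /hasPn hno.
case: (conf_exists bs h4) => [x hx hrx||] .
- by have := hno x hx; rewrite hrx negbK => /eqP.
- by case=> A0 [A1 [A2 [O hT]]]; apply: (triangle_10_extended bs b4 hs bz cz hr hT).
by case=> A0 [A1 [A2 [A3 hT]]]; apply: (quad_4222 bs b4 hz hT).
Qed.

Lemma removable_in_or s col (c : pred nat) :
  (exists x, [/\ x \in s, removable s x & c (col x)]) \/
  {in s, forall x, removable s x -> ~~ c (col x)}.
Proof.
case: (boolP (has (fun x => removable s x && c (col x)) s)) => [/hasP [x hx /andP [h1 h2]]|/hasPn h].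
  by left; exists x.
by right=> x hx hr; have := h x hx; rewrite hr.
Qed.

Lemma removed s x col n : hereditary R n -> (size s <= n)%N -> blocked s col -> bounded s col ->
  x \in s -> removable s x -> exists s', [/\ perm_eq s (x :: s'),
    hereditary R (size s'), blocked s' col, bounded s' col &
    sizes s' col = decr (sizes s col) (col x)] /\
  [/\ blocked (x :: s') col, (col x < 4)%N & removable (x :: s') x].
Proof.
move=> IH sn bs b4 hx hr; have [us _] := bs.
have hp := perm_remove1 us hx; exists [seq y <- s | y \notin [:: x]].
have hsz := perm_size hp.
split; split=> //.
- by apply: hereditary_le IH; rewrite (leq_trans _ sn) // hsz /=.
- by apply: blocked_remove bs; rewrite /= hr.
- exact: remove_bounded.
- exact: sizes_remove1.
- exact: blocked_perm hp bs.
- exact: b4.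
by apply/removableP => v w; rewrite -!(perm_mem hp); exact: (removableP _ _ hr).
Qed.

Lemma only0_removable s col n : hereditary R n -> (size s <= n)%N -> blocked s col ->
  bounded s col -> only_colour0 (sizes s col) -> {in s, forall x, removable s x -> col x = 0%N}.
Proof.
move=> IH sn bs b4 /allP h0 x hx hr.
have hin : col x \in iota 0 4 by rewrite mem_iota b4.
by have /implyP /(_ (removable_allowed IH sn bs b4 hx hr)) /eqP := h0 _ hin.
Qed.

(** All points that block nothing belong to the class of three, so its triangle contains the whole
    set. Deleting the three corners leaves two classes of two points, which is not allowed. *)
Lemma not_3220 s col : hereditary R (size s) -> blocked s col -> bounded s col ->
  sizes s col <> [:: 3; 2; 2; 0]%N.
Proof.
move=> IH bs b4 hz; have [us _] := bs.
have sz3 : size (class s col 0) = 3%N by rewrite size_class (sizes_eqP hz).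
have hrem : {in s, forall x, removable s x -> col x = 0%N}.
  by apply: (only0_removable IH) => //; rewrite hz.
have [a0 [a1 [a2 [hp ho]]]] : exists a0 a1 a2,
    perm_eq (class s col 0) [:: a0; a1; a2] /\ 0 < orient a0 a1 a2.
  have uc : uniq (class s col 0) by exact: filter_uniq.
  have mem0 x : x \in class s col 0 -> x \in s /\ col x = 0%N.
    by rewrite mem_class => /andP [? /eqP].
  move: sz3 uc mem0; case E: (class s col 0) => [|a0 [|a1 [|a2 [|]]]] // _.
  rewrite /= !inE negb_or => /and3P [/andP [n01 n02] n12 _] mem0.
  have [[i0 k0] [i1 k1] [i2 k2]] : [/\ a0 \in s /\ col a0 = 0%N,
    a1 \in s /\ col a1 = 0%N & a2 \in s /\ col a2 = 0%N].
    by split; apply: mem0; rewrite !inE eqxx ?orbT.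
  have o0 : orient a0 a1 a2 != 0 by apply: (mono_orient bs); rewrite ?k0 ?k1 ?k2.
  case: (ltgtP (orient a0 a1 a2) 0) o0 => // h _; last by exists a0, a1, a2.
  by exists a0, a2, a1; split; [perm_tac|rewrite orient_flip oppr_gt0].
have o1 : orient a1 a2 a0 = orient a0 a1 a2 by rewrite /orient; ring.
have o2 : orient a2 a0 a1 = orient a0 a1 a2 by rewrite /orient; ring.
have z1 p q : orient p q p = 0 by rewrite /orient; ring.
have z2 p q : orient p q q = 0 by rewrite /orient; ring.
have hull p q : {in [:: a0; a1;
  a2], forall x, 0 <= orient p q x} -> {in s, forall x, 0 <= orient p q x}.
  move=> h; apply: (@hull_orient _ _ (fun x => col x == 0%N)).
    by move=> x hx hr; rewrite (hrem x hx hr).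
  by move=> x hx hc; apply: h; rewrite -(perm_mem hp) mem_class hx.
have h01 : {in s, forall x, 0 <= orient a0 a1 x}.
  by apply: hull => x; rewrite !inE => /or3P [] /eqP ->; rewrite ?z1 ?z2 // ltW.
have h12 : {in s, forall x, 0 <= orient a1 a2 x}.
  by apply: hull => x; rewrite !inE => /or3P [] /eqP ->; rewrite ?z1 ?z2 // o1 ltW.
have h20 : {in s, forall x, 0 <= orient a2 a0 x}.
  by apply: hull => x; rewrite !inE => /or3P [] /eqP ->; rewrite ?z1 ?z2 // o2 ltW.
have hr : all (removable s) [:: a0; a1; a2].
  rewrite /= andbT; apply/and3P; split.
  - by apply: (@corner_removable _ _ a0 a1 a2); rewrite ?lt0r_neq0.
  - by apply: (@corner_removable _ _ a1 a2 a0); rewrite ?o1 ?lt0r_neq0.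
  by apply: (@corner_removable _ _ a2 a0 a1); rewrite ?o2 ?lt0r_neq0.
have hp' : perm_eq (class s col 0) ([:: a0; a1; a2] ++ [::]) by rewrite cats0.
have : allowed (sizes [seq x <- s | x \notin [:: a0; a1; a2]] col).
  apply: (remove_allowed IH) => // x hx.
  have : x \in class s col 0 by rewrite (perm_mem hp).
  by rewrite mem_class => /andP [].
by rewrite /sizes (eq_map (fun i => corner_sizes i bs hp')) /= !(sizes_eqP hz).
Qed.

Lemma no_minimal_forbidden s col : hereditary R (size s) -> blocked s col -> bounded s col ->
  sizes s col \notin minimal_forbidden.
Proof.
move=> IH bs b4; apply/negP; have [us _] := bs.
(* In convex position, deleting the corners empties class 0, and no other class may then exceed two
   points. *)
have quad t : sizes s col = t ->
    ~~ allowed [seq nth 0 t i - (if i == 0 then 4 else 0) | i <- iota 0 4]%N ->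
    ~ exists A0 A1 A2 A3, quad_conf s col A0 A1 A2 A3.
  move=> hz hn [A0 [A1 [A2 [A3 /(quad_inner IH (leqnn _) bs b4) h]]]].
  by case/negP: hn; rewrite -hz.
have triangle t : sizes s col = t ->
    ~~ allowed [seq nth 0 t i - (if i == 0 then 3 else 0) | i <- iota 0 4]%N ->
    ~ exists A0 A1 A2 O, triangle_conf s col A0 A1 A2 O.
  move=> hz hn [A0 [A1 [A2 [A3 /(triangle_inner IH (leqnn _) bs b4) h]]]].
  by case/negP: hn; rewrite -hz.
have small_triangle t : sizes s col = t -> (sumn t < 10)%N ->
    ~ exists A0 A1 A2 O, triangle_conf s col A0 A1 A2 O.
  move=> hz ht [A0 [A1 [A2 [O hT]]]]; have := triangle_10 bs b4 hT.
  by rewrite (size_sizes b4) hz leqNgt ht.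
have small_quad t : sizes s col = t -> (sumn t < 9)%N ->
    ~ exists A0 A1 A2 A3, quad_conf s col A0 A1 A2 A3.
  move=> hz ht [A0 [A1 [A2 [O hT]]]]; have := quad_9 bs b4 hT.
  by rewrite (size_sizes b4) hz leqNgt ht.
have conf t : sizes s col = t -> nth 0%N t 0 = 4%N ->
    {in s, forall x, removable s x -> col x = 0%N} ->
    (exists A0 A1 A2 O, triangle_conf s col A0 A1 A2 O) \/
    (exists A0 A1 A2 A3, quad_conf s col A0 A1 A2 A3).
  by move=> hz h4; apply: conf_exists; rewrite ?(sizes_eqP hz).
have only0 t : sizes s col = t -> only_colour0 t -> {in s, forall x, removable s x ->
  col x = 0%N}.
  by move=> hz h0; apply: (only0_removable IH); rewrite ?hz.
have colP t x : sizes s col = t -> x \in s -> removable s x -> allowed (decr t (col x)).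
  by move=> <- hx hr; exact: (removable_allowed IH).
have s0 t : sizes s col = t -> t != [:: 0; 0; 0; 0]%N -> s != [::].
  by move=> hz; apply: contraNneq => e; rewrite -hz e.
rewrite !inE.
case/orP => [/eqP hz|]; first by have /negP := small_refutes cert2 bs b4 hz; apply; exact: cert2E.
case/orP => [/eqP hz|]; first by have /negP := small_refutes cert22 bs b4 hz; apply; exact: cert22E.
case/orP => [/eqP hz|]; first by have /negP := small_refutes cert31 bs b4 hz; apply; exact: cert31E.
case/orP => [/eqP hz|]; first by have /negP := small_refutes cert311 bs b4 hz; apply; exact: cert311E.
case/orP => [/eqP hz|]; first by have /negP := small_refutes cert321 bs b4 hz; apply; exact: cert321E.
case/orP => [/eqP hz|]; first exact: (not_3220 IH bs b4 hz).
case/orP => [/eqP hz|]; first by have := not_3331 IH bs b4; rewrite hz.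
(* Sizes 4, 1, 1, 1 and, next, 4, 2, 1, 1: too few points for either position. *)
case/orP => [/eqP hz|].
  by case: (conf _ hz erefl (only0 _ hz isT));
    [exact: small_triangle hz _|exact: small_quad hz _].
case/orP => [/eqP hz|].
  by case: (conf _ hz erefl (only0 _ hz isT));
    [exact: small_triangle hz _|exact: small_quad hz _].
(* Sizes 4, 3, 1, 1: nine points are too few for the triangle, and the class of three excludes
   convex position. *)
case/orP => [/eqP hz|].
  by case: (conf _ hz erefl (only0 _ hz isT)); [exact: small_triangle hz _|exact: quad hz _].
(* Sizes 4, 3, 2, 1: outside class 0 only a deletion from class 1 leads to allowed sizes, namely 4,
   2, 2, 1. *)
case/orP => [/eqP hz|].
  have [[x [hx hr cx]]|hr0] := @removable_in_or s col (fun i => i != 0%N).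
    have [s' [[hp IH' bs' b4' hz'] [bx cx4 rx]]] := removed IH (leqnn _) bs b4 hx hr.
    apply: (no_grid_extension IH' bs' b4' _ bx cx4 rx); rewrite hz' hz.
    by move: cx cx4 (colP _ _ hz hx hr); case: (col x) => [|[|[|[|]]]].
  case: (conf _ hz erefl) => [x hx hr||]; last exact: quad hz _.
    by have := hr0 x hx hr; rewrite negbK => /eqP.
  by case=> A0 [A1 [A2 [O]]]; exact: triangle_4321.
(* Sizes 4, 3, 2, 2: likewise, with 4, 2, 2, 2 after a deletion from class 1. *)
case/orP => [/eqP hz|].
  have [[x [hx hr cx]]|hr0] := @removable_in_or s col (fun i => i != 0%N).
    have [s' [[hp IH' bs' b4' hz'] [bx cx4 rx]]] := removed IH (leqnn _) bs b4 hx hr.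
    apply: (no_4222_extension IH' bs' b4' _ bx cx4 rx); rewrite hz' hz.
    by move: cx cx4 (colP _ _ hz hx hr); case: (col x) => [|[|[|[|]]]].
  case: (conf _ hz erefl) => [x hx hr||]; last exact: quad hz _.
    by have := hr0 x hx hr; rewrite negbK => /eqP.
  by case=> A0 [A1 [A2 [O]]]; apply: triangle_11 => //; rewrite (size_sizes b4) hz.
case/orP => [/eqP hz|].
  case: (conf _ hz erefl (only0 _ hz isT)); last exact: quad hz _.
  by case=> A0 [A1 [A2 [O]]]; exact: triangle_12.
(* Sizes 4, 3, 3, 3: without the corners of the triangle they become 1, 3, 3, 3, which is
   forbidden. *)
case/orP => [/eqP hz|].
  by case: (conf _ hz erefl (only0 _ hz isT)); [exact: triangle hz _|exact: quad hz _].
(* Sizes 5, 2, 2, 1 and 5, 2, 2, 2: the deleted point has colour 0, and putting it back extends a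
   set with sizes 4, 2, 2, 1 or 4, 2, 2, 2. *)
case/orP => [/eqP hz|/eqP hz].
  have [x hx hr] := removable_exists (s0 _ hz isT).
  have cx := only0 _ hz isT x hx hr.
  have [s' [[hp IH' bs' b4' hz'] [bx cx4 rx]]] := removed IH (leqnn _) bs b4 hx hr.
  by apply: (no_grid_extension IH' bs' b4' _ bx cx4 rx); rewrite hz' hz cx.
have [x hx hr] := removable_exists (s0 _ hz isT).
have cx := only0 _ hz isT x hx hr.
have [s' [[hp IH' bs' b4' hz'] [bx cx4 rx]]] := removed IH (leqnn _) bs b4 hx hr.
by apply: (no_4222_extension IH' bs' b4' _ bx cx4 rx); rewrite hz' hz cx.
Qed.

(** Strong induction on the number of points. After relabelling, the sizes decrease, and deleting a
    point that blocks nothing shows that forbidden sizes would belong to [minimal_forbidden]. *)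
Lemma blocked_allowed s col : blocked s col -> bounded s col -> allowed (sizes s col).
Proof.
have [n] := ubnP (size s); elim: n s col => // n IH s col sn bs b4.
have IH' : hereditary R (size s).
  by move=> s' col' hs'; apply: IH; exact: leq_trans hs' sn.
have [f [fi b4' hz]] := relabel b4.
have bs' := blocked_col fi bs.
rewrite -[allowed _](allowed_perm (permEl (perm_sort geq _))) -hz.
apply/negPn/negP => hn.
have s0 : s != [::] by apply: contraNneq hn => ->.
have [x hx hr] := removable_exists s0.
have hd := removable_allowed IH' (leqnn _) bs' b4' hx hr.
have hpos : (0 < nth 0 (sizes s (f \o col)) ((f \o col) x))%N.
  by rewrite nth_sizes ?b4' // -has_count; apply/hasP; exists x.
have := no_minimal_forbidden IH' bs' b4'.
have := sort_sorted geq_total (sizes s col); rewrite -hz.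
move: hd hpos hn; have := b4' x hx; rewrite /sizes /=.
move=> h4 hd hpos hn /and4P [h1 h2 h3 _] /negP; apply.
exact: (minimal_forbiddenP h1 h2 h3 h4 hpos hn hd).
Qed.

End Classification.

(** * Configurations that realise the allowed sizes *)

(* [orient v x w == 0] and [0 < inner_dot x v w] with the negative terms moved
   to the other side. *)
Definition nat_btw (x v w : nat * nat) : bool :=
  ((x.1 * w.2 + v.1 * x.2 + v.2 * w.1)%N == (x.2 * w.1 + v.2 * x.1 + v.1 * w.2)%N) &&
  (x.1 * x.1 + v.1 * w.1 + (x.2 * x.2 + v.2 * w.2) <
   x.1 * w.1 + v.1 * x.1 + (x.2 * w.2 + v.2 * x.2))%N.

Definition class_of (cs : seq (seq (nat * nat))) (p : nat * nat) : nat :=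
  find (fun c => p \in c) cs.

(** All coordinates are natural numbers, so the validity of a configuration is decided by
    computation, independently of the real field. *)
Definition valid (cs : seq (seq (nat * nat))) : bool :=
  let s := flatten cs in
  [&& uniq s,
    all (fun v => all (fun w => (v != w) ==>
      (has (fun x => nat_btw x v w) s == (class_of cs v == class_of cs w))) s) s,
    all (fun p => class_of cs p < 4)%N s
  & [seq count (fun p => class_of cs p == i) s | i <- iota 0 4] == map size cs].

Section Configurations.
Variable R : realType.
Local Notation plane := 'rV[R]_2.

Definition point (p : nat * nat) : plane :=
  \row_(j < 2) (if j == 0 then p.1%:R else p.2%:R).

Lemma px_point p : px (point p) = p.1%:R.
Proof. by rewrite /px mxE. Qed.

Lemma py_point p : py (point p) = p.2%:R.
Proof. by rewrite /py mxE. Qed.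

Lemma point_inj : injective point.
Proof.
move=> [a b] [c d] e; have := px_point (a, b); have := py_point (a, b).
rewrite e px_point py_point => /eqP; rewrite eqr_nat => /eqP /= -> /eqP.
by rewrite eqr_nat => /eqP /= ->.
Qed.

Lemma btw_point x v w : btw (point x) (point v) (point w) = nat_btw x v w.
Proof.
rewrite /btw /orient /inner_dot !px_point !py_point /nat_btw.
rewrite -(eqr_nat R) -(ltr_nat R) !natrD !natrM.
by congr (_ && _); [rewrite -[RHS]subr_eq0; congr (_ == 0); ring |
  rewrite -[RHS]subr_gt0; congr (0 < _); ring].
Qed.

Lemma valid_representable cs a b c d : valid cs ->
  perm_eq [:: a; b; c; d] (map size cs) -> representable R [tuple a; b; c; d].
Proof.
case/and4P; set t := flatten cs => ut /allP ht /allP h4 /eqP hc hp; apply/representableP.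
pose s := map point t.
pose col x := nth 0%N (map (class_of cs) t) (index x s).
have colE p : p \in t -> col (point p) = class_of cs p.
  move=> hpt; rewrite /col (index_map point_inj) (nth_map p) ?index_mem //.
  by rewrite nth_index.
exists s, col; split.
- split; first by rewrite map_inj_uniq //; exact: point_inj.
  move=> _ _ /mapP [v hv ->] /mapP [w hw ->]; rewrite (inj_eq point_inj) => vw.
  have /allP /(_ _ hw) := ht _ hv; rewrite vw !colE // => /eqP <-.
  by rewrite has_map; apply: eq_has => x /=; rewrite btw_point.
- by move=> _ /mapP [v hv ->]; rewrite colE // h4.
rewrite (_ : map _ _ = map size cs) // -hc; apply: eq_map => i.
rewrite /class_size count_map; apply: eq_in_count => p hpt /=.
by rewrite colE.
Qed.

End Configurations.

Local Close Scope ring_scope.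

(** One configuration for each of the sixteen multisets: fourteen with entries from 1 to 3, and the
    two with an entry 4. *)
Definition configurations : seq (seq (seq (nat * nat))) := [::
  [:: [:: (0, 4)]; [:: (1, 1)]; [:: (2, 1)]; [:: (2, 2)]];
  [:: [:: (2, 1); (2, 3)]; [:: (0, 4)]; [:: (1, 1)]; [:: (2, 2)]];
  [:: [:: (0, 4); (4, 0)]; [:: (2, 1); (2, 3)]; [:: (1, 1)]; [:: (2, 2)]];
  [:: [:: (1, 3); (4, 0); (4, 3)]; [:: (2, 2)]; [:: (3, 3)]; [:: (4, 1)]];
  [:: [:: (0, 4); (4, 0)]; [:: (1, 1); (4, 1)]; [:: (2, 1); (2, 3)]; [:: (2, 2)]];
  [:: [:: (1, 0); (3, 2); (3, 4)]; [:: (2, 1); (2, 4)]; [:: (2, 2)]; [:: (3, 3)]];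
  [:: [:: (0, 4); (4, 0)]; [:: (1, 1); (3, 1)]; [:: (2, 1); (4, 3)]; [:: (3, 0); (3, 2)]];
  [:: [:: (0, 4); (4, 0); (4, 2)]; [:: (1, 1); (4, 1)]; [:: (2, 1); (2, 3)]; [:: (2, 2)]];
  [:: [:: (0, 2); (0, 4); (4, 2)]; [:: (0, 3); (4, 1); (4, 3)]; [:: (2, 2)]; [:: (2, 3)]];
  [:: [:: (1, 2); (3, 0); (3, 4)]; [:: (0, 4); (2, 2)]; [:: (1, 3); (3, 3)]; [:: (2, 1);
    (2, 3)]];
  [:: [:: (2, 2); (2, 4); (4, 2)]; [:: (2, 3); (4, 1); (4, 3)]; [:: (1, 1); (3, 3)]; [::
    (3, 2)]];
  [:: [:: (0, 1); (0, 3); (2, 1); (2, 3)]; [:: (0, 2); (2, 2)]; [:: (1, 1); (1, 3)]; [::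
    (1, 2)]];
  [:: [:: (0, 4); (2, 2); (4, 4)]; [:: (1, 2); (3, 0); (3, 4)]; [:: (1, 3); (3, 3)]; [::
    (2, 1); (2, 3)]];
  [:: [:: (0, 0); (0, 6); (2, 4); (6, 6)]; [:: (0, 1); (4, 5)]; [:: (1, 2); (1, 6)]; [::
    (1, 5); (5, 5)]];
  [:: [:: (0, 1); (4, 3); (4, 5)]; [:: (2, 2); (4, 4); (6, 2)]; [:: (3, 4); (5, 2); (5,
    4)]; [:: (3, 3); (5, 3)]];
  [:: [:: (0, 0); (2, 4); (4, 4)]; [:: (1, 2); (1, 6); (3, 4)]; [:: (1, 3); (3, 3); (3,
    5)]; [:: (2, 3); (2, 5); (6, 5)]]].

Lemma configurations_valid : all valid configurations.
Proof. exact: isT. Qed.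

Lemma existence (R : realType) a b c d :
  (0 < a)%N -> (0 < b)%N -> (0 < c)%N -> (0 < d)%N ->
  [\/ perm_eq [:: a; b; c; d] [:: 4; 2; 2; 1],
      perm_eq [:: a; b; c; d] [:: 4; 2; 2; 2]
    | [/\ (a <= 3)%N, (b <= 3)%N, (c <= 3)%N & (d <= 3)%N] /\
      ~~ perm_eq [:: a; b; c; d] [:: 3; 3; 3; 1]] ->
  representable R [tuple a; b; c; d].
Proof.
move=> ha hb hc hd h.
suff /hasP [cs hcs hp] : has (fun cs => perm_eq [:: a; b; c; d] (map size cs)) configurations.
  by apply: (@valid_representable R cs) => //; exact: (allP configurations_valid).
case: h => [h|h|[[h1 h2 h3 h4] h5]].
(* Counting from 0, number 11 is the ordinary 3 x 3 grid and number 13 has sizes 4, 2, 2, 2. *)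
- by apply/hasP; exists (nth [::] configurations 11).
- by apply/hasP; exists (nth [::] configurations 13).
have H : all (fun a => all (fun b => all (fun c => all (fun d =>
    perm_eq [:: a; b; c; d] [:: 3; 3; 3; 1] ||
    has (fun cs => perm_eq [:: a; b; c; d] (map size cs)) configurations)
  (iota 1 3)) (iota 1 3)) (iota 1 3)) (iota 1 3) by [].
have m3 n : (0 < n)%N -> (n <= 3)%N -> n \in iota 1 3 by rewrite mem_iota => -> /=.
move/allP/(_ _ (m3 _ ha h1))/allP/(_ _ (m3 _ hb h2))/allP/(_ _ (m3 _ hc h3))/allP/(_ _ (m3
  _ hd h4)): H.
by rewrite (negbTE h5).
Qed.

Lemma allowedP a b c d : (0 < a)%N -> (0 < b)%N -> (0 < c)%N -> (0 < d)%N ->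
  allowed [:: a; b; c; d] ->
  [\/ perm_eq [:: a; b; c; d] [:: 4; 2; 2; 1],
      perm_eq [:: a; b; c; d] [:: 4; 2; 2; 2]
    | [/\ (a <= 3)%N, (b <= 3)%N, (c <= 3)%N & (d <= 3)%N] /\
      ~~ perm_eq [:: a; b; c; d] [:: 3; 3; 3; 1]].
Proof.
move=> ha hb hc hd; rewrite /allowed.
set t := [:: a; b; c; d].
have hp : perm_eq (sort geq t) t by rewrite perm_sort.
have hs := sort_sorted geq_total t.
have pos : all (fun n => 0 < n)%N t by rewrite /= ha hb hc hd.
case E: (sort geq t) => [|x [|y [|z [|w [|]]]]] //=.
have pos' : all (fun n => 0 < n)%N [:: x; y; z; w] by rewrite -E (perm_all _ hp).
case/and5P: pos' => x0 y0 z0 w0 _.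
rewrite gtn_eqF //; rewrite E in hp hs; case/or3P => [/andP [x3 n3]|/eqP e|/eqP e].
- constructor 3.
  have /and4P [yx zy wz _] := hs.
  have h3 : all (fun n => n <= 3)%N t.
    rewrite -(perm_all _ hp) /= x3 (leq_trans yx x3) (leq_trans zy (leq_trans yx x3)).
    by rewrite (leq_trans wz (leq_trans zy (leq_trans yx x3))).
  split; first by case/and5P: h3.
  apply: contra n3 => h; have := perm_trans hp h.
  move/(perm_sortP geq_total geq_trans geq_anti).
  by rewrite (sorted_sort geq_trans hs) => ->.
- by constructor 1; rewrite -e perm_sym.
by constructor 2; rewrite -e perm_sym.
Qed.

Theorem theorem23 (R : realType) (a b c d : nat)
    (ha : (0 < a)%N) (hb : (0 < b)%N) (hc : (0 < c)%N) (hd : (0 < d)%N) :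
  representable R [tuple a; b; c; d] <->
  [\/ perm_eq [:: a; b; c; d] [:: 4; 2; 2; 1],
      perm_eq [:: a; b; c; d] [:: 4; 2; 2; 2]
    | [/\ (a <= 3)%N, (b <= 3)%N, (c <= 3)%N & (d <= 3)%N] /\
      ~~ perm_eq [:: a; b; c; d] [:: 3; 3; 3; 1]].
Proof.
split; last exact: existence.
case/representableP => s [col [bs b4 hp]].
apply: allowedP => //; rewrite (allowed_perm hp).
exact: blocked_allowed.
Qed.
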